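(* Let $f\in\mathcal{S}$ and let $\gamma_2,\gamma_3$ be its logarithmic coefficients. Then $$|\gamma_3|-|\gamma_2|\le \frac{1}{\sqrt{5}}.$$
   Context: Let $\mathbb{D}=\{z\in\mathbb{C}:|z|<1\}$. $\mathcal{S}$ denotes the class of functions $f$ analytic and univalent in $\mathbb{D}$ with the normalization $f(z)=z+a_2z^2+a_3z^3+\cdots$ (i.e. $f(0)=0$, $f'(0)=1$). The logarithmic coefficients $\gamma_n$ of $f\in\mathcal{S}$ are defined by $$\log\frac{f(z)}{z}=2\sum_{n=1}^{\infty}\gamma_n z^n,\qquad z\in\mathbb{D},$$ where the branch of the logarithm is the one equal to $0$ at $z=0$. In particular $\gamma_2=\tfrac12\left(a_3-\tfrac12a_2^2\right)$ and $\gamma_3=\tfrac12\left(a_4-a_2a_3+\tfrac13a_2^3\right)$. *)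

(* Defs.v *)
From Stdlib Require Import Reals.
From Coquelicot Require Import Coquelicot.
Open Scope C_scope.

Definition in_unit_disk (z : C) : Prop := (Cmod z < 1)%R.

(* f belongs to the class S, with Taylor coefficients a (f(z) = sum a_n z^n):
   f is analytic in D, given by its power series at 0 converging on all of D,
   normalized by f(0) = 0 (a_0 = 0) and f'(0) = 1 (a_1 = 1), and univalent
   (injective) in D. *)
Definition class_S (f : C -> C) (a : nat -> C) : Prop :=
  a 0%nat = 0 /\ a 1%nat = 1 /\
  (forall z, in_unit_disk z -> is_pseries a z (f z)) /\
  (forall z w, in_unit_disk z -> in_unit_disk w -> f z = f w -> z = w).

Definition gamma2 (a : nat -> C) : C :=
  / 2 * (a 3%nat - / 2 * (a 2%nat * a 2%nat)).
Definition gamma3 (a : nat -> C) : C :=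
  / 2 * (a 4%nat - a 2%nat * a 3%nat + / 3 * (a 2%nat * a 2%nat * a 2%nat)).

(* Main.v *)
(* Let F be the odd univalent function with F(z)^2 = f(z^2) and F(z) = z + b_3 z^3 + b_5 z^5 + ... . The
   coefficients of z and z^5 in 1/F are -a and -w, where a = b_3 and w = b_7 - 2 b_3 b_5 + b_3^3, so the
   area theorem gives |a|^2 + 5 |w|^2 <= 1. As gamma_3 - a gamma_2 = w - a^3/6 and |a| <= 1,
     |gamma_3| - |gamma_2| <= |w| + |a|^3/6 <= sqrt ((1 - |a|^2)/5) + |a|^3/6 <= 1/sqrt 5.

   The area estimate is a Grunsky inequality, and it follows from the positivity of a discrete logarithmic
   energy. Put real charges x_i of total 0 at the points p_i = F(r w^i), with w a primitive N-th root of
   unity. The kernel k(p,q) = 1 - |p-q|^2 / ((1+|p|^2) (1+|q|^2)) = |1 + p conj q|^2 / ((1+|p|^2) (1+|q|^2))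
   is positive, hence so is -log (1 - s k) for 0 <= s < 1, and for s close to 1 the energy is about
   - sum x_i x_j log |p_i - p_j|^2. It splits into the energy of the points r w^i, a computation with
   roots of unity, and a sum of the logarithms of |(F(z) - F(z')) / (z - z')|^2, which for large N picks
   Taylor coefficients of the logarithm of the divided difference of F.

   Integration is avoided throughout: Cauchy estimates are averages over roots of unity, and the reciprocal
   of a power series without zeros in the disk is extended to the whole disk by Neumann series. *)

Require Import Defs.
From Stdlib Require Import Reals Lra Lia Arith Classical.
From Coquelicot Require Import Coquelicot.
Open Scope C_scope.

(** * Absolutely convergent complex series *)

(** The kernel must lie in [0,1] and equal 1 on the diagonal for points anywhere in the plane; this
    forces the denominators [(1+|p|^2)], and they do no harm: each depends on one point only, so
    total charge 0 cancels its logarithm. The charges are trigonometric with frequencies 1 and 5.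
    The logarithm of the divided difference is a sum of homogeneous polynomials in (z, z'), and a
    monomial z^p z'^q is seen by such charges only for p, q in {1, 5}, that is in degrees 2, 6 and
    10 (up to aliasing in degrees near N, which is negligible). Degree 2 yields b_3, degree 6 yields
    w, and degree 10 yields a number that is never computed. The roots of unity themselves
    contribute the weights 1 and 1/5 of the two frequencies, which is the source of the 5 in the
    statement. Two obstacles shape the rest. On the diagonal the divided difference is F', so F'
    must be shown to be free of zeros before a logarithm exists. And N tends to infinity while
    nearby points merge, so every constant has to be fixed before N, uniformly over all pairs of
    points. *)

Fixpoint rsum (u : nat -> R) (n : nat) : R :=
  match n with O => 0%R | S m => (rsum u m + u m)%R end.
Fixpoint csum (u : nat -> C) (n : nat) : C :=
  match n with O => 0 | S m => csum u m + u m end.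

Lemma csum_ext u v n : (forall i, (i < n)%nat -> u i = v i) -> csum u n = csum v n.
Proof.
  induction n; intros H; simpl; [reflexivity|].
  rewrite IHn, H by (try intros; try apply H; lia); reflexivity.
Qed.
Lemma rsum_ext u v n : (forall i, (i < n)%nat -> u i = v i) -> rsum u n = rsum v n.
Proof.
  induction n; intros H; simpl; [reflexivity|].
  rewrite IHn, H by (try intros; try apply H; lia); reflexivity.
Qed.
Lemma csum_plus u v n : csum (fun i => u i + v i) n = csum u n + csum v n.
Proof. induction n; simpl; [ring|rewrite IHn; ring]. Qed.
Lemma csum_scal c u n : csum (fun i => c * u i) n = c * csum u n.
Proof. induction n; simpl; [ring|rewrite IHn; ring]. Qed.
Lemma csum_0 n : csum (fun _ => 0) n = 0.
Proof. induction n; simpl; [ring|rewrite IHn; ring]. Qed.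
Lemma csum_const c n : csum (fun _ => c) n = INR n * c.
Proof.
  induction n; [simpl; ring|]. simpl csum. rewrite IHn, S_INR, RtoC_plus. ring.
Qed.
Lemma csum_swap (U : nat -> nat -> C) m n :
  csum (fun i => csum (fun j => U i j) n) m = csum (fun j => csum (fun i => U i j) m) n.
Proof.
  induction m; simpl; [now rewrite csum_0|]. now rewrite IHm, csum_plus.
Qed.
Lemma csum_delta k (c : C) M : csum (fun n => if Nat.eq_dec n k then c else 0) M = if le_lt_dec M k then 0 else c.
Proof.
  induction M; cbn [csum]; [destruct (le_lt_dec 0 k); [reflexivity|lia]|].
  rewrite IHM. destruct (le_lt_dec M k), (le_lt_dec (S M) k), (Nat.eq_dec M k); try lia; ring.
Qed.
Lemma rsum_plus u v n : rsum (fun i => u i + v i)%R n = (rsum u n + rsum v n)%R.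
Proof. induction n; simpl; [ring|rewrite IHn; ring]. Qed.
Lemma rsum_scal c u n : rsum (fun i => c * u i)%R n = (c * rsum u n)%R.
Proof. induction n; simpl; [ring|rewrite IHn; ring]. Qed.
Lemma rsum_const c n : rsum (fun _ => c) n = (INR n * c)%R.
Proof. induction n; [simpl; ring|]. simpl rsum. rewrite IHn, S_INR. ring. Qed.
Lemma rsum_le u v n : (forall i, (i < n)%nat -> (u i <= v i)%R) -> (rsum u n <= rsum v n)%R.
Proof.
  induction n; intros H; simpl; [lra|].
  apply Rplus_le_compat; [apply IHn; intros|]; apply H; lia.
Qed.
Lemma Re_csum u n : Re (csum u n) = rsum (fun i => Re (u i)) n.
Proof. induction n; simpl; [reflexivity|now rewrite <- IHn]. Qed.
Lemma RtoC_rsum u n : RtoC (rsum u n) = csum (fun i => RtoC (u i)) n.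
Proof. induction n; simpl; [reflexivity|now rewrite RtoC_plus, IHn]. Qed.
Lemma Cmod_csum u n : (Cmod (csum u n) <= rsum (fun i => Cmod (u i)) n)%R.
Proof.
  induction n; simpl; [rewrite Cmod_0; lra|].
  eapply Rle_trans; [apply Cmod_triangle|lra].
Qed.

(** Built on the total function [Series], so a divergent series also has a value; the linearity and
    product laws therefore ask for [asum]. *)
Definition cseries (u : nat -> C) : C :=
  (Series (fun n => Re (u n)), Series (fun n => Im (u n))).
Definition asum (u : nat -> C) : Prop := ex_series (fun n => Cmod (u n)).

Lemma im_le_Cmod (c : C) : (Rabs (Im c) <= Cmod c)%R.
Proof. eapply Rle_trans; [|apply Rmax_Cmod]. apply Rmax_r. Qed.

Lemma asum_le u (v : nat -> R) :
  (forall n, (Cmod (u n) <= v n)%R) -> ex_series v -> asum u.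
Proof.
  intros H Hv. apply (ex_series_le (V := R_CompleteNormedModule) _ v); [|exact Hv].
  intros n. unfold norm; simpl; unfold abs; simpl.
  rewrite Rabs_pos_eq; [apply H|apply Cmod_ge_0].
Qed.
Lemma asum_re u : asum u -> ex_series (fun n => Re (u n)).
Proof.
  intros H. apply (ex_series_le (V := R_CompleteNormedModule) _ _ (fun n => re_le_Cmod (u n)) H).
Qed.
Lemma asum_im u : asum u -> ex_series (fun n => Im (u n)).
Proof.
  intros H. apply (ex_series_le (V := R_CompleteNormedModule) _ _ (fun n => im_le_Cmod (u n)) H).
Qed.
Lemma asum_ext u v : (forall n, u n = v n) -> asum u -> asum v.
Proof. intros H. apply ex_series_ext. intros n. now rewrite H. Qed.
Lemma asum_plus u v : asum u -> asum v -> asum (fun n => u n + v n).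
Proof.
  intros Hu Hv. apply (asum_le _ (fun n => Cmod (u n) + Cmod (v n))%R).
  - intros n. apply Cmod_triangle.
  - apply (ex_series_plus (V := R_NormedModule) _ _ Hu Hv).
Qed.
Lemma asum_scal c u : asum u -> asum (fun n => c * u n).
Proof.
  intros Hu. apply (asum_le _ (fun n => Cmod c * Cmod (u n))%R).
  - intros n. rewrite Cmod_mult. lra.
  - apply (ex_series_scal (V := R_NormedModule) (Cmod c) _ Hu).
Qed.
Lemma asum_csum (U : nat -> nat -> C) N : (forall j, asum (U j)) ->
  asum (fun n => csum (fun j => U j n) N).
Proof.
  intros H. induction N; simpl.
  - apply (asum_le _ (fun _ => 0)%R); [intros n; rewrite Cmod_0; lra|].
    exists 0%R. apply is_series_Reals. intros e He. exists O. intros n _.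
    rewrite sum_eq_R0 by reflexivity. rewrite R_dist_eq. lra.
  - apply asum_plus; auto.
Qed.
Lemma asum_shift u N : asum u -> asum (fun n => u (N + n)%nat).
Proof. intros H. now apply (ex_series_incr_n (fun n => Cmod (u n)) N). Qed.

Lemma cseries_ext u v : (forall n, u n = v n) -> cseries u = cseries v.
Proof. intros H. unfold cseries. f_equal; apply Series_ext; intros n; now rewrite H. Qed.
Lemma cseries_plus u v : asum u -> asum v -> cseries (fun n => u n + v n) = cseries u + cseries v.
Proof.
  intros Hu Hv. unfold cseries. apply injective_projections; simpl.
  - rewrite <- Series_plus by now apply asum_re. reflexivity.
  - rewrite <- Series_plus by now apply asum_im. reflexivity.
Qed.
Lemma cseries_scal c u : asum u -> cseries (fun n => c * u n) = c * cseries u.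
Proof.
  intros Hu. unfold cseries. apply injective_projections; simpl.
  - rewrite <- !Series_scal_l, <- Series_minus.
    + reflexivity.
    + apply (ex_series_scal (V := R_NormedModule) (fst c)), (asum_re _ Hu).
    + apply (ex_series_scal (V := R_NormedModule) (snd c)), (asum_im _ Hu).
  - rewrite <- !Series_scal_l, <- Series_plus.
    + reflexivity.
    + apply (ex_series_scal (V := R_NormedModule) (fst c)), (asum_im _ Hu).
    + apply (ex_series_scal (V := R_NormedModule) (snd c)), (asum_re _ Hu).
Qed.
Lemma Re_cseries u : Re (cseries u) = Series (fun n => Re (u n)).
Proof. reflexivity. Qed.
Lemma cseries_0 : cseries (fun _ => 0) = 0.
Proof.
  unfold cseries. apply injective_projections; simpl;
  (apply is_series_unique, is_series_Reals; intros e He; exists O; intros n _;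
    rewrite sum_eq_R0 by reflexivity; rewrite R_dist_eq; lra).
Qed.
Lemma cseries_csum (U : nat -> nat -> C) N : (forall j, asum (U j)) ->
  cseries (fun n => csum (fun j => U j n) N) = csum (fun j => cseries (U j)) N.
Proof.
  intros H. induction N; simpl; [apply cseries_0|].
  rewrite cseries_plus, IHN; auto. now apply asum_csum.
Qed.

(** The componentwise definition loses the sharp triangle inequality. It is recovered by rotation:
    with S the sum, |S|^2 = Re (conj S * S) is the real series of Re (conj S * u_n), whose terms are
    at most |S| |u_n|. *)
Lemma cseries_bound u : asum u -> (Cmod (cseries u) <= Series (fun n => Cmod (u n)))%R.
Proof.
  intros Hu. destruct (Ceq_dec (cseries u) 0) as [E|E].
  - rewrite E, Cmod_0. rewrite <- (Rmult_0_l (Series (fun n => Cmod (u n)))), <- Series_scal_l.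
    apply Series_le; [|exact Hu]. intros n. pose proof (Cmod_ge_0 (u n)); lra.
  - assert (P := proj1 (Cmod_gt_0 _) E).
    apply (Rmult_le_reg_l (Cmod (cseries u))); [exact P|].
    assert (Q : (Cmod (cseries u) * Cmod (cseries u) = Re (Cconj (cseries u) * cseries u))%R).
    { generalize (cseries u). intros z. assert (S := Cmod2_alt z). destruct z as [x y].
      unfold Re, Im in S. simpl fst in S; simpl snd in S. unfold Re, Cconj, Cmult. simpl fst; simpl snd. lra. }
    rewrite Q, <- cseries_scal, Re_cseries, <- Series_scal_l by exact Hu.
    apply Rle_trans with (Series (fun n => Rabs (Re (Cconj (cseries u) * u n)))).
    + eapply Rle_trans; [apply Rle_abs|]. apply Series_Rabs.
      apply (ex_series_le (V := R_CompleteNormedModule) _ (fun n => Cmod (Cconj (cseries u) * u n))%R).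
      * intros n. unfold norm; simpl; unfold abs; simpl. rewrite Rabs_Rabsolu. exact (re_le_Cmod (Cconj (cseries u) * u n)).
      * now apply asum_scal.
    + apply Series_le.
      * intros n. split; [apply Rabs_pos|]. eapply Rle_trans; [exact (re_le_Cmod (Cconj (cseries u) * u n))|].
        rewrite Cmod_mult, Cmod_conj. lra.
      * apply (ex_series_scal (V := R_NormedModule) (Cmod (cseries u)) _ Hu).
Qed.

Lemma cseries_split u N : asum u -> cseries u = csum u N + cseries (fun n => u (N + n)%nat).
Proof.
  intros Hu. induction N.
  - simpl. rewrite Cplus_0_l. reflexivity.
  - rewrite IHN. simpl. rewrite <- Cplus_assoc. f_equal.
    assert (H := asum_shift u N Hu).
    unfold cseries. apply injective_projections; simpl.
    + rewrite Series_incr_1 by now apply (asum_re (fun n => u (N + n)%nat)).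
      rewrite Nat.add_0_r. apply f_equal, Series_ext. intros n. do 2 f_equal; lia.
    + rewrite Series_incr_1 by now apply (asum_im (fun n => u (N + n)%nat)).
      rewrite Nat.add_0_r. apply f_equal, Series_ext. intros n. do 2 f_equal; lia.
Qed.

Lemma series_tail (v : nat -> R) : ex_series v -> forall eps, (0 < eps)%R ->
  exists N0, forall N, (N0 <= N)%nat -> (Rabs (Series (fun n => v (N + n)%nat)) < eps)%R.
Proof.
  intros Hv eps He. destruct Hv as [l Hl].
  assert (H := proj1 (is_series_Reals _ _) Hl eps He). destruct H as [N0 H].
  exists (S N0). intros N HN. specialize (H (pred N) ltac:(lia)).
  assert (E := Series_incr_n v N ltac:(lia) (ex_intro _ l Hl)).
  rewrite (is_series_unique _ _ Hl) in E. unfold Rdist in H.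
  replace (Series (fun k => v (N + k)%nat)) with (- (sum_f_R0 v (pred N) - l))%R by lra.
  now rewrite Rabs_Ropp.
Qed.

Lemma geom_series q : (0 <= q < 1)%R -> is_series (fun n => q ^ n)%R (/ (1 - q))%R.
Proof. intros H. apply is_series_geom. rewrite Rabs_pos_eq; lra. Qed.
Lemma geom_scal_series A q : (0 <= q < 1)%R -> is_series (fun n => A * q ^ n)%R (A / (1 - q))%R.
Proof.
  intros H. apply (is_series_scal (V := R_NormedModule) A), geom_series, H.
Qed.
Lemma asum_geom u A q : (0 <= q < 1)%R -> (forall n, Cmod (u n) <= A * q ^ n)%R -> asum u.
Proof.
  intros Hq H. apply (asum_le _ _ H). eexists. now apply geom_scal_series.
Qed.
Lemma cseries_geom u A q : (0 <= q < 1)%R -> (forall n, Cmod (u n) <= A * q ^ n)%R ->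
  (Cmod (cseries u) <= A / (1 - q))%R.
Proof.
  intros Hq H. eapply Rle_trans; [apply cseries_bound, (asum_geom _ _ _ Hq H)|].
  rewrite <- (is_series_unique _ _ (geom_scal_series A q Hq)).
  apply Series_le; [|eexists; now apply geom_scal_series].
  intros n. split; [apply Cmod_ge_0|apply H].
Qed.

(** * Formal power series *)

Definition tl (a : nat -> C) : nat -> C := fun n => a (S n).
(** The Cauchy product, by recursion along a = a_0 + z [tl a]. In this form the ring laws are plain
    inductions; [conv_csum] gives the usual sum. *)
Fixpoint conv (a b : nat -> C) (n : nat) : C :=
  match n with
  | O => a O * b O
  | S m => a O * b (S m) + conv (tl a) b m
  end.

Lemma conv_ext a a' b b' n : (forall k, (k <= n)%nat -> a k = a' k) ->
  (forall k, (k <= n)%nat -> b k = b' k) -> conv a b n = conv a' b' n.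
Proof.
  revert a a'. induction n; intros a a' H1 H2; simpl.
  - now rewrite H1, H2 by lia.
  - rewrite H1, H2 by lia. f_equal. apply IHn; intros; unfold tl; [apply H1|apply H2]; lia.
Qed.
Lemma conv_plus_l a a' b n : conv (fun k => a k + a' k) b n = conv a b n + conv a' b n.
Proof.
  revert a a'. induction n; intros a a'; simpl; [ring|].
  change (tl (fun k => a k + a' k)) with (fun k => tl a k + tl a' k).
  rewrite IHn. ring.
Qed.
Lemma conv_scal_l c a b n : conv (fun k => c * a k) b n = c * conv a b n.
Proof.
  revert a. induction n; intros a; simpl; [ring|].
  change (tl (fun k => c * a k)) with (fun k => c * tl a k).
  rewrite IHn. ring.
Qed.
Lemma conv_S_r a b n : conv a b (S n) = conv a (tl b) n + a (S n) * b O.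
Proof.
  revert a. induction n; intros a; [simpl; unfold tl; ring|].
  change (conv a b (S (S n))) with (a O * b (S (S n)) + conv (tl a) b (S n)).
  rewrite IHn. simpl. unfold tl. ring.
Qed.
Lemma conv_comm a b n : conv a b n = conv b a n.
Proof.
  revert a b. induction n; intros a b; [simpl; ring|].
  rewrite conv_S_r. simpl. rewrite IHn. ring.
Qed.
Lemma conv_plus_r a b b' n : conv a (fun k => b k + b' k) n = conv a b n + conv a b' n.
Proof. rewrite conv_comm, conv_plus_l, !(conv_comm a). reflexivity. Qed.
Lemma conv_scal_r c a b n : conv a (fun k => c * b k) n = c * conv a b n.
Proof. rewrite conv_comm, conv_scal_l, (conv_comm a). reflexivity. Qed.
Lemma conv_assoc a b c n : conv (conv a b) c n = conv a (conv b c) n.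
Proof.
  revert a. induction n; intros a; [simpl; ring|].
  simpl. change (tl (conv a b)) with (fun m => a O * tl b m + conv (tl a) b m).
  rewrite conv_plus_l, conv_scal_l, IHn. ring.
Qed.
Lemma conv_pow a b z n :
  conv (fun k => a k * z ^ k) (fun k => b k * z ^ k) n = conv a b n * z ^ n.
Proof.
  revert a. induction n; intros a; [simpl; ring|].
  simpl conv at 1.
  rewrite (conv_ext _ (fun k => z * (tl a k * z ^ k)) _ (fun k => b k * z ^ k));
    [|intros; unfold tl; rewrite Cpow_S; ring|reflexivity].
  rewrite conv_scal_l, IHn. simpl conv. rewrite !Cpow_S. simpl. ring.
Qed.

Definition psone (n : nat) : C := match n with O => 1 | S _ => 0 end.
Lemma conv_0_l b n : conv (fun _ => 0) b n = 0.
Proof.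
  induction n; simpl; [ring|]. change (tl (fun _ => 0)) with (fun _ : nat => RtoC 0).
  rewrite IHn. ring.
Qed.
Lemma conv_one_l b n : conv psone b n = b n.
Proof.
  destruct n; simpl; [ring|]. change (tl psone) with (fun _ : nat => RtoC 0).
  rewrite conv_0_l. ring.
Qed.
Lemma conv_one_r b n : conv b psone n = b n.
Proof. rewrite conv_comm. apply conv_one_l. Qed.

Lemma csum_S_l u n : csum u (S n) = u O + csum (fun k => u (S k)) n.
Proof. induction n; [simpl; ring|]. simpl in *. rewrite IHn. ring. Qed.
Lemma conv_csum a b n : conv a b n = csum (fun k => a k * b (n - k)%nat) (S n).
Proof.
  revert a. induction n; intros a; [simpl; ring|].
  rewrite csum_S_l. simpl conv. rewrite IHn. f_equal.
Qed.
Lemma sum_f_rsum f n : sum_f_R0 f n = rsum f (S n).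
Proof. induction n; simpl; [ring|]. rewrite IHn. reflexivity. Qed.
Lemma Cmod_conv a b (u v : nat -> R) n :
  (forall k, (k <= n)%nat -> (Cmod (a k) <= u k)%R) -> (forall k, (k <= n)%nat -> (Cmod (b k) <= v k)%R) ->
  (Cmod (conv a b n) <= rsum (fun k => u k * v (n - k)%nat)%R (S n))%R.
Proof.
  intros H1 H2. rewrite conv_csum. eapply Rle_trans; [apply Cmod_csum|].
  apply rsum_le. intros i Hi. rewrite Cmod_mult.
  apply Rmult_le_compat; try apply Cmod_ge_0; [apply H1|apply H2]; lia.
Qed.

Lemma asum_conv u v : asum u -> asum v -> asum (conv u v).
Proof.
  intros Hu Hv.
  apply (asum_le _ (fun n => sum_f_R0 (fun k => Cmod (u k) * Cmod (v (n - k)%nat))%R n)).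
  - intros n. rewrite sum_f_rsum. apply (Cmod_conv u v (fun k => Cmod (u k)) (fun k => Cmod (v k)));
      intros; lra.
  - destruct Hu as [l1 H1], Hv as [l2 H2]. eexists. apply (is_series_mult _ _ l1 l2 H1 H2).
    + apply ex_series_ext with (fun n => Cmod (u n)); [|now exists l1].
      intros n. symmetry. apply Rabs_pos_eq, Cmod_ge_0.
    + apply ex_series_ext with (fun n => Cmod (v n)); [|now exists l2].
      intros n. symmetry. apply Rabs_pos_eq, Cmod_ge_0.
Qed.
Lemma ex_series_Rabs_Re u : asum u -> ex_series (fun n => Rabs (Re (u n))).
Proof.
  intros H. apply (ex_series_le (V := R_CompleteNormedModule) _ (fun n => Cmod (u n))); [|exact H].
  intros n. unfold norm; simpl; unfold abs; simpl. rewrite Rabs_Rabsolu. apply re_le_Cmod.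
Qed.
Lemma ex_series_Rabs_Im u : asum u -> ex_series (fun n => Rabs (Im (u n))).
Proof.
  intros H. apply (ex_series_le (V := R_CompleteNormedModule) _ (fun n => Cmod (u n))); [|exact H].
  intros n. unfold norm; simpl; unfold abs; simpl. rewrite Rabs_Rabsolu. apply im_le_Cmod.
Qed.
Lemma Im_csum u n : Im (csum u n) = rsum (fun i => Im (u i)) n.
Proof. induction n; simpl; [reflexivity|now rewrite <- IHn]. Qed.
Lemma cseries_conv u v : asum u -> asum v -> cseries (conv u v) = cseries u * cseries v.
Proof.
  intros Hu Hv.
  assert (M : forall (p q : nat -> R), ex_series p -> ex_series q ->
     ex_series (fun n => Rabs (p n)) -> ex_series (fun n => Rabs (q n)) ->
     is_series (fun n => rsum (fun k => p k * q (n - k)%nat)%R (S n)) (Series p * Series q)%R).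
  { intros p q Hp Hq Ap Aq.
    apply is_series_ext with (fun n => sum_f_R0 (fun k => p k * q (n - k)%nat)%R n).
    - intros n. apply sum_f_rsum.
    - apply is_series_mult; auto; now apply Series_correct. }
  assert (Ru := asum_re _ Hu). assert (Rv := asum_re _ Hv).
  assert (Iu := asum_im _ Hu). assert (Iv := asum_im _ Hv).
  assert (Ru' := ex_series_Rabs_Re _ Hu). assert (Rv' := ex_series_Rabs_Re _ Hv).
  assert (Iu' := ex_series_Rabs_Im _ Hu). assert (Iv' := ex_series_Rabs_Im _ Hv).
  unfold cseries. apply injective_projections; simpl; apply is_series_unique.
  - eapply is_series_ext; [|apply (is_series_minus (V := R_NormedModule) _ _ _ _ (M _ _ Ru Rv Ru' Rv') (M _ _ Iu Iv Iu' Iv'))].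
    intros n. rewrite conv_csum, Re_csum. unfold minus, plus, opp. cbn -[rsum].
    set (A := rsum _ (S n)). set (B := rsum _ (S n)).
    replace (A + - B)%R with (A + (-1) * B)%R by ring. unfold A, B. rewrite <- rsum_scal, <- rsum_plus.
    apply rsum_ext. intros i _. unfold Re, Im. cbn. ring.
  - eapply is_series_ext; [|apply (is_series_plus (V := R_NormedModule) _ _ _ _ (M _ _ Ru Iv Ru' Iv') (M _ _ Iu Rv Iu' Rv'))].
    intros n. rewrite conv_csum, Im_csum. unfold plus. cbn -[rsum].
    rewrite <- rsum_plus. apply rsum_ext. intros i _. unfold Re, Im. cbn. ring.
Qed.

(** Convergence is recorded at one closed radius rather than through a radius of convergence, since
    reciprocals are later extended from one radius to the next. *)
Definition sm (a : nat -> C) (r : R) : Prop := ex_series (fun n => Cmod (a n) * r ^ n)%R.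
Definition peval (a : nat -> C) (z : C) : C := cseries (fun n => a n * z ^ n).

Lemma sm_asum a r z : sm a r -> (Cmod z <= r)%R -> asum (fun n => a n * z ^ n).
Proof.
  intros H Hz. refine (asum_le _ _ _ H). intros n.
  rewrite Cmod_mult, Cmod_pow. apply Rmult_le_compat_l; [apply Cmod_ge_0|].
  apply pow_incr. split; [apply Cmod_ge_0|exact Hz].
Qed.
Lemma asum_sm a r : (0 <= r)%R -> asum (fun n => a n * r ^ n) -> sm a r.
Proof.
  intros Hr. apply ex_series_ext. intros n.
  rewrite Cmod_mult, Cmod_pow, Cmod_R, Rabs_pos_eq by exact Hr. reflexivity.
Qed.
Lemma sm_mono a r r' : (0 <= r' <= r)%R -> sm a r -> sm a r'.
Proof.
  intros Hr H. apply asum_sm; [lra|]. apply (sm_asum a r); [exact H|].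
  rewrite Cmod_R, Rabs_pos_eq; lra.
Qed.
Lemma Cmod_pos r : (0 <= r)%R -> (Cmod r <= r)%R.
Proof. intros H. rewrite Cmod_R, Rabs_pos_eq; lra. Qed.
Lemma sm_conv a b r : (0 <= r)%R -> sm a r -> sm b r -> sm (conv a b) r.
Proof.
  intros Hr Ha Hb. apply asum_sm; [exact Hr|].
  eapply asum_ext; [intros n; apply conv_pow|].
  apply asum_conv; (eapply sm_asum; [eassumption|now apply Cmod_pos]).
Qed.
Lemma peval_conv a b r z : sm a r -> sm b r -> (Cmod z <= r)%R ->
  peval (conv a b) z = peval a z * peval b z.
Proof.
  intros Ha Hb Hz. unfold peval. rewrite <- cseries_conv by (eapply sm_asum; eassumption).
  apply cseries_ext. intros n. now rewrite conv_pow.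
Qed.
Lemma sm_plus a b r : (0 <= r)%R -> sm a r -> sm b r -> sm (fun n => a n + b n) r.
Proof.
  intros Hr Ha Hb. apply asum_sm; [exact Hr|].
  apply asum_ext with (fun n => a n * r ^ n + b n * r ^ n); [intros; ring|].
  apply asum_plus; (eapply sm_asum; [eassumption|now apply Cmod_pos]).
Qed.
Lemma sm_scal c a r : (0 <= r)%R -> sm a r -> sm (fun n => c * a n) r.
Proof.
  intros Hr Ha. apply asum_sm; [exact Hr|].
  apply asum_ext with (fun n => c * (a n * r ^ n)); [intros; ring|].
  apply asum_scal. eapply sm_asum; [eassumption|now apply Cmod_pos].
Qed.
Lemma peval_plus a b r z : sm a r -> sm b r -> (Cmod z <= r)%R ->
  peval (fun n => a n + b n) z = peval a z + peval b z.
Proof.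
  intros Ha Hb Hz. unfold peval. rewrite <- cseries_plus by (eapply sm_asum; eassumption).
  apply cseries_ext. intros; ring.
Qed.
Lemma peval_scal c a r z : sm a r -> (Cmod z <= r)%R -> peval (fun n => c * a n) z = c * peval a z.
Proof.
  intros Ha Hz. unfold peval. rewrite <- cseries_scal by (eapply sm_asum; eassumption).
  apply cseries_ext. intros; ring.
Qed.
Lemma peval_ext a b z : (forall n, a n = b n) -> peval a z = peval b z.
Proof. intros H. apply cseries_ext. intros. now rewrite H. Qed.
Lemma sm_ext a b r : (forall n, a n = b n) -> sm a r -> sm b r.
Proof. intros H. apply ex_series_ext. intros n. now rewrite H. Qed.
Lemma peval_one z : peval psone z = 1.
Proof.
  unfold peval. assert (A : asum (fun n => psone n * z ^ n)).
  { apply (asum_geom _ 1 0); [lra|]. intros [|n]; simpl.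
    - rewrite Cmult_1_l, Cmod_1. lra.
    - rewrite Cmult_0_l, Cmod_0. lra. }
  rewrite (cseries_split _ 1 A). simpl.
  rewrite (cseries_ext _ (fun _ => 0)), cseries_0 by (intros; simpl; ring). ring.
Qed.
Lemma sm_one r : (0 <= r)%R -> sm psone r.
Proof.
  intros Hr. apply asum_sm; [exact Hr|]. apply (asum_geom _ 1 0); [lra|]. intros [|n]; simpl.
  - rewrite Cmult_1_l, Cmod_1. lra.
  - rewrite Cmult_0_l, Cmod_0. lra.
Qed.
Lemma sm_bound a A q r : (0 <= r)%R -> (0 <= q)%R -> (q * r < 1)%R ->
  (forall n, Cmod (a n) <= A * q ^ n)%R -> sm a r.
Proof.
  intros Hr Hq Hqr H. apply asum_sm; [exact Hr|]. apply (asum_geom _ A (q * r)).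
  - split; [now apply Rmult_le_pos|exact Hqr].
  - intros n. rewrite Cmod_mult, Cmod_pow, Cmod_R, Rabs_pos_eq, Rpow_mult_distr, <- Rmult_assoc by exact Hr.
    apply Rmult_le_compat_r; [now apply pow_le|apply H].
Qed.
Lemma peval_0 a : peval a 0 = a O.
Proof.
  unfold peval. rewrite (cseries_split _ 1).
  - rewrite (cseries_ext _ (fun _ => 0)) by (intros n; simpl; ring). rewrite cseries_0. simpl. ring.
  - apply (asum_geom _ (Cmod (a O)) 0); [lra|]. intros [|n]; simpl.
    + rewrite Cmult_1_r. lra.
    + rewrite Cmult_0_l, Cmult_0_r, Cmod_0. lra.
Qed.

(** * Roots of unity and Cauchy estimates *)

Definition prim_root (N : nat) (w : C) : Prop :=
  w ^ N = 1 /\ Cmod w = 1%R /\ forall d, (0 < d < N)%nat -> w ^ d <> 1.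

Lemma cis_pow x n : (cos x, sin x) ^ n = (cos (INR n * x), sin (INR n * x)).
Proof.
  induction n.
  - simpl. rewrite Rmult_0_l, cos_0, sin_0. reflexivity.
  - rewrite Cpow_S, IHn, S_INR, Rmult_plus_distr_r, Rmult_1_l, cos_plus, sin_plus.
    unfold Cmult. simpl. f_equal; ring.
Qed.
Lemma prim_root_exists N : (0 < N)%nat -> exists w, prim_root N w.
Proof.
  intros HN. assert (P : (0 < INR N)%R) by now apply lt_0_INR.
  set (x := (2 * PI / INR N)%R). exists (cos x, sin x). repeat split.
  - rewrite cis_pow. replace (INR N * x)%R with (2 * PI)%R by (unfold x; field; lra).
    rewrite cos_2PI, sin_2PI. reflexivity.
  - unfold Cmod. simpl. replace (_ + _)%R with 1%R; [apply sqrt_1|].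
    assert (S := sin2_cos2 x). unfold Rsqr in S. lra.
  - intros d [Hd1 Hd2] E. rewrite cis_pow in E. injection E as E _.
    apply lt_INR in Hd2. apply lt_0_INR in Hd1. pose proof PI_RGT_0 as HP.
    (* 1 - cos (2y) = 2 sin^2 y, and y = pi d / N lies strictly between 0 and pi. *)
    assert (Q : (0 < sin (INR d * PI / INR N))%R).
    { apply sin_gt_0.
      - apply Rdiv_lt_0_compat; nra.
      - apply Rmult_lt_reg_r with (INR N); [exact P|]. unfold Rdiv.
        rewrite Rmult_assoc, Rinv_l by lra. nra. }
    replace (INR d * x)%R with (2 * (INR d * PI / INR N))%R in E by (unfold x; field; lra).
    rewrite cos_2a_sin in E. nra.
Qed.

Lemma Cconj_R (t : R) : Cconj t = t.
Proof. unfold Cconj, RtoC; simpl. now rewrite Ropp_0. Qed.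
Lemma prim_root_conj N w k : prim_root N w -> w ^ k * Cconj (w ^ k) = 1.
Proof. intros (_ & W2 & _). rewrite <- Cmod2_conj, Cmod_pow, W2, !pow1. reflexivity. Qed.

Lemma geom_root_sum u N : u ^ N = 1 -> u <> 1 -> csum (fun j => u ^ j) N = 0.
Proof.
  intros H1 H2.
  assert (E : (u - 1) * csum (fun j => u ^ j) N = u ^ N - 1).
  { clear. induction N; [simpl; ring|]. simpl csum. rewrite Cmult_plus_distr_l, IHN, Cpow_S. ring. }
  rewrite H1 in E. replace (1 - 1) with (RtoC 0) in E by ring.
  destruct (Ceq_dec (csum (fun j => u ^ j) N) 0) as [Z|Z]; [exact Z|].
  exfalso. apply (Cmult_neq_0 (u - 1) _) in Z; [contradiction|].
  intros F. apply H2. replace u with (u - 1 + 1) by ring. rewrite F. ring.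
Qed.

Lemma prim_root_sum N w n : prim_root N w -> (n mod N <> 0)%nat ->
  csum (fun j => (w ^ n) ^ j) N = 0.
Proof.
  intros (H1 & H2 & H3) Hn. destruct N as [|N']; [reflexivity|]. set (N := S N') in *.
  apply geom_root_sum.
  - rewrite <- Cpow_mult_r, Nat.mul_comm, Cpow_mult_r, H1. apply Cpow_1_l.
  - rewrite (Nat.div_mod_eq n N), Cpow_add_r, Cpow_mult_r, H1, Cpow_1_l, Cmult_1_l.
    apply H3. pose proof (Nat.mod_upper_bound n N). lia.
Qed.
Lemma prim_root_sum1 N w n : prim_root N w -> (n mod N = 0)%nat ->
  csum (fun j => (w ^ n) ^ j) N = INR N.
Proof.
  intros (H1 & H2 & H3) Hn.
  rewrite (csum_ext _ (fun _ => 1)); [rewrite csum_const; ring|].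
  intros i _. rewrite (Nat.div_mod_eq n N), Hn, Nat.add_0_r, Cpow_mult_r, H1, !Cpow_1_l. reflexivity.
Qed.

Lemma tail_series a r : sm a r -> forall eps, (0 < eps)%R -> exists N0, forall N, (N0 <= N)%nat ->
  (Series (fun n => Cmod (a (N + n)%nat) * r ^ (N + n)) < eps)%R.
Proof.
  intros H eps He. destruct (series_tail _ H eps He) as [N0 HN]. exists N0. intros N L.
  eapply Rle_lt_trans; [apply Rle_abs|apply HN, L].
Qed.

(** The contour integral is replaced by the average over N-th roots of unity, which isolates a_n r^n
    exactly among the coefficients below N; those from N on form a tail that vanishes as N grows. *)
Lemma cauchy_estimate a r M : (0 <= r)%R -> sm a r ->
  (forall z, Cmod z = r -> (Cmod (peval a z) <= M)%R) -> forall n, (Cmod (a n) * r ^ n <= M)%R.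
Proof.
  intros Hr Ha HM n. apply le_epsilon. intros eps He.
  destruct (tail_series a r Ha eps He) as [N0 HN]. set (N := (S n + N0)%nat).
  specialize (HN N ltac:(lia)). set (T := Series _) in HN.
  destruct (prim_root_exists N ltac:(lia)) as [w Hw]. pose proof Hw as (W1 & W2 & W3).
  assert (Hz : forall j, Cmod (r * w ^ j) = r).
  { intros j. rewrite Cmod_mult, Cmod_pow, W2, pow1, Cmod_R, Rabs_pos_eq; lra. }
  set (t := fun j => cseries (fun k => a (N + k)%nat * (r * w ^ j) ^ (N + k))).
  assert (Ht : forall j, (Cmod (t j) <= T)%R).
  { intros j. unfold t. eapply Rle_trans.
    - apply cseries_bound. apply (asum_shift (fun k => a k * (r * w ^ j) ^ k) N).
      apply (sm_asum a r); [exact Ha|]. rewrite Hz. lra.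
    - unfold T. apply Req_le, Series_ext. intros k. rewrite Cmod_mult, Cmod_pow, Hz. reflexivity. }
  (* [w ^ (N - n)] stands for w^(-n): summed over j, the term of index m < N contributes N if m = n
     and 0 otherwise. *)
  assert (E : csum (fun j => (w ^ (N - n)) ^ j * peval a (r * w ^ j)) N
    = INR N * (a n * r ^ n) + csum (fun j => (w ^ (N - n)) ^ j * t j) N).
  { rewrite (csum_ext _ (fun j => csum (fun m => a m * r ^ m * (w ^ (N - n + m)) ^ j) N
        + (w ^ (N - n)) ^ j * t j)).
    2:{ intros j _. unfold peval. rewrite (cseries_split _ N).
        2:{ apply (sm_asum a r); [exact Ha|]. rewrite Hz. lra. }
        fold (t j). rewrite Cmult_plus_distr_l, <- csum_scal. f_equal.
        apply csum_ext. intros m _. rewrite Cpow_add_r, !Cpow_mult_l, <- (Cpow_mult_r w j m),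
          (Nat.mul_comm j m), (Cpow_mult_r w m j). ring. }
    rewrite csum_plus, csum_swap. f_equal.
    rewrite (csum_ext _ (fun m => if Nat.eq_dec m n then INR N * (a n * r ^ n) else 0)).
    - rewrite csum_delta. destruct (le_lt_dec N n); [lia|reflexivity].
    - intros m Hm. rewrite csum_scal. destruct (Nat.eq_dec m n) as [->|D].
      + rewrite (prim_root_sum1 N w _ Hw); [ring|].
        replace (N - n + n)%nat with (1 * N)%nat by lia. apply Nat.Div0.mod_mul.
      + rewrite (prim_root_sum N w _ Hw); [ring|]. intros Z.
        apply Nat.Div0.mod_divides in Z. destruct Z as [c Hc].
        destruct c as [|[|c]]; nia. }
  assert (P : (0 < INR N)%R) by (apply lt_0_INR; lia).
  assert (U : forall j, Cmod ((w ^ (N - n)) ^ j) = 1%R).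
  { intros j. now rewrite !Cmod_pow, W2, !pow1. }
  assert (A1 : (Cmod (csum (fun j => (w ^ (N - n)) ^ j * peval a (r * w ^ j))%C N) <= INR N * M)%R).
  { eapply Rle_trans; [apply Cmod_csum|]. rewrite <- rsum_const. apply rsum_le. intros j _.
    rewrite Cmod_mult, U, Rmult_1_l. apply HM, Hz. }
  assert (A2 : (Cmod (csum (fun j => (w ^ (N - n)) ^ j * t j)%C N) <= INR N * T)%R).
  { eapply Rle_trans; [apply Cmod_csum|]. rewrite <- rsum_const. apply rsum_le. intros j _.
    rewrite Cmod_mult, U, Rmult_1_l. apply Ht. }
  assert (A3 : (INR N * (Cmod (a n) * r ^ n) <= INR N * M + INR N * T)%R).
  { replace (INR N * (Cmod (a n) * r ^ n))%R with (Cmod (INR N * (a n * r ^ n))).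
    - replace (INR N * (a n * r ^ n)) with (csum (fun j => (w ^ (N - n)) ^ j * peval a (r * w ^ j)) N
        + - csum (fun j => (w ^ (N - n)) ^ j * t j) N) by (rewrite E; ring).
      eapply Rle_trans; [apply Cmod_triangle|]. rewrite Cmod_opp. lra.
    - rewrite !Cmod_mult, Cmod_pow, !Cmod_R, !Rabs_pos_eq by lra. reflexivity. }
  nra.
Qed.

(** * Reciprocals of power series *)

(** Course-of-values recursion by tables: stage n is final up to index n, and [Phi m] receives the
    whole table although it may only look at indices up to m (the hypothesis of [rec_seq_S]). *)
Fixpoint rec_prefix (Phi : nat -> (nat -> C) -> C) (c : C) (n : nat) : nat -> C :=
  match n with
  | O => fun _ => c
  | S m => fun k => if le_lt_dec k m then rec_prefix Phi c m k else Phi m (rec_prefix Phi c m)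
  end.
Definition rec_seq Phi c : nat -> C := fun n => rec_prefix Phi c n n.

Lemma rec_seq_S Phi c n :
  (forall n s s', (forall k, (k <= n)%nat -> s k = s' k) -> Phi n s = Phi n s') ->
  rec_seq Phi c (S n) = Phi n (rec_seq Phi c).
Proof.
  intros HP.
  assert (PS : forall n k, rec_prefix Phi c (S n) k =
    if le_lt_dec k n then rec_prefix Phi c n k else Phi n (rec_prefix Phi c n)) by reflexivity.
  assert (St : forall n k, (k <= n)%nat -> rec_prefix Phi c n k = rec_prefix Phi c k k).
  { clear n. induction n; intros k Hk.
    - now replace k with O by lia.
    - rewrite PS. destruct (le_lt_dec k n); [now apply IHn|]. replace k with (S n) by lia.
      rewrite PS. destruct (le_lt_dec (S n) n); [lia|reflexivity]. }
  unfold rec_seq at 1. rewrite PS. destruct (le_lt_dec (S n) n); [lia|].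
  apply HP. intros k Hk. now apply St.
Qed.

(** Solves g_0 h_(n+1) + ([tl g] h)_n = 0, the coefficient of index n+1 in g h = 1. *)
Definition pinv (g : nat -> C) : nat -> C :=
  rec_seq (fun n h => - (/ g O * conv (tl g) h n)) (/ g O).

Lemma pinv_S g n : pinv g (S n) = - (/ g O * conv (tl g) (pinv g) n).
Proof.
  unfold pinv at 1. rewrite rec_seq_S; [reflexivity|].
  intros m s s' Hs. do 2 f_equal. now apply conv_ext.
Qed.
Lemma pinv_spec g n : g O <> RtoC 0 -> conv g (pinv g) n = psone n.
Proof.
  intros H0. destruct n as [|n]; simpl.
  - unfold pinv, rec_seq. simpl. field. exact H0.
  - rewrite pinv_S. field. exact H0.
Qed.

Lemma sm_term_bound a r : (0 <= r)%R -> sm a r -> exists A, (0 < A)%R /\ forall n, (Cmod (a n) * r ^ n <= A)%R.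
Proof.
  intros Hr H. exists (1 + Series (fun n => Cmod (a n) * r ^ n))%R.
  assert (P : forall n, (0 <= Cmod (a n) * r ^ n)%R).
  { intros n. apply Rmult_le_pos; [apply Cmod_ge_0|now apply pow_le]. }
  assert (Q : forall n, (Cmod (a n) * r ^ n <= Series (fun n => Cmod (a n) * r ^ n))%R).
  { intros n. assert (E := Series_incr_n _ (S n) ltac:(lia) H). simpl pred in E. rewrite E.
    rewrite sum_f_rsum. simpl rsum.
    assert (0 <= rsum (fun k => Cmod (a k) * r ^ k) n)%R.
    { replace 0%R with (rsum (fun _ => 0%R) n) by (rewrite rsum_const; ring).
      apply rsum_le. intros; apply P. }
    assert (0 <= Series (fun k => Cmod (a (S n + k)%nat) * r ^ (S n + k)))%R; [|lra].
    replace 0%R with (Series (fun _ => 0%R)).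
    - apply Series_le.
      + intros k. split; [lra|apply P].
      + apply (ex_series_incr_n (fun n => Cmod (a n) * r ^ n)%R (S n)), H.
    - assert (Z := Re_cseries (fun _ => 0)). rewrite cseries_0 in Z. simpl in Z. symmetry. exact Z. }
  split; [specialize (P O); specialize (Q O); lra|]. intros n. specialize (Q n). lra.
Qed.

Lemma sm_geom a r : (0 < r)%R -> sm a r -> exists A, (0 < A)%R /\ forall n, (Cmod (a n) <= A * (/ r) ^ n)%R.
Proof.
  intros Hr H. destruct (sm_term_bound a r (Rlt_le _ _ Hr) H) as (A & HA & B).
  exists A. split; [exact HA|]. intros n. specialize (B n).
  assert (P : (0 < r ^ n)%R) by now apply pow_lt.
  rewrite pow_inv. apply (Rmult_le_reg_r (r ^ n)); [exact P|].
  rewrite Rmult_assoc, Rinv_l; lra.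
Qed.

(** Geometric majorant: if |g_n| <= A i^n, the recursion for h is dominated by |h_0| q^n with a
    suitable ratio q. This only gives some positive radius. *)
Lemma inv_start g h r : (0 < r)%R -> sm g r -> (forall n, conv g h n = psone n) ->
  exists R0, (0 < R0)%R /\ forall R, (0 <= R < R0)%R -> sm h R.
Proof.
  intros Hr Hg E.
  destruct (sm_geom g r Hr Hg) as (A & HA & B).
  assert (N0 : g O <> 0).
  { intros Z. specialize (E O). simpl in E. rewrite Z, Cmult_0_l in E. symmetry in E.
    injection E. lra. }
  assert (PG := proj1 (Cmod_gt_0 _) N0).
  set (A' := (A / Cmod (g O))%R). assert (HA' : (0 < A')%R) by now apply Rdiv_lt_0_compat.
  set (i := (/ r)%R). fold i in B. assert (Hi : (0 < i)%R) by now apply Rinv_0_lt_compat.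
  set (q := ((1 + A') * i)%R). assert (Hq : (0 < q)%R) by (apply Rmult_lt_0_compat; lra).
  (* The ratio q was chosen with q - i = A' i, so that this geometric sum telescopes and stays below
     q^(n+1). *)
  assert (Sm : forall n, rsum (fun k => A' * i ^ (S k) * q ^ (n - k))%R (S n) = (q ^ (S n) - i ^ (S n))%R).
  { induction n; [simpl; unfold q; ring|].
    change (rsum (fun k => A' * i ^ (S k) * q ^ (S n - k))%R (S (S n))) with
      (rsum (fun k => A' * i ^ (S k) * q ^ (S n - k))%R (S n) + A' * i ^ (S (S n)) * q ^ (S n - S n))%R.
    rewrite (rsum_ext _ (fun k => q * (A' * i ^ (S k) * q ^ (n - k)))%R).
    - rewrite rsum_scal, IHn, Nat.sub_diag. unfold q. simpl. ring.
    - intros k Hk. replace (S n - k)%nat with (S (n - k)) by lia. simpl. ring. }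
  assert (Bh : forall n k, (k <= n)%nat -> (Cmod (h k) <= Cmod (h O) * q ^ k)%R).
  { induction n; intros k Hk.
    - replace k with O by lia. simpl. lra.
    - destruct (le_lt_dec k n) as [L|L]; [now apply IHn|]. replace k with (S n) by lia.
      assert (E1 : h (S n) = - (/ g O * conv (tl g) h n)).
      { specialize (E (S n)). simpl in E.
        replace (conv (tl g) h n) with (g O * h (S n) + conv (tl g) h n - g O * h (S n)) by ring.
        rewrite E. field. exact N0. }
      rewrite E1, Cmod_opp, Cmod_mult, Cmod_inv by exact N0.
      assert (C1 := Cmod_conv (tl g) h (fun k => A * i ^ (S k))%R (fun k => Cmod (h O) * q ^ k)%R n
         (fun k _ => B (S k)) (fun k Hk => IHn k Hk)).
      apply Rle_trans with (/ Cmod (g O) * rsum (fun k => A * i ^ (S k) * (Cmod (h O) * q ^ (n - k)))%R (S n))%R.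
      { apply Rmult_le_compat_l; [left; now apply Rinv_0_lt_compat|exact C1]. }
      rewrite <- rsum_scal.
      rewrite (rsum_ext _ (fun k => Cmod (h O) * (A' * i ^ (S k) * q ^ (n - k)))%R).
      2:{ intros j _. unfold A'. field. lra. }
      rewrite rsum_scal, Sm. apply Rmult_le_compat_l; [apply Cmod_ge_0|].
      assert (0 < i ^ S n)%R by now apply pow_lt. lra. }
  exists (/ q)%R. split; [now apply Rinv_0_lt_compat|]. intros R HR.
  apply (sm_bound h (Cmod (h O)) q R); try lra.
  - apply (Rmult_lt_reg_l (/ q)); [now apply Rinv_0_lt_compat|].
    rewrite <- Rmult_assoc, Rinv_l; lra.
  - intros n. now apply (Bh n).
Qed.

Lemma sm_scaled a s R : (0 <= s)%R -> (0 <= R)%R -> sm a (s * R) -> sm (fun n => a n * s ^ n) R.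
Proof.
  intros Hs HR. apply ex_series_ext. intros n.
  rewrite Cmod_mult, Cmod_pow, Cmod_R, Rabs_pos_eq, Rpow_mult_distr; [|exact Hs].
  rewrite <- Rmult_assoc. reflexivity.
Qed.
Lemma peval_scaled a (s : R) z : peval (fun n => a n * s ^ n) z = peval a (s * z).
Proof. apply cseries_ext. intros n. rewrite Cpow_mult_l. ring. Qed.

(* Enlarges the radius of convergence of the reciprocal [h] of [g] from [R] to [s * R]. The dilation
   [h (s t)] is the limit of the iteration [u := h (1 - eps u)], where [eps t = g (s t) - g t]; it keeps
   [|u| <= 2 / m] for [|t| <= R] and makes one more coefficient correct at each step. *)
Lemma inv_step g h R s m : (0 < R)%R -> (1 < s)%R -> (0 < m)%R ->
  (forall n, conv g h n = psone n) -> sm h R -> sm g (s * R) ->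
  (forall t, (Cmod t <= R)%R -> (m <= Cmod (peval g t))%R /\ (Cmod (peval g (s * t) - peval g t) <= m / 2)%R) ->
  forall n, (Cmod (h n) * (s * R) ^ n <= 2 / m)%R.
Proof.
  intros HR Hs Hm E Hh Hgs H.
  assert (Hg : sm g R) by (apply (sm_mono g (s * R)); [split; nra|exact Hgs]).
  set (eps := fun n => g n * s ^ n + - (1) * g n).
  assert (He : sm eps R).
  { apply sm_plus; [lra| |apply sm_scal; [lra|exact Hg]]. apply sm_scaled; [lra|lra|exact Hgs]. }
  assert (Eve : forall t, (Cmod t <= R)%R -> peval eps t = peval g (s * t) - peval g t).
  { intros t Ht. unfold eps. rewrite (peval_plus _ _ R); auto.
    - rewrite peval_scaled, (peval_scal _ _ R) by auto. ring.
    - apply sm_scaled; [lra|lra|exact Hgs].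
    - apply sm_scal; [lra|exact Hg]. }
  set (u := fix u K : nat -> C := match K with O => fun _ => 0 | S K' =>
     fun n => h n + - (1) * conv h (conv eps (u K')) n end).
  assert (Hu : forall K, sm (u K) R /\ forall t, (Cmod t <= R)%R -> (Cmod (peval (u K) t) <= 2 / m)%R).
  { induction K.
    - split.
      + apply (sm_ext (fun n => 0 * psone n)); [intros; simpl; ring|]. apply sm_scal; [lra|apply sm_one; lra].
      + intros t Ht. simpl. unfold peval. rewrite (cseries_ext _ (fun _ => 0)), cseries_0, Cmod_0 by (intros; ring).
        left. now apply Rdiv_lt_0_compat; lra.
    - destruct IHK as [S1 B1].
      assert (S2 : sm (conv h (conv eps (u K))) R) by (apply sm_conv; [lra|exact Hh|apply sm_conv; auto; lra]).
      split.
      + simpl. apply sm_plus; [lra|exact Hh|]. apply sm_scal; [lra|exact S2].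
      + intros t Ht. destruct (H t Ht) as [H1 H2].
        assert (E1 : peval g t * peval h t = 1).
        { rewrite <- (peval_conv g h R t Hg Hh Ht), (peval_ext _ psone t E). apply peval_one. }
        assert (B2 : (Cmod (peval h t) <= / m)%R).
        { assert (Cmod (peval g t) * Cmod (peval h t) = 1)%R by (rewrite <- Cmod_mult, E1; apply Cmod_1).
          pose proof (Cmod_ge_0 (peval h t)). apply (Rmult_le_reg_l m); [exact Hm|].
          rewrite Rinv_r by lra. nra. }
        replace (peval (u (S K)) t) with (peval h t * (1 + - (peval eps t * peval (u K) t))).
        * rewrite Cmod_mult.
          (* The constants reproduce themselves: |eps| <= m/2 and |u| <= 2/m give |eps u| <= 1, and
             |h| <= 1/m turns the factor 2 back into 2/m. *)
          assert (B3 : (Cmod (1 + - (peval eps t * peval (u K) t)) <= 2)%R).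
          { eapply Rle_trans; [apply Cmod_triangle|]. rewrite Cmod_opp, Cmod_1, Cmod_mult, Eve by exact Ht.
            specialize (B1 t Ht). pose proof (Cmod_ge_0 (peval (u K) t)).
            pose proof (Cmod_ge_0 (peval g (s * t) - peval g t)).
            assert (Cmod (peval g (s * t) - peval g t) * Cmod (peval (u K) t) <= m / 2 * (2 / m))%R
              by (apply Rmult_le_compat; auto).
            replace (m / 2 * (2 / m))%R with 1%R in * by (field; lra). lra. }
          replace (2 / m)%R with (/ m * 2)%R by (field; lra).
          apply Rmult_le_compat; auto using Cmod_ge_0.
        * simpl. rewrite (peval_plus _ _ R); auto; [|apply sm_scal; [lra|exact S2]].
          rewrite (peval_scal _ _ R), (peval_conv _ _ R), (peval_conv _ _ R); auto; [ring|].
          apply sm_conv; auto; lra. }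
  set (hs := fun n => h n * s ^ n).
  (* [hs] is the reciprocal of g (s t) = g + eps, hence g hs = 1 - eps hs; multiply by h. *)
  assert (Ehs : forall n, hs n = h n + - (1) * conv h (conv eps hs) n).
  { intros n. assert (Q : forall k, conv g hs k = psone k + - (1) * conv eps hs k).
    { intros k. assert (Q1 : conv (fun n => g n * s ^ n) hs k = psone k).
      { unfold hs. rewrite conv_pow, E. destruct k; simpl; ring. }
      rewrite <- Q1. unfold eps. rewrite conv_plus_l, conv_scal_l. ring. }
    rewrite <- (conv_one_l hs n) at 1.
    rewrite (conv_ext psone (conv h g) hs hs n); [|intros; rewrite conv_comm; now rewrite E|reflexivity].
    rewrite conv_assoc, (conv_ext h h _ _ n (fun _ _ => eq_refl) (fun k _ => Q k)).
    rewrite conv_plus_r, conv_one_r, conv_scal_r. reflexivity. }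
  (* [eps] has no constant term, so coefficient n of a new iterate reads only coefficients below n
     of the previous one. *)
  assert (Uhs : forall K n, (n < K)%nat -> u K n = hs n).
  { induction K; intros n Hn; [lia|]. rewrite Ehs. simpl. f_equal. f_equal.
    apply conv_ext; [reflexivity|]. intros k Hk. destruct k as [|k].
    - simpl. unfold eps. simpl. ring.
    - simpl. replace (eps O) with (RtoC 0) by (unfold eps; simpl; ring). rewrite !Cmult_0_l. f_equal.
      apply conv_ext; [reflexivity|]. intros j Hj. apply IHK. lia. }
  intros n. destruct (Hu (S n)) as [S1 B1].
  assert (CE := cauchy_estimate (u (S n)) R (2 / m) ltac:(lra) S1
    (fun z Hz => B1 z (Req_le _ _ Hz)) n).
  rewrite Uhs in CE by lia. unfold hs in CE.
  rewrite Cmod_mult, Cmod_pow, Cmod_R, Rabs_pos_eq in CE by lra.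
  rewrite Rpow_mult_distr. lra.
Qed.

(** Starting from the radius given by [inv_start], each use of [inv_step] multiplies it by s, and
    finitely many uses reach rho because m and s do not change on the way. *)
Lemma inv_bound g h rho s m : (0 < rho)%R -> (1 < s)%R -> (0 < m)%R ->
  (forall n, conv g h n = psone n) -> sm g (s * rho) ->
  (forall t, (Cmod t <= rho)%R -> (m <= Cmod (peval g t))%R /\ (Cmod (peval g (s * t) - peval g t) <= m / 2)%R) ->
  sm h rho /\ forall n, (Cmod (h n) * rho ^ n <= 2 / m)%R.
Proof.
  intros Hr Hs Hm E Hg H.
  destruct (inv_start g h (s * rho) ltac:(nra) Hg E) as (R0 & HR0 & Hst).
  assert (Cl : forall k R, (0 < R <= rho)%R -> (R < R0 * s ^ k)%R -> sm h R).
  { induction k; intros R HR HRk.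
    - apply Hst. simpl in HRk. lra.
    - set (b := Rmin rho (R0 * s ^ k)).
      assert (Hb : (R / s < b)%R).
      { simpl in HRk. apply Rmin_glb_lt; apply (Rmult_lt_reg_r s); try lra;
          unfold Rdiv; rewrite Rmult_assoc, Rinv_l by lra; nra. }
      (* A radius strictly above R / s: [inv_step] only bounds the terms at s R', and summability
         follows at the strictly smaller R. *)
      set (R' := ((R / s + b) / 2)%R).
      assert (P0 : (0 < R / s)%R) by (apply Rdiv_lt_0_compat; lra).
      assert (P1 : (R / s < R' < b)%R) by (unfold R'; lra).
      assert (b <= rho)%R by apply Rmin_l. assert (b <= R0 * s ^ k)%R by apply Rmin_r.
      assert (S1 : sm h R') by (apply IHk; lra).
      assert (P2 : (R < s * R')%R).
      { replace R with (s * (R / s))%R by (field; lra). apply Rmult_lt_compat_l; lra. }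
      assert (B := inv_step g h R' s m ltac:(lra) Hs Hm E S1).
      assert (B' := B ltac:(apply (sm_mono g (s * rho)); [split; nra|exact Hg])
        ltac:(intros t Ht; apply H; lra)).
      assert (P3 : (0 < s * R')%R) by nra.
      apply (sm_bound h (2 / m) (/ (s * R')) R); try lra.
      + left; now apply Rinv_0_lt_compat.
      + apply (Rmult_lt_reg_l (s * R')); [exact P3|]. rewrite <- Rmult_assoc, Rinv_r; lra.
      + intros n. specialize (B' n). assert (P4 : (0 < (s * R') ^ n)%R) by now apply pow_lt.
        rewrite pow_inv. apply (Rmult_le_reg_r ((s * R') ^ n)); [exact P4|].
        rewrite (Rmult_assoc (2 / m)), Rinv_l; lra. }
  assert (S1 : sm h rho).
  { destruct (Pow_x_infinity s ltac:(rewrite Rabs_pos_eq; lra) (rho / R0 + 1)) as [k Hk].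
    apply (Cl k); [lra|]. specialize (Hk k ltac:(lia)).
    rewrite Rabs_pos_eq in Hk by (apply pow_le; lra).
    replace rho with (R0 * (rho / R0))%R at 1 by (field; lra). apply Rmult_lt_compat_l; lra. }
  split; [exact S1|]. intros n.
  assert (B := inv_step g h rho s m Hr Hs Hm E S1 Hg H n).
  eapply Rle_trans; [|exact B]. apply Rmult_le_compat_l; [apply Cmod_ge_0|].
  apply pow_incr. nra.
Qed.

(** * Compactness *)

(** Heine-Borel without coverings: [P x m] reads as a property with margin m, easier for small m,
    and local margins yield a common one. The proof takes the supremum of the x for which [-1,x] has
    a common margin. *)
Lemma compact_1d (P : R -> R -> Prop) :
  (forall x m m', (m' <= m)%R -> P x m -> P x m') ->
  (forall x, (-1 <= x <= 1)%R -> exists d, (0 < d)%R /\ forall y, (Rabs (y - x) < d)%R -> P y d) ->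
  exists m, (0 < m)%R /\ forall x, (-1 <= x <= 1)%R -> P x m.
Proof.
  intros Hm Hl.
  set (E := fun x => (-1 <= x <= 1)%R /\ exists m, (0 < m)%R /\ forall y, (-1 <= y <= x)%R -> P y m).
  assert (E1 : E (-1)%R).
  { split; [lra|]. destruct (Hl (-1)%R ltac:(lra)) as (d & Hd & H). exists d. split; [exact Hd|].
    intros y Hy. apply H. rewrite Rabs_pos_eq; lra. }
  destruct (completeness E) as [c [Hc1 Hc2]].
  - exists 1%R. intros x [Hx _]. lra.
  - now exists (-1)%R.
  - assert (C1 : (-1 <= c <= 1)%R).
    { split; [now apply Hc1|]. apply Hc2. intros x [Hx _]. lra. }
    destruct (Hl c C1) as (d & Hd & H).
    assert (X : exists x, E x /\ (c - d < x)%R).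
    { apply NNPP. intros N. assert (c <= c - d)%R; [|lra]. apply Hc2. intros x Hx.
      apply Rnot_lt_le. intros L. apply N. now exists x. }
    destruct X as (x & [Hx (m & Hm0 & HP)] & Lx).
    assert (Ux : (x <= c)%R) by (apply Hc1; split; [exact Hx|now exists m]).
    assert (Y : forall y, (-1 <= y <= 1)%R -> (y < c + d)%R -> P y (Rmin m d)).
    { intros y Hy Ly. destruct (Rle_lt_dec y x).
      - apply (Hm y m); [apply Rmin_l|]. apply HP. lra.
      - apply (Hm y d); [apply Rmin_r|]. apply H. apply Rabs_def1; lra. }
    assert (Pm : (0 < Rmin m d)%R) by now apply Rmin_pos.
    exists (Rmin m d). split; [exact Pm|].
    destruct (Rle_lt_dec 1 c) as [L|L].
    + intros y Hy. apply Y; lra.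
    + exfalso. set (x' := Rmin 1 (c + d / 2)).
      assert (x' <= 1)%R by apply Rmin_l. assert (x' <= c + d / 2)%R by apply Rmin_r.
      assert (c < x')%R by (apply Rmin_glb_lt; lra).
      assert (x' <= c)%R; [|lra]. apply Hc1. split; [lra|]. exists (Rmin m d). split; [exact Pm|].
      intros y Hy. apply Y; lra.
Qed.

Lemma Cmod_le_sum (x y : R) : (Cmod (x, y) <= Rabs x + Rabs y)%R.
Proof.
  replace ((x, y) : C) with (RtoC x + Ci * RtoC y).
  - eapply Rle_trans; [apply Cmod_triangle|].
    rewrite Cmod_mult, Cmod_Ci, !Cmod_R. lra.
  - apply injective_projections; simpl; ring.
Qed.

(** The one-dimensional case twice on a square: first along y, with a margin that also serves all x
    near x0, then along x. *)
Lemma compact_C (P : C -> R -> Prop) :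
  (forall x m m', (m' <= m)%R -> P x m -> P x m') ->
  (forall x, exists d, (0 < d)%R /\ forall y, (Cmod (y - x) < d)%R -> P y d) ->
  exists m, (0 < m)%R /\ forall x, (Cmod x <= 1)%R -> P x m.
Proof.
  intros Hm Hl.
  destruct (compact_1d (fun x m => forall y, (-1 <= y <= 1)%R -> P (x, y) m)) as (m & H0 & H).
  - intros x m m' L H y Hy. apply (Hm _ m); auto.
  - intros x0 Hx0.
    destruct (compact_1d (fun y m => forall x, (Rabs (x - x0) < m)%R -> P (x, y) m)) as (m & H0 & H).
    + intros y m m' L H x Hx. apply (Hm _ m); [exact L|]. apply H. lra.
    + intros y0 Hy0. destruct (Hl (x0, y0)) as (d & Hd & H). exists (d / 2)%R. split; [lra|].
      intros y Hy x Hx. apply (Hm _ d); [lra|]. apply H.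
      eapply Rle_lt_trans; [apply (Cmod_le_sum (x + - x0) (y + - y0))|].
      unfold Rminus in *. lra.
    + exists m. split; [exact H0|]. intros x Hx y Hy. apply H; auto.
  - exists m. split; [exact H0|]. intros [x y] Hx.
    assert (Q := Rmax_Cmod (x, y)). simpl in Q.
    pose proof (Rmax_l (Rabs x) (Rabs y)). pose proof (Rmax_r (Rabs x) (Rabs y)).
    assert (Rabs x <= 1)%R by lra. assert (Rabs y <= 1)%R by lra.
    apply H; apply Rabs_le_between; assumption.
Qed.

Lemma compact_C2 (P : C -> C -> R -> Prop) :
  (forall x y m m', (m' <= m)%R -> P x y m -> P x y m') ->
  (forall x0 y0, exists d, (0 < d)%R /\ forall x y, (Cmod (x - x0) < d)%R ->
     (Cmod (y - y0) < d)%R -> P x y d) ->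
  exists m, (0 < m)%R /\ forall x y, (Cmod x <= 1)%R -> (Cmod y <= 1)%R -> P x y m.
Proof.
  intros Hm Hl.
  destruct (compact_C (fun x m => forall y, (Cmod y <= 1)%R -> P x y m)) as (m & H0 & H).
  - intros x m m' L H y Hy. apply (Hm _ _ m); auto.
  - intros x0.
    destruct (compact_C (fun y m => forall x, (Cmod (x - x0) < m)%R -> P x y m)) as (m & H0 & H).
    + intros y m m' L H x Hx. apply (Hm _ _ m); [exact L|]. apply H. lra.
    + intros y0. destruct (Hl x0 y0) as (d & Hd & H). exists d. auto.
    + exists m. split; [exact H0|]. intros x Hx y Hy. apply H; auto.
  - exists m. auto.
Qed.

Lemma Cmod_dist (z w : C) : (Rabs (Cmod z - Cmod w) <= Cmod (z - w))%R.
Proof.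
  assert (H1 := Cmod_triangle (z - w) w). assert (H2 := Cmod_triangle (- (z - w)) z).
  replace (z - w + w) with z in H1 by ring. replace (- (z - w) + z) with w in H2 by ring.
  rewrite Cmod_opp in H2. apply Rabs_le. lra.
Qed.

(** Replaces the existence of a minimum on a compact set; the Lipschitz hypothesis makes the local
    lower bounds explicit. *)
Lemma lip_lower_bound (phi : C -> C -> R) rho K : (0 < rho)%R -> (0 < K)%R ->
  (forall z w z' w', (Cmod z <= rho)%R -> (Cmod w <= rho)%R -> (Cmod z' <= rho)%R -> (Cmod w' <= rho)%R ->
    (Rabs (phi z w - phi z' w') <= K * (Cmod (z - z') + Cmod (w - w')))%R) ->
  (forall z w, (Cmod z <= rho)%R -> (Cmod w <= rho)%R -> (0 < phi z w)%R) ->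
  exists m, (0 < m)%R /\ forall z w, (Cmod z <= rho)%R -> (Cmod w <= rho)%R -> (m <= phi z w)%R.
Proof.
  intros Hr HK L Pos.
  assert (B : forall y, (Cmod y <= 1)%R -> (Cmod (rho * y) <= rho)%R).
  { intros y Hy. rewrite Cmod_mult, Cmod_R, Rabs_pos_eq by lra. nra. }
  destruct (compact_C2 (fun x y m => (Cmod x <= 1)%R -> (Cmod y <= 1)%R -> (m <= phi (rho * x)%C (rho * y)%C)%R))
    as (m & Hm & H).
  - intros x y m m' Hle H Hx Hy. specialize (H Hx Hy). lra.
  - assert (Far : forall x, (1 < Cmod x)%R -> forall y, (Cmod (y - x) < Cmod x - 1)%R -> (Cmod y <= 1)%R -> False).
    { intros x Hx y Hy Hy1. assert (D := Cmod_dist y x). apply Rabs_le_between in D. lra. }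
    intros x y. destruct (Rle_lt_dec (Cmod x) 1) as [Lx|Lx].
    2:{ exists (Cmod x - 1)%R. split; [lra|]. intros x' y' H1' _ H2' _. exfalso. now apply (Far x Lx x'). }
    destruct (Rle_lt_dec (Cmod y) 1) as [Ly|Ly].
    2:{ exists (Cmod y - 1)%R. split; [lra|]. intros x' y' _ H1' _ H2'. exfalso. now apply (Far y Ly y'). }
    set (v := phi (rho * x) (rho * y)). assert (Hv : (0 < v)%R) by (apply Pos; auto).
    assert (PK : (0 < K * rho)%R) by now apply Rmult_lt_0_compat.
    (* Moving both arguments by less than d lowers phi by at most 2 K rho d, and v - 2 K rho d =
       d. *)
    set (d := (v / (1 + 2 * (K * rho)))%R). assert (Hd : (0 < d)%R) by (apply Rdiv_lt_0_compat; lra).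
    assert (Ed : (d + 2 * (K * rho) * d = v)%R) by (unfold d; field; lra).
    exists d. split; [exact Hd|]. intros x' y' Hx' Hy' Hx1 Hy1.
    assert (L' := L (rho * x) (rho * y) (rho * x') (rho * y') (B _ Lx) (B _ Ly) (B _ Hx1) (B _ Hy1)).
    replace (rho * x - rho * x') with (rho * - (x' - x)) in L' by ring.
    replace (rho * y - rho * y') with (rho * - (y' - y)) in L' by ring.
    rewrite !Cmod_mult, !Cmod_opp, Cmod_R, (Rabs_pos_eq rho) in L' by lra. fold v in L'. apply Rabs_le_between in L'.
    assert (K * rho * (Cmod (x' - x) + Cmod (y' - y)) <= K * rho * (2 * d))%R by (apply Rmult_le_compat_l; lra). lra.
  - exists m. split; [exact Hm|]. intros z w Hz Hw.
    assert (S : forall z, (Cmod z <= rho)%R -> (Cmod (/ rho * z) <= 1)%R /\ z = rho * (/ rho * z)).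
    { intros y Hy. split.
      - rewrite <- RtoC_inv, Cmod_mult, Cmod_R, Rabs_pos_eq by (try left; try apply Rinv_0_lt_compat; lra).
        apply (Rmult_le_reg_l rho); [lra|]. rewrite <- Rmult_assoc, Rinv_r; lra.
      - field. intros E. apply RtoC_inj in E. lra. }
    destruct (S z Hz) as [C1 E1]. destruct (S w Hw) as [C2 E2]. rewrite E1, E2. now apply H.
Qed.

(** * Lipschitz estimates and power series on the unit disk *)

(** Bernoulli's inequality for y/x = 1 + d. It absorbs the factor n+1 of a derivative into a
    slightly larger ratio. *)
Lemma linear_le_pow x y : (0 < x < y)%R ->
  exists K, (0 < K)%R /\ forall n, (INR (S n) * x ^ n <= K * y ^ n)%R.
Proof.
  intros Hxy. set (d := (y / x - 1)%R).
  assert (Hd : (0 < d)%R).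
  { unfold d. assert (1 < y / x)%R; [|lra]. apply (Rmult_lt_reg_r x); [lra|].
    unfold Rdiv. rewrite Rmult_assoc, Rinv_l; lra. }
  exists (1 + / d)%R. assert (0 < / d)%R by now apply Rinv_0_lt_compat. split; [lra|].
  intros n. assert (B := poly n d Hd).
  replace (1 + d)%R with (y / x)%R in B by (unfold d; ring).
  assert (E : (y ^ n = (y / x) ^ n * x ^ n)%R).
  { rewrite <- Rpow_mult_distr. f_equal. field. lra. }
  rewrite E, <- Rmult_assoc. apply Rmult_le_compat_r; [apply pow_le; lra|].
  rewrite S_INR. pose proof (pos_INR n).
  apply Rle_trans with ((1 + / d) * (1 + INR n * d))%R; [|apply Rmult_le_compat_l; lra].
  replace ((1 + / d) * (1 + INR n * d))%R with (1 + INR n * d + / d + INR n)%R by (field; lra). nra.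
Qed.

Lemma Cpow_lip z w r n : (Cmod z <= r)%R -> (Cmod w <= r)%R ->
  (Cmod (z ^ S n - w ^ S n) <= INR (S n) * r ^ n * Cmod (z - w))%R.
Proof.
  intros Hz Hw. assert (Hr : (0 <= r)%R) by (pose proof (Cmod_ge_0 z); lra).
  induction n.
  - simpl. rewrite !Cmult_1_r. lra.
  - replace (z ^ S (S n) - w ^ S (S n)) with (z * (z ^ S n - w ^ S n) + (z - w) * w ^ S n)
      by (rewrite (Cpow_S z (S n)), (Cpow_S w (S n)); ring).
    eapply Rle_trans; [apply Cmod_triangle|].
    rewrite !Cmod_mult, Cmod_pow, (S_INR (S n)).
    assert (B : (Cmod w ^ S n <= r ^ S n)%R) by (apply pow_incr; split; [apply Cmod_ge_0|exact Hw]).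
    pose proof (Cmod_ge_0 (z - w)). pose proof (Cmod_ge_0 (z ^ S n - w ^ S n)).
    pose proof (Cmod_ge_0 z).
    apply Rle_trans with (r * (INR (S n) * r ^ n * Cmod (z - w)) + Cmod (z - w) * r ^ S n)%R.
    + apply Rplus_le_compat; [|now apply Rmult_le_compat_l].
      apply Rmult_le_compat; auto.
    + simpl pow. nra.
Qed.

(** The order of the quantifiers is the point: K depends on Q and rho only, so it serves a whole
    family of series dominated by A Q^n. *)
Lemma peval_lip Q rho : (0 < Q)%R -> (0 < rho)%R -> (Q * rho < 1)%R ->
  exists K, (0 < K)%R /\ forall a A, (0 <= A)%R -> (forall n, Cmod (a n) <= A * Q ^ n)%R ->
  forall z w, (Cmod z <= rho)%R -> (Cmod w <= rho)%R ->
  (Cmod (peval a z - peval a w) <= A * K * Cmod (z - w))%R.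
Proof.
  intros HQ Hr Hqr. set (x := (Q * rho)%R) in *. assert (Hx : (0 < x)%R) by now apply Rmult_lt_0_compat.
  set (y := ((x + 1) / 2)%R). destruct (linear_le_pow x y ltac:(unfold y; lra)) as (K & HK & B).
  exists (Q * K / (1 - y))%R. assert (Hy : (0 <= y < 1)%R) by (unfold y; lra).
  split; [apply Rdiv_lt_0_compat; [apply Rmult_lt_0_compat|]; lra|].
  intros a A HA Ha z w Hz Hw.
  assert (Sz : sm a rho) by (apply (sm_bound a A Q); auto; lra).
  assert (Az := sm_asum _ _ _ Sz Hz). assert (Aw := sm_asum _ _ _ Sz Hw).
  assert (E : peval a z - peval a w = cseries (fun n => a (S n) * (z ^ S n - w ^ S n))).
  { transitivity (cseries (fun n => a n * z ^ n + - (1) * (a n * w ^ n))).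
    - rewrite cseries_plus, cseries_scal; auto; [unfold peval; ring|]. now apply asum_scal.
    - rewrite (cseries_split _ 1).
      + replace (csum _ 1) with (RtoC 0); [|simpl; ring].
        rewrite Cplus_0_l. apply cseries_ext. intros n. change (1 + n)%nat with (S n). ring.
      + apply asum_plus; auto. now apply asum_scal. }
  rewrite E. replace (A * (Q * K / (1 - y)) * Cmod (z - w))%R with (A * Q * K * Cmod (z - w) / (1 - y))%R
    by (field; lra).
  apply cseries_geom; [exact Hy|]. intros n. rewrite Cmod_mult.
  pose proof (Cmod_ge_0 (z - w)). assert (0 <= INR (S n) * rho ^ n)%R.
  { apply Rmult_le_pos; [apply pos_INR|apply pow_le; lra]. }
  apply Rle_trans with (A * Q ^ S n * (INR (S n) * rho ^ n * Cmod (z - w)))%R.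
  - apply Rmult_le_compat; auto using Cmod_ge_0. now apply Cpow_lip.
  - specialize (B n). unfold x in B. rewrite Rpow_mult_distr in B. simpl pow.
    replace (A * (Q * Q ^ n) * (INR (S n) * rho ^ n * Cmod (z - w)))%R with
      (A * Q * Cmod (z - w) * (INR (S n) * (Q ^ n * rho ^ n)))%R by ring.
    replace (A * Q * K * Cmod (z - w) * y ^ n)%R with (A * Q * Cmod (z - w) * (K * y ^ n))%R by ring.
    apply Rmult_le_compat_l; [|exact B]. apply Rmult_le_pos; [apply Rmult_le_pos|]; lra.
Qed.

(* One dilation factor serves a whole family of power series with common coefficient bounds. *)
Lemma choose_dilation A Q rho m : (0 < A)%R -> (0 < Q)%R -> (0 < rho)%R -> (Q * rho < 1)%R -> (0 < m)%R ->
  exists s, (1 < s)%R /\ (Q * (s * rho) < 1)%R /\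
  forall a, (forall n, Cmod (a n) <= A * Q ^ n)%R -> forall t, (Cmod t <= rho)%R ->
  (Cmod (peval a (s * t) - peval a t) <= m)%R.
Proof.
  intros HA HQ Hr Hqr Hm. set (x := (Q * rho)%R) in *. assert (Hx : (0 < x)%R) by now apply Rmult_lt_0_compat.
  set (r' := ((rho + / Q) / 2)%R).
  assert (HiQ : (rho < / Q)%R).
  { apply (Rmult_lt_reg_l Q); [exact HQ|]. rewrite Rinv_r by lra. exact Hqr. }
  assert (Hr' : (Q * r' < 1)%R).
  { apply Rlt_le_trans with (Q * / Q)%R; [|rewrite Rinv_r; lra]. apply Rmult_lt_compat_l; unfold r'; lra. }
  destruct (peval_lip Q r' HQ ltac:(unfold r'; lra) Hr') as (K & HK & L).
  (* The first bound keeps the dilated points in the disk of radius r', where the Lipschitz constant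
     is valid; the second makes A K e rho <= m. *)
  set (e := Rmin (r' / rho - 1) (m / (A * K * rho))).
  assert (E1 : (0 < r' / rho - 1)%R).
  { assert (1 < r' / rho)%R; [|lra]. apply (Rmult_lt_reg_r rho); [lra|].
    unfold Rdiv. rewrite Rmult_assoc, Rinv_l by lra. unfold r'. lra. }
  assert (P : (0 < A * K * rho)%R) by (repeat apply Rmult_lt_0_compat; lra).
  assert (He : (0 < e)%R) by (apply Rmin_pos; [exact E1|now apply Rdiv_lt_0_compat]).
  assert (e <= r' / rho - 1)%R by apply Rmin_l. assert (He2 : (e <= m / (A * K * rho))%R) by apply Rmin_r.
  assert (S1 : ((1 + e) * rho <= r')%R).
  { replace r' with (r' / rho * rho)%R by (field; lra). apply Rmult_le_compat_r; lra. }
  exists (1 + e)%R. split; [lra|]. split.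
  { eapply Rle_lt_trans; [|exact Hr']. apply Rmult_le_compat_l; lra. }
  intros a Ha t Ht. eapply Rle_trans.
  - apply (L a A); [lra|exact Ha| |unfold r'; lra].
    rewrite Cmod_mult, Cmod_R, Rabs_pos_eq by lra. pose proof (Cmod_ge_0 t). nra.
  - replace ((1 + e)%R * t - t) with (e * t) by (rewrite RtoC_plus; ring).
    rewrite Cmod_mult, Cmod_R, Rabs_pos_eq by lra.
    apply Rle_trans with (A * K * (e * rho))%R.
    + apply Rmult_le_compat_l; [apply Rmult_le_pos; lra|]. apply Rmult_le_compat_l; lra.
    + replace (A * K * (e * rho))%R with (e * (A * K * rho))%R by ring.
      apply (Rmult_le_compat_r (A * K * rho)) in He2; [|lra].
      replace (m / (A * K * rho) * (A * K * rho))%R with m in He2 by (field; lra). exact He2.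
Qed.

(** The standard ratio Q between 1 and 1/rho: above 1, so the coefficients of a series on the disk
    are O(Q^n), and below 1/rho, so Q^n rho^n is summable. *)
Lemma disk_mid rho : (0 < rho < 1)%R -> (1 < (1 + / rho) / 2)%R /\ ((1 + / rho) / 2 * rho < 1)%R.
Proof.
  intros Hr. assert (Hi : (1 < / rho)%R) by (rewrite <- Rinv_1; apply Rinv_lt_contravar; lra).
  split; [lra|]. apply (Rmult_lt_reg_r (/ rho)); [lra|]. rewrite Rmult_assoc, Rinv_r; lra.
Qed.

Definition disk (a : nat -> C) : Prop := forall r, (0 <= r < 1)%R -> sm a r.

Lemma disk_geom a Q : disk a -> (1 < Q)%R -> exists A, (0 < A)%R /\ forall n, (Cmod (a n) <= A * Q ^ n)%R.
Proof.
  intros Ha HQ. assert (0 < / Q < 1)%R.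
  { split; [apply Rinv_0_lt_compat; lra|]. rewrite <- Rinv_1. apply Rinv_lt_contravar; lra. }
  destruct (sm_geom a (/ Q) ltac:(lra) (Ha (/ Q)%R ltac:(lra))) as (A & HA & B).
  exists A. rewrite Rinv_inv in B. auto.
Qed.

Lemma disk_asum a z : disk a -> (Cmod z < 1)%R -> asum (fun n => a n * z ^ n).
Proof. intros Ha Hz. apply (sm_asum a (Cmod z)); [apply Ha|]; pose proof (Cmod_ge_0 z); lra. Qed.
Lemma disk_intro a : (forall Q, (1 < Q)%R -> exists A, forall n, (Cmod (a n) <= A * Q ^ n)%R) -> disk a.
Proof.
  intros H r Hr. set (rho := ((1 + r) / 2)%R). destruct (disk_mid rho ltac:(unfold rho; lra)) as [H1 H2].
  destruct (H _ H1) as [A HA]. apply (sm_mono a rho); [unfold rho; lra|].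
  apply (sm_bound a A ((1 + / rho) / 2) rho); auto; unfold rho in *; lra.
Qed.
Lemma disk_tl a : disk a -> disk (tl a).
Proof.
  intros Ha. apply disk_intro. intros Q HQ. destruct (disk_geom a Q Ha HQ) as (A & HA & B).
  exists (A * Q)%R. intros n. eapply Rle_trans; [apply (B (S n))|]. simpl. lra.
Qed.
Lemma disk_shift k : forall a, disk a -> disk (fun n => a (k + n)%nat).
Proof. induction k; intros a Ha; [exact Ha|]. apply (IHk (tl a)), disk_tl, Ha. Qed.
Lemma peval_tl a z : disk a -> (Cmod z < 1)%R -> peval a z = a O + z * peval (tl a) z.
Proof.
  intros Ha Hz. unfold peval. rewrite (cseries_split _ 1), <- cseries_scal by (apply disk_asum; auto using disk_tl).
  replace (csum _ 1) with (a O) by (simpl; ring). f_equal.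
  apply cseries_ext. intros n. change (1 + n)%nat with (S n). rewrite Cpow_S. unfold tl. ring.
Qed.

Lemma disk_lip a rho : disk a -> (0 < rho < 1)%R -> exists K, (0 < K)%R /\
  forall z w, (Cmod z <= rho)%R -> (Cmod w <= rho)%R -> (Cmod (peval a z - peval a w) <= K * Cmod (z - w))%R.
Proof.
  intros Ha Hr. destruct (disk_mid rho Hr) as [H1 H2].
  destruct (disk_geom a _ Ha H1) as (A & HA & B).
  destruct (peval_lip ((1 + / rho) / 2) rho ltac:(lra) ltac:(lra) H2) as (K & HK & L).
  exists (A * K)%R. split; [now apply Rmult_lt_0_compat|]. intros z w Hz Hw. apply L; auto. lra.
Qed.

Lemma disk_lower_bound a rho : disk a -> (0 < rho < 1)%R ->
  (forall z, (Cmod z <= rho)%R -> peval a z <> 0) ->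
  exists m, (0 < m)%R /\ forall z, (Cmod z <= rho)%R -> (m <= Cmod (peval a z))%R.
Proof.
  intros Ha Hr Hz. destruct (disk_lip a rho Ha Hr) as (K & HK & L).
  destruct (lip_lower_bound (fun z _ => Cmod (peval a z)) rho K) as (m & Hm & H); [lra|lra| | |].
  - intros z w z' w' Hz1 _ Hz1' _. eapply Rle_trans; [apply Cmod_dist|].
    eapply Rle_trans; [now apply L|]. pose proof (Cmod_ge_0 (w - w')). apply Rmult_le_compat_l; lra.
  - intros z w Hz1 _. now apply Cmod_gt_0, Hz.
  - exists m. split; [exact Hm|]. intros z Hz1. now apply (H z z).
Qed.

(** Stands in for the fact that a holomorphic function on the disk has a Taylor series converging
    there: on |z| <= rho compactness bounds |g| below, and [inv_bound] extends the reciprocal up to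
    rho, for every rho < 1. *)
Lemma inv_disk g h : disk g -> (forall z, (Cmod z < 1)%R -> peval g z <> 0) ->
  (forall n, conv g h n = psone n) -> disk h.
Proof.
  intros Hg Hz E r Hr. set (rho := ((r + 1) / 2)%R). assert (Hrho : (0 < rho < 1)%R) by (unfold rho; lra).
  apply (sm_mono h rho); [unfold rho; lra|].
  destruct (disk_lower_bound g rho Hg Hrho) as (m & Hm & Lm).
  { intros z Hz1. apply Hz. lra. }
  destruct (disk_mid rho Hrho) as [H1 H2]. set (Q := ((1 + / rho) / 2)%R) in *.
  destruct (disk_geom g Q Hg H1) as (A & HA & B).
  destruct (choose_dilation A Q rho (m / 2) HA ltac:(lra) ltac:(lra) H2 ltac:(lra)) as (s & Hs & Hq & D).
  apply (inv_bound g h rho s m); auto; try lra.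
  apply (sm_bound g A Q); auto; nra.
Qed.

(** * Divided differences *)

Definition deriv (a : nat -> C) : nat -> C := fun n => INR (S n) * a (S n).

Lemma disk_deriv a : disk a -> disk (deriv a).
Proof.
  intros Ha. apply disk_intro. intros Q HQ. set (x := ((1 + Q) / 2)%R).
  destruct (disk_geom a x Ha ltac:(unfold x; lra)) as (A & HA & B).
  destruct (linear_le_pow x Q ltac:(unfold x; lra)) as (K & HK & L).
  exists (A * x * K)%R. intros n. unfold deriv. rewrite Cmod_mult, Cmod_R, Rabs_pos_eq by apply pos_INR.
  apply Rle_trans with (INR (S n) * (A * x ^ S n))%R.
  - apply Rmult_le_compat_l; [apply pos_INR|apply B].
  - simpl pow. replace (INR (S n) * (A * (x * x ^ n)))%R with (A * x * (INR (S n) * x ^ n))%R by ring.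
    rewrite (Rmult_assoc (A * x)). apply Rmult_le_compat_l; [|apply L]. apply Rmult_le_pos; unfold x; lra.
Qed.

(* The quotient [(z ^ (n + 1) - w ^ (n + 1)) / (z - w)], as a polynomial. *)
Fixpoint pq (n : nat) (z w : C) : C :=
  match n with O => 1 | S m => z ^ S m + w * pq m z w end.
Definition divdiff (b : nat -> C) (z w : C) : C := cseries (fun n => b (S n) * pq n z w).

Lemma pq_mul n z w : (z - w) * pq n z w = z ^ S n - w ^ S n.
Proof.
  induction n; [simpl; ring|].
  change (pq (S n) z w) with (z ^ S n + w * pq n z w).
  replace ((z - w) * (z ^ S n + w * pq n z w)) with ((z - w) * z ^ S n + w * ((z - w) * pq n z w)) by ring.
  rewrite IHn, (Cpow_S z (S n)), (Cpow_S w (S n)). ring.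
Qed.
Lemma pq_diag n z : pq n z z = INR (S n) * z ^ n.
Proof.
  induction n; [simpl; ring|]. change (pq (S n) z z) with (z ^ S n + z * pq n z z).
  rewrite IHn, (S_INR (S n)), RtoC_plus, Cpow_S. ring.
Qed.
Lemma pq_scale n t z w : pq n (t * z) (t * w) = pq n z w * t ^ n.
Proof.
  induction n; [simpl; ring|].
  change (pq (S n) (t * z) (t * w)) with ((t * z) ^ S n + t * w * pq n (t * z) (t * w)).
  change (pq (S n) z w) with (z ^ S n + w * pq n z w).
  rewrite IHn, Cpow_mult_l, !Cpow_S. ring.
Qed.
Lemma pq_bound n z w r : (Cmod z <= r)%R -> (Cmod w <= r)%R -> (Cmod (pq n z w) <= INR (S n) * r ^ n)%R.
Proof.
  intros Hz Hw. induction n; [simpl; rewrite Cmod_1; lra|].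
  change (pq (S n) z w) with (z ^ S n + w * pq n z w).
  eapply Rle_trans; [apply Cmod_triangle|]. rewrite Cmod_mult, Cmod_pow, (S_INR (S n)).
  assert (Cmod z ^ S n <= r ^ S n)%R by (apply pow_incr; split; [apply Cmod_ge_0|exact Hz]).
  assert (Cmod w * Cmod (pq n z w) <= r * (INR (S n) * r ^ n))%R
    by (apply Rmult_le_compat; auto using Cmod_ge_0).
  simpl pow in *. lra.
Qed.
(** The factor (n+1)(n+2) is that of a second derivative, so summing against b_(n+2) produces the
    series of [deriv (deriv b)] in [divdiff_lip]. *)
Lemma pq_lip n z w z' w' r :
  (Cmod z <= r)%R -> (Cmod w <= r)%R -> (Cmod z' <= r)%R -> (Cmod w' <= r)%R ->
  (Cmod (pq (S n) z w - pq (S n) z' w') <=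
   INR (S n) * INR (S (S n)) * r ^ n * (Cmod (z - z') + Cmod (w - w')))%R.
Proof.
  intros Hz Hw Hz' Hw'. pose proof (Cmod_ge_0 (z - z')). pose proof (Cmod_ge_0 (w - w')).
  pose proof (Cmod_ge_0 z).
  induction n.
  - simpl. replace (z * 1 + w * 1 - (z' * 1 + w' * 1)) with (z - z' + (w - w')) by ring.
    eapply Rle_trans; [apply Cmod_triangle|]. lra.
  - change (pq (S (S n)) z w) with (z ^ S (S n) + w * pq (S n) z w).
    change (pq (S (S n)) z' w') with (z' ^ S (S n) + w' * pq (S n) z' w').
    replace (z ^ S (S n) + w * pq (S n) z w - (z' ^ S (S n) + w' * pq (S n) z' w')) with
      ((z ^ S (S n) - z' ^ S (S n)) + (w * (pq (S n) z w - pq (S n) z' w') + (w - w') * pq (S n) z' w')) by ring.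
    eapply Rle_trans; [apply Cmod_triangle|].
    assert (B1 := Cpow_lip z z' r (S n) Hz Hz').
    assert (B2 := pq_bound (S n) z' w' r Hz' Hw').
    assert (B3 : (Cmod (w * (pq (S n) z w - pq (S n) z' w') + (w - w') * pq (S n) z' w')
      <= r * (INR (S n) * INR (S (S n)) * r ^ n * (Cmod (z - z') + Cmod (w - w')))
       + Cmod (w - w') * (INR (S (S n)) * r ^ S n))%R).
    { eapply Rle_trans; [apply Cmod_triangle|]. rewrite !Cmod_mult.
      apply Rplus_le_compat; apply Rmult_le_compat; auto using Cmod_ge_0; lra. }
    rewrite (S_INR (S (S n))), (S_INR (S n)) in *. pose proof (pos_INR (S n)).
    assert (P : (0 <= r ^ S n)%R) by (apply pow_le; lra).
    set (X := (r ^ S n)%R) in *. replace (r * (INR (S n) * (INR (S n) + 1) * r ^ n *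
      (Cmod (z - z') + Cmod (w - w'))))%R with (INR (S n) * (INR (S n) + 1) * X * (Cmod (z - z') + Cmod (w - w')))%R
      in B3 by (unfold X; simpl pow; ring).
    set (k := INR (S n)) in *. set (p := Cmod (z - z')) in *. set (q := Cmod (w - w')) in *.
    apply Rle_trans with ((k + 1) * X * p + (k * (k + 1) * X * (p + q) + q * ((k + 1) * X)))%R; [lra|].
    assert (0 <= X * p)%R by now apply Rmult_le_pos. assert (0 <= X * q)%R by now apply Rmult_le_pos.
    assert (0 <= k * (X * (p + q)))%R by (apply Rmult_le_pos; lra). nra.
Qed.

Lemma divdiff_asum b z w : disk b -> (Cmod z < 1)%R -> (Cmod w < 1)%R -> asum (fun n => b (S n) * pq n z w).
Proof.
  intros Hb Hz Hw. set (r := Rmax (Cmod z) (Cmod w)).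
  assert (H1 : (Cmod z <= r)%R) by apply Rmax_l. assert (H2 : (Cmod w <= r)%R) by apply Rmax_r.
  assert (H3 : (r < 1)%R) by now apply Rmax_lub_lt. pose proof (Cmod_ge_0 z).
  apply (asum_le _ (fun n => Cmod (deriv b n) * r ^ n)%R); [|apply disk_deriv; auto; lra].
  intros n. unfold deriv. rewrite !Cmod_mult, Cmod_R, (Rabs_pos_eq (INR _)) by apply pos_INR.
  replace (INR (S n) * Cmod (b (S n)) * r ^ n)%R with (Cmod (b (S n)) * (INR (S n) * r ^ n))%R by ring.
  apply Rmult_le_compat_l; [apply Cmod_ge_0|]. now apply pq_bound.
Qed.
Lemma divdiff_mul b z w : disk b -> (Cmod z < 1)%R -> (Cmod w < 1)%R -> (z - w) * divdiff b z w = peval b z - peval b w.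
Proof.
  intros Hb Hz Hw. unfold divdiff. rewrite <- cseries_scal by now apply divdiff_asum.
  assert (Sz : asum (fun n => b n * z ^ n)) by now apply disk_asum.
  assert (Sw : asum (fun n => b n * w ^ n)) by now apply disk_asum.
  unfold peval. rewrite (cseries_split _ 1 Sz), (cseries_split _ 1 Sw).
  replace (csum (fun n => b n * z ^ n) 1) with (csum (fun n => b n * w ^ n) 1) by (simpl; ring).
  transitivity (cseries (fun n => b (1 + n)%nat * z ^ (1 + n)) + - (1) * cseries (fun n => b (1 + n)%nat * w ^ (1 + n))); [|ring].
  apply (asum_shift _ 1) in Sz. apply (asum_shift _ 1) in Sw.
  rewrite <- cseries_scal, <- cseries_plus; auto; [|now apply asum_scal].
  apply cseries_ext. intros n. change (1 + n)%nat with (S n).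
  replace ((z - w) * (b (S n) * pq n z w)) with (b (S n) * ((z - w) * pq n z w)) by ring.
  rewrite pq_mul. ring.
Qed.
Lemma divdiff_diag b z : divdiff b z z = peval (deriv b) z.
Proof. apply cseries_ext. intros n. unfold deriv. rewrite pq_diag. ring. Qed.

Lemma divdiff_lip b rho : disk b -> (0 < rho < 1)%R -> exists K, (0 < K)%R /\ forall z w z' w',
  (Cmod z <= rho)%R -> (Cmod w <= rho)%R -> (Cmod z' <= rho)%R -> (Cmod w' <= rho)%R ->
  (Cmod (divdiff b z w - divdiff b z' w') <= K * (Cmod (z - z') + Cmod (w - w')))%R.
Proof.
  intros Hb Hr. assert (D2 : sm (deriv (deriv b)) rho) by (apply disk_deriv; [now apply disk_deriv|lra]).
  set (K := Series (fun n => Cmod (deriv (deriv b) n) * rho ^ n)%R).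
  assert (HK : (0 <= K)%R).
  { eapply Rle_trans; [apply Cmod_ge_0|]. unfold K.
    erewrite Series_ext; [apply (cseries_bound _ (sm_asum _ _ rho D2 (Cmod_pos rho (Rlt_le _ _ (proj1 Hr)))))|].
    intros n. simpl. now rewrite Cmod_mult, Cmod_pow, Cmod_R, (Rabs_pos_eq rho) by lra. }
  exists (K + 1)%R. split; [lra|]. intros z w z' w' Hz Hw Hz' Hw'.
  set (d := (Cmod (z - z') + Cmod (w - w'))%R).
  assert (Hd : (0 <= d)%R) by (unfold d; pose proof (Cmod_ge_0 (z - z')); pose proof (Cmod_ge_0 (w - w')); lra).
  assert (A1 := divdiff_asum b z w Hb ltac:(lra) ltac:(lra)). assert (A2 := divdiff_asum b z' w' Hb ltac:(lra) ltac:(lra)).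
  assert (E : divdiff b z w - divdiff b z' w' = cseries (fun n => b (S (S n)) * (pq (S n) z w - pq (S n) z' w'))).
  { transitivity (cseries (fun n => b (S n) * pq n z w + - (1) * (b (S n) * pq n z' w'))).
    - rewrite cseries_plus, cseries_scal; auto; [unfold divdiff; ring|]. now apply asum_scal.
    - rewrite (cseries_split _ 1).
      + replace (csum _ 1) with (RtoC 0); [|simpl; ring].
        rewrite Cplus_0_l. apply cseries_ext. intros n. change (1 + n)%nat with (S n). ring.
      + apply asum_plus; auto. now apply asum_scal. }
  assert (T : forall n, (Cmod (b (S (S n)) * (pq (S n) z w - pq (S n) z' w'))
     <= d * (Cmod (deriv (deriv b) n) * rho ^ n))%R).
  { intros n. unfold deriv. rewrite !Cmod_mult, !Cmod_R, !(Rabs_pos_eq (INR _)) by apply pos_INR.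
    assert (L := pq_lip n z w z' w' rho Hz Hw Hz' Hw'). fold d in L.
    replace (d * (INR (S n) * (INR (S (S n)) * Cmod (b (S (S n)))) * rho ^ n))%R with
      (Cmod (b (S (S n))) * (INR (S n) * INR (S (S n)) * rho ^ n * d))%R by ring.
    apply Rmult_le_compat_l; [apply Cmod_ge_0|exact L]. }
  assert (X : ex_series (fun n => d * (Cmod (deriv (deriv b) n) * rho ^ n))%R)
    by apply (ex_series_scal (V := R_NormedModule) d _ D2).
  rewrite E. eapply Rle_trans; [apply cseries_bound, (asum_le _ _ T X)|].
  apply Rle_trans with (d * K)%R; [|nra].
  unfold K. rewrite <- Series_scal_l. apply Series_le; [|exact X].
  intros n. split; [apply Cmod_ge_0|apply T].
Qed.

(** The coefficient of w^k in the difference quotient is the sum of b_(k+1+n) p^n. These numbers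
    satisfy c_k = b_(k+1) + p c_(k+1), which gives the identity after multiplication by p - w,
    without rearranging a double series. *)
Lemma divdiff_series b p : disk b -> (Cmod p < 1)%R ->
  exists c, disk c /\ forall w, (Cmod w < 1)%R -> peval c w = divdiff b p w.
Proof.
  intros Hb Hp. pose proof (Cmod_ge_0 p) as Hp0.
  set (c := fun k => peval (fun n => b (S k + n)%nat) p).
  assert (Hc : disk c).
  { apply disk_intro. intros Q' HQ'. destruct (disk_mid ((1 + Cmod p) / 2) ltac:(lra)) as [Q1 Q2].
    (* [Q0] guarantees Q |p| < 1, so that the inner sums converge; Q <= Q' gives the required growth
       in k. *)
    set (Q0 := ((1 + / ((1 + Cmod p) / 2)) / 2)%R) in *. set (Q := Rmin Q0 Q').
    assert (L1 : (Q <= Q0)%R) by apply Rmin_l. assert (L2 : (Q <= Q')%R) by apply Rmin_r.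
    assert (L3 : (1 < Q)%R) by now apply Rmin_glb_lt.
    destruct (disk_geom b Q Hb L3) as (A & HA & B).
    assert (Qp : (Q * Cmod p < 1)%R) by nra.
    exists (A * Q / (1 - Q * Cmod p))%R. intros k.
    apply Rle_trans with (A * Q ^ S k / (1 - Q * Cmod p))%R.
    - apply cseries_geom; [nra|]. intros n. rewrite Cmod_mult, Cmod_pow, Rpow_mult_distr.
      apply Rle_trans with (A * Q ^ (S k + n) * Cmod p ^ n)%R.
      + apply Rmult_le_compat_r; [now apply pow_le|apply B].
      + rewrite pow_add. lra.
    - simpl pow. replace (A * (Q * Q ^ k) / (1 - Q * Cmod p))%R with (A * Q / (1 - Q * Cmod p) * Q ^ k)%R by (field; lra).
      apply Rmult_le_compat_l; [|apply pow_incr; lra].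
      left. apply Rdiv_lt_0_compat; [|lra]. apply Rmult_lt_0_compat; lra. }
  exists c. split; [exact Hc|].
  assert (rec : forall k, c k = b (S k) + p * c (S k)).
  { intros k. unfold c at 1. rewrite peval_tl by (try apply (disk_shift (S k)); auto).
    rewrite Nat.add_0_r. do 2 f_equal. apply peval_ext. intros n. unfold tl. f_equal. lia. }
  assert (c0 : p * c O = peval b p - b O).
  { rewrite (peval_tl b) by auto. change (c O) with (peval (tl b) p). ring. }
  assert (Em : forall w, (Cmod w < 1)%R -> (p - w) * peval c w = (p - w) * divdiff b p w).
  { intros w Hw. rewrite divdiff_mul by auto. pose proof (Cmod_ge_0 w).
    assert (E1 : w * peval c w = peval b w - b O + p * (peval c w - c O)).
    { assert (Tb : sm (tl b) (Cmod w)) by (apply disk_tl; auto). assert (Tc : sm (tl c) (Cmod w)) by (apply disk_tl; auto).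
      rewrite (peval_ext c (fun n => tl b n + p * tl c n)) at 1 by apply rec.
      rewrite (peval_plus _ _ (Cmod w)), (peval_scal _ _ (Cmod w)) by (auto using Rle_refl; apply sm_scal; auto).
      rewrite (peval_tl b), (peval_tl c) by auto. ring. }
    replace ((p - w) * peval c w) with (p * c O + p * (peval c w - c O) - w * peval c w) by ring.
    rewrite E1, c0. ring. }
  assert (Ne : forall w, (Cmod w < 1)%R -> w <> p -> peval c w = divdiff b p w).
  { intros w Hw Hn. specialize (Em w Hw).
    assert (Z : p - w <> 0). { intros Z. apply Hn. replace w with (p - (p - w)) by ring. rewrite Z. ring. }
    replace (peval c w) with (/ (p - w) * ((p - w) * peval c w)) by (field; exact Z).
    rewrite Em. field. exact Z. }
  intros w Hw. destruct (Ceq_dec w p) as [->|D]; [|now apply Ne].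
  (* At w = p the factor p - w is lost. Both sides are Lipschitz and agree at p + x for small x > 0,
     hence they differ at p by at most (K1 + K2) x. *)
  set (rho := ((1 + Cmod p) / 2)%R). assert (Hrho : (0 < rho < 1)%R) by (unfold rho; lra).
  destruct (disk_lip c rho Hc Hrho) as (K1 & HK1 & B1). destruct (divdiff_lip b rho Hb Hrho) as (K2 & HK2 & B2).
  replace (peval c p) with (divdiff b p p + (peval c p - divdiff b p p)) by ring.
  rewrite (Cmod_eq_0 (peval c p - divdiff b p p)); [ring|].
  apply Rle_antisym; [|apply Cmod_ge_0]. apply le_epsilon. intros e He.
  set (x := Rmin ((1 - Cmod p) / 2) (e / (K1 + K2))).
  assert (Hx : (0 < x)%R) by (apply Rmin_pos; [lra|apply Rdiv_lt_0_compat; lra]).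
  assert (X1 : (x <= (1 - Cmod p) / 2)%R) by apply Rmin_l.
  assert (X2 : (x <= e / (K1 + K2))%R) by apply Rmin_r.
  assert (Hq : (Cmod (p + x) <= rho)%R).
  { eapply Rle_trans; [apply Cmod_triangle|]. rewrite Cmod_R, Rabs_pos_eq; unfold rho; lra. }
  assert (Nq : peval c (p + x) = divdiff b p (p + x)).
  { apply Ne; [lra|]. intros Z. assert (RtoC x = 0) by (replace (RtoC x) with (p + x - p) by ring; rewrite Z; ring).
    injection H. lra. }
  replace (peval c p - divdiff b p p) with ((peval c p - peval c (p + x)) + (divdiff b p (p + x) - divdiff b p p)) by (rewrite Nq; ring).
  eapply Rle_trans; [apply Cmod_triangle|].
  specialize (B1 p (p + x) ltac:(unfold rho; lra) Hq).
  specialize (B2 p (p + x) p p ltac:(unfold rho; lra) Hq ltac:(unfold rho; lra) ltac:(unfold rho; lra)).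
  replace (p - (p + x)) with (- x) in B1 by ring. replace (p + x - p) with (RtoC x) in B2 by ring.
  replace (p - p) with (RtoC 0) in B2 by ring.
  rewrite Cmod_opp, Cmod_R, Rabs_pos_eq in B1 by lra. rewrite Cmod_0, Cmod_R, Rabs_pos_eq in B2 by lra.
  apply (Rmult_le_compat_r (K1 + K2)) in X2; [|lra].
  replace (e / (K1 + K2) * (K1 + K2))%R with e in X2 by (field; lra). lra.
Qed.

(** * Derivatives of univalent functions *)

Definition inj_disk (b : nat -> C) : Prop :=
  forall z w, (Cmod z < 1)%R -> (Cmod w < 1)%R -> peval b z = peval b w -> z = w.

Lemma divdiff_neq b z w : disk b -> inj_disk b -> (Cmod z < 1)%R -> (Cmod w < 1)%R -> z <> w -> divdiff b z w <> 0.
Proof.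
  intros Hb Hi Hz Hw D E. apply D, (Hi z w Hz Hw).
  assert (M := divdiff_mul b z w Hb Hz Hw). rewrite E in M.
  replace (peval b z) with (peval b z - peval b w + peval b w) by ring. rewrite <- M. ring.
Qed.

(* If [divdiff b p p <> 0], then [1 / divdiff b p] is a power series on the whole disk, so its value at [p0] is
   bounded by its size on a circle around [p0], uniformly as [p] tends to [p0]. *)
Lemma deriv_neq_limit b p0 : disk b -> inj_disk b -> (Cmod p0 < 1)%R ->
  (forall e, (0 < e)%R -> exists p, (Cmod (p - p0) < e)%R /\ divdiff b p p <> 0) -> divdiff b p0 p0 <> 0.
Proof.
  intros Hb Hi Hp0 Hl E0. pose proof (Cmod_ge_0 p0) as P0.
  set (rho := ((1 + Cmod p0) / 2)%R). assert (Hrho : (Cmod p0 < rho < 1)%R) by (unfold rho; lra).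
  destruct (divdiff_lip b rho Hb ltac:(lra)) as (K & HK & L).
  (* The second summand makes the function positive at [w = p0] without changing it on the circle. *)
  destruct (lip_lower_bound (fun _ w => Cmod (divdiff b p0 w) + Rabs (Cmod w - rho))%R rho (K + 1)) as (m & Hm & Lm);
    [lra|lra| | |].
  { intros z w z' w' Hz Hw Hz' Hw'. assert (L' := L p0 w p0 w' ltac:(lra) Hw ltac:(lra) Hw').
    replace (p0 - p0) with (RtoC 0) in L' by ring. rewrite Cmod_0, Rplus_0_l in L'.
    assert (C1 := Cmod_dist (divdiff b p0 w) (divdiff b p0 w')). assert (C2 := Cmod_dist w w').
    assert (C3 := Rabs_triang_inv2 (Cmod w - rho) (Cmod w' - rho)).
    replace (Cmod w - rho - (Cmod w' - rho))%R with (Cmod w - Cmod w')%R in C3 by ring.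
    assert (C4 := Rabs_triang (Cmod (divdiff b p0 w) - Cmod (divdiff b p0 w')) (Rabs (Cmod w - rho) - Rabs (Cmod w' - rho))).
    match goal with |- (Rabs ?A <= _)%R => match type of C4 with (Rabs ?B <= _)%R => replace A with B by ring end end.
    pose proof (Cmod_ge_0 (z - z')). assert (0 <= (K + 1) * Cmod (z - z'))%R by (apply Rmult_le_pos; lra). lra. }
  { intros z w Hz Hw. pose proof (Rabs_pos (Cmod w - rho)). pose proof (Cmod_ge_0 (divdiff b p0 w)).
    destruct (Ceq_dec p0 w) as [<-|D].
    - assert (0 < Rabs (Cmod p0 - rho))%R by (apply Rabs_pos_lt; lra). lra.
    - assert (0 < Cmod (divdiff b p0 w))%R by (apply Cmod_gt_0, divdiff_neq; auto; lra). lra. }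
  assert (Lm' : forall w, Cmod w = rho -> (m <= Cmod (divdiff b p0 w))%R).
  { intros w Hw. specialize (Lm p0 w ltac:(lra) ltac:(lra)). rewrite Hw, Rminus_diag, Rabs_R0 in Lm. lra. }
  (* The bound on the reciprocal at p0: its coefficients will be at most (2/m) rho^(-n), summed as a
     geometric series at |p0|. *)
  set (B := (2 / m / (1 - Cmod p0 / rho))%R).
  assert (Hfr : (0 <= Cmod p0 / rho < 1)%R).
  { split; [apply Rmult_le_pos; [lra|left; apply Rinv_0_lt_compat; lra]|].
    apply (Rmult_lt_reg_r rho); [lra|]. unfold Rdiv. rewrite Rmult_assoc, Rinv_l; lra. }
  assert (HB : (0 < B)%R) by (unfold B; repeat apply Rdiv_lt_0_compat; lra).
  (* The three bounds keep p in the disk of radius rho, keep |[divdiff b p]| >= m/2 on the circle,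
     and force |[divdiff b p p0]| <= 1/(2B). The last contradicts a reciprocal of size at most B. *)
  set (e := Rmin (rho - Cmod p0) (Rmin (m / 2 / K) (/ (2 * B * K)))).
  assert (He : (0 < e)%R).
  { repeat apply Rmin_pos; [lra| |].
    - repeat apply Rdiv_lt_0_compat; lra.
    - apply Rinv_0_lt_compat. assert (0 < B * K)%R by (apply Rmult_lt_0_compat; assumption). lra. }
  assert (e1 : (e <= rho - Cmod p0)%R) by apply Rmin_l.
  assert (e2 : (e <= m / 2 / K)%R) by (eapply Rle_trans; [apply Rmin_r|apply Rmin_l]).
  assert (e3 : (e <= / (2 * B * K))%R) by (eapply Rle_trans; [apply Rmin_r|apply Rmin_r]).
  destruct (Hl e He) as (p & Hp & Np).
  assert (Hpr : (Cmod p <= rho)%R).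
  { replace p with (p - p0 + p0) by ring. eapply Rle_trans; [apply Cmod_triangle|]. lra. }
  destruct (divdiff_series b p Hb ltac:(lra)) as (c & Hc & Ec).
  assert (Nc : forall z, (Cmod z < 1)%R -> peval c z <> 0).
  { intros z Hz. rewrite Ec by exact Hz. destruct (Ceq_dec p z) as [<-|D]; [exact Np|].
    apply divdiff_neq; auto. lra. }
  assert (c0 : c O <> 0) by (rewrite <- peval_0; apply Nc; rewrite Cmod_0; lra).
  set (h := pinv c). assert (Eh : forall n, conv c h n = psone n) by (intros; now apply pinv_spec). assert (Hh := inv_disk c h Hc Nc Eh).
  assert (Ech : forall z, (Cmod z <= rho)%R -> peval c z * peval h z = 1).
  { intros z Hz. rewrite <- (peval_conv c h rho z); [|apply Hc; lra|apply Hh; lra|exact Hz].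
    rewrite (peval_ext _ psone z Eh). apply peval_one. }
  assert (K * Cmod (p - p0) <= m / 2)%R.
  { apply Rle_trans with (K * (m / 2 / K))%R; [apply Rmult_le_compat_l; lra|]. right. field. lra. }
  assert (Bh : forall n, (Cmod (h n) * rho ^ n <= 2 / m)%R).
  { apply cauchy_estimate; [lra|apply Hh; lra|]. intros z Hz.
    assert (E1 := Ech z ltac:(lra)). rewrite Ec in E1 by lra.
    assert (L1 := L p0 z p z ltac:(lra) ltac:(lra) ltac:(lra) ltac:(lra)).
    replace (z - z) with (RtoC 0) in L1 by ring. rewrite Cmod_0 in L1.
    replace (p0 - p) with (- (p - p0)) in L1 by ring. rewrite Cmod_opp in L1.
    assert (L2 := Lm' z Hz).
    assert (Cmod (divdiff b p0 z) <= Cmod (divdiff b p0 z - divdiff b p z) + Cmod (divdiff b p z))%R.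
    { replace (divdiff b p0 z) with (divdiff b p0 z - divdiff b p z + divdiff b p z) at 1 by ring. apply Cmod_triangle. }
    assert (E2 : (Cmod (divdiff b p z) * Cmod (peval h z) = 1)%R) by (rewrite <- Cmod_mult, E1; apply Cmod_1).
    apply (Rmult_le_reg_l (m / 2)); [lra|]. replace (m / 2 * (2 / m))%R with 1%R by (field; lra).
    pose proof (Cmod_ge_0 (peval h z)). nra. }
  assert (Bp : (Cmod (peval h p0) <= B)%R).
  { apply cseries_geom; [exact Hfr|]. intros n. rewrite Cmod_mult, Cmod_pow.
    specialize (Bh n). assert (Pn : (0 < rho ^ n)%R) by (apply pow_lt; lra).
    unfold Rdiv at 2. rewrite Rpow_mult_distr, pow_inv.
    replace (Cmod (h n) * Cmod p0 ^ n)%R with (Cmod (h n) * rho ^ n * (Cmod p0 ^ n * / rho ^ n))%R by (field; lra).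
    apply Rmult_le_compat_r; [|exact Bh]. apply Rmult_le_pos; [apply pow_le, P0|]. left. now apply Rinv_0_lt_compat. }
  assert (E1 := Ech p0 ltac:(lra)). rewrite Ec in E1 by lra.
  assert (L1 := L p p0 p0 p0 ltac:(lra) ltac:(lra) ltac:(lra) ltac:(lra)).
  rewrite E0 in L1. replace (divdiff b p p0 - 0) with (divdiff b p p0) in L1 by ring.
  replace (p0 - p0) with (RtoC 0) in L1 by ring. rewrite Cmod_0 in L1.
  assert (E2 : (Cmod (divdiff b p p0) * Cmod (peval h p0) = 1)%R) by (rewrite <- Cmod_mult, E1; apply Cmod_1).
  assert (S1 : (K * Cmod (p - p0) <= / (2 * B))%R).
  { apply Rle_trans with (K * (/ (2 * B * K)))%R; [apply Rmult_le_compat_l; lra|]. right. field. lra. }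
  assert (S2 : (1 <= / (2 * B) * B)%R).
  { rewrite <- E2. apply Rmult_le_compat; auto using Cmod_ge_0. lra. }
  replace (/ (2 * B) * B)%R with (/ 2)%R in S2 by (field; lra). lra.
Qed.

(** Continuation along the radius from 0, where the derivative is b_1. The parameters up to which it
    has no zero form an interval that is closed by [deriv_neq_limit] and open by the Lipschitz
    bound. *)
Lemma deriv_neq b z : disk b -> inj_disk b -> b 1%nat <> 0 -> (Cmod z < 1)%R -> divdiff b z z <> 0.
Proof.
  intros Hb Hi H1 Hz Z. pose proof (Cmod_ge_0 z) as P0.
  set (rho := ((1 + Cmod z) / 2)%R). assert (Hrho : (Cmod z < rho < 1)%R) by (unfold rho; lra).
  destruct (divdiff_lip b rho Hb ltac:(lra)) as (K & HK & L).
  set (phi := fun x : R => divdiff b (x * z) (x * z)).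
  assert (Bx : forall x, (0 <= x <= 1)%R -> (Cmod (x * z) <= Cmod z)%R).
  { intros x Hx. rewrite Cmod_mult, Cmod_R, Rabs_pos_eq by lra. nra. }
  assert (Lp : forall x y, (0 <= x <= 1)%R -> (0 <= y <= 1)%R -> (Cmod (phi x - phi y) <= 2 * K * Rabs (x - y))%R).
  { intros x y Hx Hy. assert (Lx := Bx x Hx). assert (Ly := Bx y Hy).
    eapply Rle_trans; [apply L; lra|].
    replace (x * z - y * z) with ((x - y)%R * z) by (rewrite RtoC_minus; ring).
    rewrite Cmod_mult, Cmod_R. pose proof (Rabs_pos (x - y)).
    assert (Rabs (x - y) * Cmod z <= Rabs (x - y) * 1)%R by (apply Rmult_le_compat_l; lra). nra. }
  set (E := fun x => (0 <= x <= 1)%R /\ forall y, (0 <= y <= x)%R -> phi y <> 0).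
  assert (E0 : E 0%R).
  { split; [lra|]. intros y Hy. replace y with 0%R by lra. unfold phi. rewrite Cmult_0_l.
    rewrite divdiff_diag, peval_0. unfold deriv. simpl. rewrite Cmult_1_l. exact H1. }
  destruct (completeness E) as [c [Hc1 Hc2]].
  - exists 1%R. intros x [Hx _]. lra.
  - now exists 0%R.
  - assert (C1 : (0 <= c <= 1)%R).
    { split; [now apply Hc1|]. apply Hc2. intros x [Hx _]. lra. }
    assert (Below : forall x, (0 <= x < c)%R -> phi x <> 0).
    { intros x Hx. assert (X : exists y, E y /\ (x < y)%R).
      { apply NNPP. intros N. assert (c <= x)%R; [|lra]. apply Hc2. intros y Hy.
        apply Rnot_lt_le. intros Ly. apply N. now exists y. }
      destruct X as (y & [Hy HE] & Ly). apply HE. lra. }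
    assert (Pc : phi c <> 0).
    { destruct (Req_dec c 0) as [->|C0]; [apply (proj2 E0); lra|].
      apply deriv_neq_limit; auto; [specialize (Bx c C1); lra|].
      intros e He. set (d := Rmin (c / 2) (e / 2)).
      assert (d1 : (d <= c / 2)%R) by apply Rmin_l. assert (d2 : (d <= e / 2)%R) by apply Rmin_r.
      assert (d3 : (0 < d)%R) by (apply Rmin_pos; lra).
      exists ((c - d)%R * z). split; [|apply Below; lra].
      replace ((c - d)%R * z - c * z) with (- (d * z)) by (rewrite RtoC_minus; ring).
      rewrite Cmod_opp, Cmod_mult, Cmod_R, Rabs_pos_eq by lra. nra. }
    assert (Pv := proj1 (Cmod_gt_0 _) Pc).
    (* Within distance d of c, phi changes by at most 2 K d, half of |phi c|. *)
    set (d := (Cmod (phi c) / (4 * K))%R). assert (Hd : (0 < d)%R) by (apply Rdiv_lt_0_compat; lra).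
    assert (Ed : (4 * K * d = Cmod (phi c))%R) by (unfold d; field; lra).
    assert (Near : forall y, (0 <= y <= 1)%R -> (Rabs (c - y) <= d)%R -> phi y <> 0).
    { intros y Hy Hcy Zy. specialize (Lp c y C1 Hy). rewrite Zy in Lp.
      replace (phi c - 0) with (phi c) in Lp by ring.
      assert (2 * K * Rabs (c - y) <= 2 * K * d)%R by (apply Rmult_le_compat_l; lra). lra. }
    destruct (Rle_lt_dec 1 (c + d)) as [L1|L1].
    + apply (Near 1%R); [lra| |].
      * rewrite Rabs_minus_sym, Rabs_pos_eq; lra.
      * unfold phi. rewrite Cmult_1_l. exact Z.
    + assert (c + d <= c)%R; [|lra]. apply Hc1. split; [lra|]. intros y Hy.
      destruct (Rlt_le_dec y c); [apply Below; lra|]. apply Near; [lra|].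
      rewrite Rabs_minus_sym, Rabs_pos_eq; lra.
Qed.

(** * Square roots and logarithms of power series *)

Lemma INR_S_neq n : RtoC (INR (S n)) <> 0.
Proof. intros Z. apply RtoC_inj in Z. revert Z. apply not_0_INR. lia. Qed.

Lemma Cmod_inv_INR n : (Cmod (/ INR (S n)) <= 1)%R.
Proof.
  rewrite Cmod_inv by apply INR_S_neq. rewrite Cmod_R, Rabs_pos_eq, <- Rinv_1 by apply pos_INR.
  apply Rinv_le_contravar; [lra|]. rewrite S_INR. pose proof (pos_INR n). lra.
Qed.

(** Leibniz's rule is first proved for [th], the operator z d/dz, which does not shift indices and
    so suits the recursion of [conv]. *)
Lemma deriv_conv a b n : deriv (conv a b) n = conv (deriv a) b n + conv a (deriv b) n.
Proof.
  set (th := fun (u : nat -> C) k => INR k * u k).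
  assert (T : forall n a, th (conv a b) n = conv (th a) b n + conv a (th b) n).
  { clear a n. induction n; intros a; [unfold th; simpl; ring|].
    change (INR (S n) * (a O * b (S n) + conv (tl a) b n) =
      th a O * b (S n) + conv (tl (th a)) b n + (a O * th b (S n) + conv (tl a) (th b) n)).
    assert (E : INR n * conv (tl a) b n = conv (th (tl a)) b n + conv (tl a) (th b) n) by apply IHn.
    assert (E2 : conv (tl (th a)) b n = conv (th (tl a)) b n + conv (tl a) b n).
    { rewrite <- conv_plus_l. apply conv_ext; [|reflexivity]. intros k _. unfold th, tl.
      rewrite S_INR, RtoC_plus. ring. }
    rewrite E2. replace (th a O) with (RtoC 0) by (unfold th; simpl; ring).
    replace (th b (S n)) with ((INR n + 1) * b (S n)) by (unfold th; rewrite S_INR, RtoC_plus; reflexivity).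
    rewrite S_INR, RtoC_plus.
    replace ((INR n + 1) * (a O * b (S n) + conv (tl a) b n)) with
      ((INR n + 1) * a O * b (S n) + (INR n * conv (tl a) b n + conv (tl a) b n)) by ring.
    rewrite E. ring. }
  assert (Q := T (S n) a).
  change (deriv (conv a b) n = th a O * b (S n) + conv (deriv a) b n + conv a (th b) (S n)) in Q.
  rewrite Q, (conv_S_r a (th b)). change (tl (th b)) with (deriv b).
  unfold th. simpl (INR 0). ring.
Qed.

Lemma ode_unique B y y' : y O = y' O ->
  (forall n, deriv y n = conv B y n) -> (forall n, deriv y' n = conv B y' n) -> forall n, y n = y' n.
Proof.
  intros H0 H1 H2.
  assert (forall n k, (k <= n)%nat -> y k = y' k) as H; [|intros n; now apply (H n)].
  induction n; intros k Hk; [now replace k with O by lia|].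
  destruct (le_lt_dec k n) as [L|L]; [now apply IHn|]. replace k with (S n) by lia.
  assert (N := INR_S_neq n).
  replace (y (S n)) with (/ INR (S n) * deriv y n) by (unfold deriv; field; exact N).
  replace (y' (S n)) with (/ INR (S n) * deriv y' n) by (unfold deriv; field; exact N).
  rewrite H1, H2. f_equal. apply conv_ext; auto.
Qed.

Lemma disk_conv a b : disk a -> disk b -> disk (conv a b).
Proof. intros Ha Hb r Hr. apply sm_conv; [lra|now apply Ha|now apply Hb]. Qed.
Lemma disk_scal c a : disk a -> disk (fun n => c * a n).
Proof. intros Ha r Hr. apply sm_scal; [lra|now apply Ha]. Qed.

Lemma rsum_geom x y n : (0 <= x < y)%R -> (rsum (fun k => x ^ k * y ^ (n - k)) (S n) <= y ^ S n / (y - x))%R.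
Proof.
  intros Hxy. apply (Rmult_le_reg_l (y - x)); [lra|].
  replace ((y - x) * (y ^ S n / (y - x)))%R with (y ^ S n)%R by (field; lra).
  apply Rle_trans with (y ^ S n - x ^ S n)%R; [|assert (0 <= x ^ S n)%R by (apply pow_le; lra); lra].
  right. induction n; [simpl; ring|].
  change (rsum (fun k => x ^ k * y ^ (S n - k))%R (S (S n))) with
    (rsum (fun k => x ^ k * y ^ (S n - k))%R (S n) + x ^ S n * y ^ (S n - S n))%R.
  rewrite (rsum_ext _ (fun k => y * (x ^ k * y ^ (n - k)))%R).
  - rewrite rsum_scal, Nat.sub_diag, Rmult_plus_distr_l.
    replace ((y - x) * (y * rsum (fun k => x ^ k * y ^ (n - k)) (S n)))%R with
      (y * ((y - x) * rsum (fun k => x ^ k * y ^ (n - k)) (S n)))%R by ring.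
    rewrite IHn. simpl. ring.
  - intros k Hk. replace (S n - k)%nat with (S (n - k)) by lia. simpl. ring.
Qed.

(** With |B_n| <= A x^n and 1 < x < Q, the bound K Q^k up to index n gives (n+1) |y_(n+1)| <= A K
    Q^(n+1) / (Q - x), so it propagates once n+1 exceeds A / (Q - x). The finitely many earlier
    coefficients are absorbed in K. *)
Lemma ode_disk B y : disk B -> (forall n, deriv y n = conv B y n) -> disk y.
Proof.
  intros HB H. apply disk_intro. intros Q HQ. set (x := ((1 + Q) / 2)%R).
  assert (Hx : (1 < x < Q)%R) by (unfold x; lra).
  destruct (disk_geom B x HB ltac:(lra)) as (A & HA & Bd).
  destruct (INR_unbounded (A / (Q - x))) as [N0 HN0].
  assert (F : forall N, exists K, (0 < K)%R /\ forall k, (k <= N)%nat -> (Cmod (y k) <= K * Q ^ k)%R).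
  { induction N.
    - exists (Cmod (y O) + 1)%R. pose proof (Cmod_ge_0 (y O)). split; [lra|].
      intros k Hk. replace k with O by lia. simpl. lra.
    - destruct IHN as (K & HK & HN). assert (P : (0 < Q ^ S N)%R) by (apply pow_lt; lra).
      pose proof (Cmod_ge_0 (y (S N))).
      assert (P2 : (0 <= Cmod (y (S N)) / Q ^ S N)%R).
      { apply Rmult_le_pos; [lra|]. left. now apply Rinv_0_lt_compat. }
      exists (K + Cmod (y (S N)) / Q ^ S N)%R. split; [lra|]. intros k Hk.
      destruct (le_lt_dec k N) as [L|L].
      + eapply Rle_trans; [apply HN, L|]. apply Rmult_le_compat_r; [apply pow_le; lra|lra].
      + replace k with (S N) by lia.
        replace ((K + Cmod (y (S N)) / Q ^ S N) * Q ^ S N)%R with (K * Q ^ S N + Cmod (y (S N)))%R by (field; lra).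
        assert (0 <= K * Q ^ S N)%R by (apply Rmult_le_pos; lra). lra. }
  destruct (F N0) as (K & HK & HN). exists K.
  assert (forall n k, (k <= n)%nat -> (Cmod (y k) <= K * Q ^ k)%R) as G; [|intros n; now apply (G n)].
  induction n; intros k Hk; [apply HN; lia|].
  destruct (le_lt_dec k n) as [L|L]; [now apply IHn|]. replace k with (S n) by lia. clear k Hk L.
  destruct (le_lt_dec (S n) N0) as [L|L]; [now apply HN|].
  assert (C1 := Cmod_conv B y (fun k => A * x ^ k)%R (fun k => K * Q ^ k)%R n (fun k _ => Bd k) IHn).
  rewrite <- H in C1. unfold deriv in C1. rewrite Cmod_mult, Cmod_R, Rabs_pos_eq in C1 by apply pos_INR.
  rewrite (rsum_ext _ (fun k => A * K * (x ^ k * Q ^ (n - k)))%R) in C1 by (intros; ring).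
  rewrite rsum_scal in C1. assert (C2 := rsum_geom x Q n ltac:(lra)).
  assert (AK : (0 < A * K)%R) by now apply Rmult_lt_0_compat.
  apply (Rmult_le_compat_l (A * K)) in C2; [|lra].
  assert (P : (0 < Q ^ S n)%R) by (apply pow_lt; lra).
  assert (NN : (INR N0 <= INR (S n))%R) by (apply le_INR; lia).
  assert (PN : (0 < INR (S n))%R) by (apply lt_0_INR; lia).
  apply (Rmult_le_reg_l (INR (S n))); [exact PN|].
  apply Rle_trans with (A / (Q - x) * (K * Q ^ S n))%R.
  - replace (A / (Q - x) * (K * Q ^ S n))%R with (A * K * (Q ^ S n / (Q - x)))%R by (field; lra). lra.
  - apply Rmult_le_compat_r; [apply Rmult_le_pos; lra|lra].
Qed.

(** The root is the solution of s' = (g' / (2 g)) s with s_0 = 1. Both s^2 and g then solve y' =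
    (g'/g) y with initial value 1, and that solution is unique. *)
Lemma sqrt_series g : disk g -> g O = 1 -> (forall z, (Cmod z < 1)%R -> peval g z <> 0) ->
  exists s, disk s /\ s O = 1 /\ forall n, conv s s n = g n.
Proof.
  intros Hg g0 Nz.
  assert (N0 : g O <> 0). { rewrite g0. intros Z. injection Z. lra. }
  set (h := pinv g). assert (Eh : forall n, conv g h n = psone n) by (intros; now apply pinv_spec). assert (Hh := inv_disk g h Hg Nz Eh).
  set (B := conv (deriv g) h).
  assert (HB : disk B) by (apply disk_conv; auto; now apply disk_deriv).
  set (s := rec_seq (fun n s => / INR (S n) * conv (fun k => / 2 * B k) s n) 1).
  assert (s0 : s O = 1) by reflexivity.
  assert (sS : forall n, s (S n) = / INR (S n) * conv (fun k => / 2 * B k) s n).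
  { intros n. unfold s at 1. rewrite rec_seq_S; [reflexivity|].
    intros m y y' Hy. f_equal. now apply conv_ext. }
  assert (Es : forall n, deriv s n = conv (fun k => / 2 * B k) s n).
  { intros n. unfold deriv. rewrite sS. field. apply INR_S_neq. }
  exists s. split; [|split; [exact s0|]].
  - apply (ode_disk (fun k => / 2 * B k)); [now apply disk_scal|exact Es].
  - apply (ode_unique B).
    + simpl. rewrite s0, g0. ring.
    + intros n. rewrite deriv_conv, (conv_comm s (deriv s)).
      rewrite (conv_ext (deriv s) (conv (fun k => / 2 * B k) s) s s n) by auto.
      rewrite conv_assoc, conv_scal_l. field.
    + intros n. unfold B. rewrite conv_assoc.
      rewrite (conv_ext _ (deriv g) _ psone n); [|reflexivity|].
      * now rewrite conv_one_r.
      * intros k _. rewrite conv_comm. apply Eh.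
Qed.

(** * Logarithm of the modulus along a radius *)

Lemma CV_radius_sm (u : nat -> R) (a : nat -> C) R : (0 < R)%R -> sm a R ->
  (forall n, Rabs (u n) <= Cmod (a n))%R -> forall x, (Rabs x < R)%R -> Rbar_lt (Rabs x) (CV_radius u).
Proof.
  intros HR Ha Hu x Hx. destruct (sm_term_bound a R ltac:(lra) Ha) as (A & HA & B).
  apply Rbar_lt_le_trans with R; [exact Hx|].
  apply (proj1 (CV_radius_bounded u)). exists A. intros n.
  assert (P : (0 < R ^ n)%R) by now apply pow_lt.
  rewrite Rabs_mult, (Rabs_pos_eq (R ^ n)) by lra. eapply Rle_trans; [|apply (B n)].
  apply Rmult_le_compat_r; [lra|apply Hu].
Qed.
Lemma Re_peval_real a (x : R) : Re (peval a x) = PSeries (fun n => Re (a n)) x.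
Proof.
  apply Series_ext. intros n. rewrite <- RtoC_pow. unfold Re. simpl. ring.
Qed.
Lemma Im_peval_real a (x : R) : Im (peval a x) = PSeries (fun n => Im (a n)) x.
Proof.
  apply Series_ext. intros n. rewrite <- RtoC_pow. unfold Im. simpl. ring.
Qed.
Lemma is_derive_Re_peval a R x : (0 < R)%R -> sm a R -> (Rabs x < R)%R ->
  is_derive (fun y => Re (peval a (RtoC y))) x (Re (peval (deriv a) (RtoC x))).
Proof.
  intros HR Ha Hx.
  apply (is_derive_ext (PSeries (fun n => Re (a n)))); [intros; symmetry; apply Re_peval_real|].
  replace (Re (peval (deriv a) x)) with (PSeries (PS_derive (fun n => Re (a n))) x).
  - apply is_derive_PSeries, (CV_radius_sm _ a R); auto. intros n. apply re_le_Cmod.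
  - rewrite Re_peval_real. apply PSeries_ext. intros n. unfold PS_derive, deriv, Re. generalize (INR (S n)); intros k; simpl; ring.
Qed.
Lemma is_derive_Im_peval a R x : (0 < R)%R -> sm a R -> (Rabs x < R)%R ->
  is_derive (fun y => Im (peval a (RtoC y))) x (Im (peval (deriv a) (RtoC x))).
Proof.
  intros HR Ha Hx.
  apply (is_derive_ext (PSeries (fun n => Im (a n)))); [intros; symmetry; apply Im_peval_real|].
  replace (Im (peval (deriv a) x)) with (PSeries (PS_derive (fun n => Im (a n))) x).
  - apply is_derive_PSeries, (CV_radius_sm _ a R); auto. intros n. apply im_le_Cmod.
  - rewrite Im_peval_real. apply PSeries_ext. intros n. unfold PS_derive, deriv, Im. generalize (INR (S n)); intros k; simpl; ring.
Qed.

Lemma sm_deriv a r R : (0 <= r < R)%R -> sm a R -> sm (deriv a) r.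
Proof.
  intros Hr Ha. destruct (sm_geom a R ltac:(lra) Ha) as (A & HA & B).
  set (Q := (2 / (R + r))%R).
  assert (HQ : (/ R < Q)%R).
  { unfold Q. apply (Rmult_lt_reg_l (R * (R + r))); [nra|].
    replace (R * (R + r) * / R)%R with (R + r)%R by (field; lra).
    replace (R * (R + r) * (2 / (R + r)))%R with (2 * R)%R by (field; lra). lra. }
  assert (HR : (0 < / R)%R) by (apply Rinv_0_lt_compat; lra).
  destruct (linear_le_pow (/ R) Q ltac:(lra)) as (K & HK & L).
  apply (sm_bound _ (A * / R * K) Q r); [lra|lra| |].
  - unfold Q. apply (Rmult_lt_reg_l (R + r)); [lra|].
    replace ((R + r) * (2 / (R + r) * r))%R with (2 * r)%R by (field; lra). lra.
  - intros n. unfold deriv. rewrite Cmod_mult, Cmod_R, Rabs_pos_eq by apply pos_INR.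
    apply Rle_trans with (INR (S n) * (A * (/ R) ^ S n))%R.
    + apply Rmult_le_compat_l; [apply pos_INR|apply B].
    + simpl pow. replace (INR (S n) * (A * (/ R * (/ R) ^ n)))%R with (A * / R * (INR (S n) * (/ R) ^ n))%R by ring.
      rewrite (Rmult_assoc (A * / R)). apply Rmult_le_compat_l; [|apply L]. apply Rmult_le_pos; lra.
Qed.

Lemma Re_mult (z w : C) : Re (z * w) = (Re z * Re w - Im z * Im w)%R.
Proof. reflexivity. Qed.
Lemma Im_mult (z w : C) : Im (z * w) = (Re z * Im w + Im z * Re w)%R.
Proof. reflexivity. Qed.

(** No branch of the complex logarithm is needed: along the real segment the derivative of ln |g|^2
    is 2 Re (g'/g) = 2 Re L', so the difference of the two sides is constant. *)
Lemma log_mod_series g L r T : (0 < r < T)%R -> sm g T -> sm L T ->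
  (forall n, deriv g n = conv (deriv L) g n) ->
  (forall x : R, (0 <= x <= r)%R -> peval g x <> 0) ->
  (ln (Cmod (peval g r) ^ 2) = ln (Cmod (g O) ^ 2) + 2 * (Re (peval L r) - Re (L O)))%R.
Proof.
  intros Hr Hg HL E Nz.
  set (P := fun x : R => Re (peval g x)). set (Q := fun x : R => Im (peval g x)). set (U := fun x : R => Re (peval L x)).
  assert (Md : forall x : R, (Cmod (peval g x) ^ 2 = P x ^ 2 + Q x ^ 2)%R) by (intros; apply Cmod2_alt).
  assert (Pos : forall x : R, (0 <= x <= r)%R -> (0 < P x ^ 2 + Q x ^ 2)%R).
  { intros x Hx. rewrite <- Md. apply pow_lt, Cmod_gt_0, Nz, Hx. }
  set (Phi := fun x : R => (ln (P x ^ 2 + Q x ^ 2) - 2 * U x)%R).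
  assert (D : Phi 0%R = Phi r).
  { apply (eq_is_derive Phi 0 r); [|lra]. intros x Hx.
    assert (Ax : (Rabs x < T)%R) by (rewrite Rabs_pos_eq; lra).
    assert (DP := is_derive_Re_peval g T x ltac:(lra) Hg Ax). fold P in DP.
    assert (DQ := is_derive_Im_peval g T x ltac:(lra) Hg Ax). fold Q in DQ.
    assert (DU := is_derive_Re_peval L T x ltac:(lra) HL Ax). fold U in DU.
    assert (Eg : peval (deriv g) x = peval (deriv L) x * peval g x).
    { set (r' := ((x + T) / 2)%R).
      rewrite <- (peval_conv _ _ r'); [now apply peval_ext| | |].
      - apply (sm_deriv L r' T); [unfold r'; lra|exact HL].
      - apply (sm_mono g T); [unfold r'; lra|exact Hg].
      - rewrite Cmod_R, Rabs_pos_eq; unfold r'; lra. }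
    specialize (Pos x Hx).
    rewrite Eg, Re_mult in DP. rewrite Eg, Im_mult in DQ.
    change (Re (peval g x)) with (P x) in DP, DQ. change (Im (peval g x)) with (Q x) in DP, DQ.
    (* With L' = u + i v one has P' = u P - v Q and Q' = u Q + v P, so (P^2 + Q^2)' = 2 u (P^2 +
       Q^2) and v drops out. *)
    revert DP DQ DU. generalize (Re (peval (deriv L) x)) (Im (peval (deriv L) x)). intros u v DP DQ DU.
    unfold Phi. evar_last.
    - apply (is_derive_minus (K := R_AbsRing) (V := R_NormedModule)).
      + apply (is_derive_comp ln (fun x => P x ^ 2 + Q x ^ 2)%R).
        * apply is_derive_Reals. apply derivable_pt_lim_ln. exact Pos.
        * apply (is_derive_plus (K := R_AbsRing) (V := R_NormedModule)).
          -- apply (is_derive_pow P 2 x _ DP).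
          -- apply (is_derive_pow Q 2 x _ DQ).
      + apply (is_derive_scal U x 2 _ DU).
    - unfold minus, plus, opp, scal, zero, mult; simpl. unfold mult; simpl. field. simpl in Pos. lra. }
  unfold Phi in D. rewrite <- !Md in D. unfold U in D. rewrite !peval_0 in D. lra.
Qed.

(** * Logarithmic energy *)

Open Scope R_scope.

Definition dsum (f : nat -> nat -> R) (N : nat) : R := rsum (fun i => rsum (fun j => f i j) N) N.

Lemma dsum_ext f g N : (forall i j, (i < N)%nat -> (j < N)%nat -> f i j = g i j) -> dsum f N = dsum g N.
Proof. intros H. apply rsum_ext. intros i Hi. apply rsum_ext. auto. Qed.
Lemma dsum_le f g N : (forall i j, (i < N)%nat -> (j < N)%nat -> f i j <= g i j) -> dsum f N <= dsum g N.
Proof. intros H. apply rsum_le. intros i Hi. apply rsum_le. auto. Qed.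
Lemma dsum_plus f g N : dsum (fun i j => f i j + g i j) N = dsum f N + dsum g N.
Proof. unfold dsum. rewrite <- rsum_plus. apply rsum_ext. intros. apply rsum_plus. Qed.
Lemma dsum_scal c f N : dsum (fun i j => c * f i j) N = c * dsum f N.
Proof. unfold dsum. rewrite <- rsum_scal. apply rsum_ext. intros. apply rsum_scal. Qed.
Lemma dsum_mult u v N : dsum (fun i j => u i * v j) N = rsum u N * rsum v N.
Proof.
  unfold dsum. rewrite (rsum_ext _ (fun i => rsum v N * u i)).
  - rewrite rsum_scal. ring.
  - intros i _. rewrite rsum_scal. ring.
Qed.
Lemma rsum_0 n : rsum (fun _ => 0) n = 0.
Proof. rewrite rsum_const. ring. Qed.
Lemma dsum_const c N : dsum (fun _ _ => c) N = INR N * INR N * c.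
Proof. unfold dsum. rewrite !rsum_const. ring. Qed.
Lemma dsum_rsum (F : nat -> nat -> nat -> R) M N :
  dsum (fun i j => rsum (fun k => F k i j) M) N = rsum (fun k => dsum (F k) N) M.
Proof.
  induction M; simpl.
  - rewrite dsum_const. ring.
  - rewrite dsum_plus, IHM. reflexivity.
Qed.

Definition sph (w : C) : R := 1 + Cmod w ^ 2.
(** [1 - ker] is the squared chordal distance on the Riemann sphere of diameter 1. *)
Definition ker (w w' : C) : R := Cmod (1 + w * Cconj w') ^ 2 / (sph w * sph w').

Lemma sph_pos w : 1 <= sph w.
Proof. unfold sph. pose proof (pow2_ge_0 (Cmod w)). lra. Qed.
(** Lagrange's identity: |1 + p conj q|^2 + |p - q|^2 = (1 + |p|^2) (1 + |q|^2). *)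
Lemma ker_compl w w' : 1 - ker w w' = Cmod (w - w') ^ 2 / (sph w * sph w').
Proof.
  pose proof (sph_pos w). pose proof (sph_pos w'). unfold ker.
  replace 1 with (sph w * sph w' / (sph w * sph w')) at 1 by (field; lra).
  unfold Rdiv. rewrite <- Rmult_minus_distr_r. f_equal. unfold sph.
  rewrite !Cmod2_alt. destruct w as [x y], w' as [x' y']. unfold Re, Im; simpl. ring.
Qed.
Lemma ker_bounds w w' : 0 <= ker w w' <= 1.
Proof.
  pose proof (sph_pos w). pose proof (sph_pos w').
  assert (P : 0 < sph w * sph w') by (apply Rmult_lt_0_compat; lra).
  assert (forall z, 0 <= Cmod z ^ 2 / (sph w * sph w')).
  { intros z. apply Rmult_le_pos; [apply pow2_ge_0|]. left. now apply Rinv_0_lt_compat. }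
  split; [apply H1|]. specialize (H1 (w - w')%C). rewrite <- ker_compl in H1. lra.
Qed.

(* [ker] is the Gram kernel of (a multiple of) the inverse stereographic projection. *)
Lemma ker_features w w' : ker w w' =
  / sph w * / sph w' + 2 * (Re w / sph w * (Re w' / sph w')) + 2 * (Im w / sph w * (Im w' / sph w'))
  + Cmod w ^ 2 / sph w * (Cmod w' ^ 2 / sph w').
Proof.
  pose proof (sph_pos w). pose proof (sph_pos w'). unfold ker.
  replace (Cmod (1 + w * Cconj w') ^ 2) with
    (1 + 2 * (Re w * Re w') + 2 * (Im w * Im w') + Cmod w ^ 2 * Cmod w' ^ 2); [field; lra|].
  rewrite !Cmod2_alt. destruct w as [x y], w' as [x' y']. unfold Re, Im; simpl. ring.
Qed.

(* Schur product theorem for the powers of [ker], one feature at a time. *)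
Lemma ker_pow_psd (w : nat -> C) N n : forall x : nat -> R,
  0 <= dsum (fun i j => x i * x j * ker (w i) (w j) ^ n) N.
Proof.
  induction n; intros x.
  - rewrite (dsum_ext _ (fun i j => x i * x j)) by (intros; simpl; ring).
    rewrite dsum_mult. apply Rle_0_sqr.
  - rewrite (dsum_ext _ (fun i j =>
      (x i * / sph (w i)) * (x j * / sph (w j)) * ker (w i) (w j) ^ n
      + 2 * ((x i * (Re (w i) / sph (w i))) * (x j * (Re (w j) / sph (w j))) * ker (w i) (w j) ^ n)
      + 2 * ((x i * (Im (w i) / sph (w i))) * (x j * (Im (w j) / sph (w j))) * ker (w i) (w j) ^ n)
      + (x i * (Cmod (w i) ^ 2 / sph (w i))) * (x j * (Cmod (w j) ^ 2 / sph (w j))) * ker (w i) (w j) ^ n)).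
    2:{ intros i j _ _. simpl pow at 1. rewrite (ker_features (w i) (w j)) at 1. ring. }
    rewrite !dsum_plus, !dsum_scal.
    pose proof (IHn (fun i => x i * / sph (w i))).
    pose proof (IHn (fun i => x i * (Re (w i) / sph (w i)))).
    pose proof (IHn (fun i => x i * (Im (w i) / sph (w i)))).
    pose proof (IHn (fun i => x i * (Cmod (w i) ^ 2 / sph (w i)))).
    cbv beta in *. lra.
Qed.

(** k / (1 - s k) is the sum of s^n k^(n+1), a positive combination of positive kernels. Partial
    sums suffice, with remainder at most s^M X. This is the s-derivative of -ln (1 - s k). *)
Lemma ker_resolvent_psd (w : nat -> C) N (x : nat -> R) s : 0 <= s < 1 ->
  0 <= dsum (fun i j => x i * x j * (ker (w i) (w j) / (1 - s * ker (w i) (w j)))) N.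
Proof.
  intros Hs. set (D := dsum _ N).
  set (X := dsum (fun i j => Rabs (x i * x j) / (1 - s)) N).
  assert (HX : 0 <= X).
  { rewrite <- (Rmult_0_r (INR N * INR N)), <- dsum_const. apply dsum_le. intros i j _ _.
    apply Rmult_le_pos; [apply Rabs_pos|]. left. apply Rinv_0_lt_compat. lra. }
  assert (H : forall M, - (s ^ M * X) <= D).
  { intros M.
    assert (P : 0 <= dsum (fun i j => rsum (fun n => s ^ n * (x i * x j * ker (w i) (w j) ^ S n)) M) N).
    { rewrite dsum_rsum, <- (rsum_0 M). apply rsum_le. intros n _.
      rewrite dsum_scal. apply Rmult_le_pos; [apply pow_le; lra|apply ker_pow_psd]. }
    assert (Q : dsum (fun i j => rsum (fun n => s ^ n * (x i * x j * ker (w i) (w j) ^ S n)) M) N <= D + s ^ M * X).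
    { unfold D, X. rewrite <- dsum_scal, <- dsum_plus. apply dsum_le. intros i j _ _.
      destruct (ker_bounds (w i) (w j)) as [K0 K1]. set (k := ker (w i) (w j)) in *.
      assert (Sk : 0 <= s * k <= s) by nra.
      replace (rsum (fun n => s ^ n * (x i * x j * k ^ S n)) M) with
        (x i * x j * (k / (1 - s * k)) - x i * x j * (k / (1 - s * k)) * (s * k) ^ M).
      2:{ clear P. induction M; [simpl; field; lra|]. cbn [rsum]. rewrite <- IHM, !Rpow_mult_distr. simpl. field. lra. }
      assert (B1 : Rabs (x i * x j * (k / (1 - s * k)) * (s * k) ^ M) <= s ^ M * (Rabs (x i * x j) / (1 - s))).
      { rewrite !Rabs_mult. rewrite <- Rabs_mult.
        rewrite (Rabs_pos_eq (k / _)), (Rabs_pos_eq (_ ^ M)).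
        - pose proof (Rabs_pos (x i * x j)).
          assert ((s * k) ^ M <= s ^ M) by (apply pow_incr; lra).
          assert (0 <= (s * k) ^ M) by (apply pow_le; lra).
          assert (k / (1 - s * k) <= / (1 - s)).
          { apply Rle_trans with (1 * / (1 - s * k)); [apply Rmult_le_compat_r; [left; apply Rinv_0_lt_compat; lra|lra]|].
            rewrite Rmult_1_l. apply Rinv_le_contravar; lra. }
          assert (0 <= k / (1 - s * k)) by (apply Rmult_le_pos; [lra|left; apply Rinv_0_lt_compat; lra]).
          replace (s ^ M * (Rabs (x i * x j) / (1 - s))) with (Rabs (x i * x j) * / (1 - s) * s ^ M) by (unfold Rdiv; ring).
          apply Rmult_le_compat; [apply Rmult_le_pos; lra|lra| |lra].
          apply Rmult_le_compat_l; lra.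
        - apply pow_le; lra.
        - apply Rmult_le_pos; [lra|left; apply Rinv_0_lt_compat; lra]. }
      apply Rabs_le_between in B1. lra. }
    lra. }
  apply Rnot_lt_le. intros L.
  (* If D < 0, choose M with s^M < -D / (X + 1); then s^M X < -D, against the bound for that M. *)
  destruct (pow_lt_1_zero s ltac:(rewrite Rabs_pos_eq; lra) (- D / (X + 1)) ltac:(apply Rdiv_lt_0_compat; lra)) as [M HM].
  specialize (HM M ltac:(lia)). specialize (H M). rewrite Rabs_pos_eq in HM by (apply pow_le; lra).
  assert (P : 0 <= s ^ M) by (apply pow_le; lra).
  assert (s ^ M * X <= - D / (X + 1) * X) by (apply Rmult_le_compat_r; lra).
  assert (- D / (X + 1) * (X + 1) = - D) by (field; lra).
  assert (0 < - D / (X + 1)) by (apply Rdiv_lt_0_compat; lra). lra.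
Qed.

Lemma is_derive_rsum (F dF : nat -> R -> R) N s : (forall i, (i < N)%nat -> is_derive (F i) s (dF i s)) ->
  is_derive (fun t => rsum (fun i => F i t) N) s (rsum (fun i => dF i s) N).
Proof.
  induction N; intros H; simpl.
  - apply (is_derive_const (K := R_AbsRing) (V := R_NormedModule)).
  - apply (is_derive_plus (K := R_AbsRing) (V := R_NormedModule)); [apply IHN; auto|apply H; lia].
Qed.

(** The energy vanishes at s = 0 and has the nonnegative derivative of [ker_resolvent_psd]; the mean
    value theorem replaces the logarithmic series. *)
Lemma energy_nonneg (w : nat -> C) N (x : nat -> R) s : 0 <= s < 1 ->
  0 <= dsum (fun i j => x i * x j * - ln (1 - s * ker (w i) (w j))) N.
Proof.
  intros Hs.
  set (Phi := fun t => dsum (fun i j => x i * x j * - ln (1 - t * ker (w i) (w j))) N).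
  set (dPhi := fun t => dsum (fun i j => x i * x j * (ker (w i) (w j) / (1 - t * ker (w i) (w j)))) N).
  assert (D : forall t, 0 <= t <= s -> is_derive Phi t (dPhi t)).
  { intros t Ht. unfold Phi, dPhi, dsum.
    apply (is_derive_rsum (fun i t => rsum (fun j => x i * x j * - ln (1 - t * ker (w i) (w j))) N)
      (fun i t => rsum (fun j => x i * x j * (ker (w i) (w j) / (1 - t * ker (w i) (w j)))) N)).
    intros i _.
    apply (is_derive_rsum (fun j t => x i * x j * - ln (1 - t * ker (w i) (w j)))
      (fun j t => x i * x j * (ker (w i) (w j) / (1 - t * ker (w i) (w j))))).
    intros j _. destruct (ker_bounds (w i) (w j)) as [K0 K1]. generalize dependent (ker (w i) (w j)).
    intros k K0 K1. assert (0 < 1 - t * k) by nra.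
    auto_derive; [lra|]. field. lra. }
  assert (P0 : Phi 0 = 0).
  { unfold Phi. rewrite (dsum_ext _ (fun _ _ => 0)); [rewrite dsum_const; ring|].
    intros. rewrite Rmult_0_l, Rminus_0_r, ln_1. ring. }
  destruct (MVT_gen Phi 0 s dPhi) as (c & Hc & E).
  - intros t Ht. rewrite Rmin_left, Rmax_right in Ht by lra. apply D. lra.
  - intros t Ht. rewrite Rmin_left, Rmax_right in Ht by lra.
    apply continuity_pt_filterlim. apply (ex_derive_continuous (V := R_NormedModule)). eexists. apply D. lra.
  - rewrite Rmin_left, Rmax_right in Hc by lra.
    assert (0 <= dPhi c) by (apply ker_resolvent_psd; lra).
    change (0 <= Phi s). rewrite P0 in E. nra.
Qed.

(** * The logarithm of the divided difference *)

Open Scope C_scope.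

(** Univalence gives nonvanishing off the diagonal, [deriv_neq] gives it on the diagonal, and
    compactness makes it quantitative. *)
Lemma divdiff_lower b rho : disk b -> inj_disk b -> b 1%nat <> 0 -> (0 < rho < 1)%R ->
  exists m, (0 < m)%R /\ forall z w, (Cmod z <= rho)%R -> (Cmod w <= rho)%R -> (m <= Cmod (divdiff b z w))%R.
Proof.
  intros Hb Hi H1 Hr. destruct (divdiff_lip b rho Hb Hr) as (K & HK & L).
  assert (Nz : forall z w, (Cmod z <= rho)%R -> (Cmod w <= rho)%R -> divdiff b z w <> 0).
  { intros z w Hz Hw. destruct (Ceq_dec z w) as [->|D].
    - apply deriv_neq; auto; lra.
    - apply divdiff_neq; auto; lra. }
  apply (lip_lower_bound (fun z w => Cmod (divdiff b z w)) rho K); [lra|lra| |].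
  - intros z w z' w' Hz Hw Hz' Hw'. eapply Rle_trans; [apply Cmod_dist|]. now apply L.
  - intros z w Hz Hw. now apply Cmod_gt_0, Nz.
Qed.

(** Turns a function of two variables into a power series in the common scale t of (t al, t be), so
    that the theory of one variable applies with al and be as parameters. *)
Definition gfam (b : nat -> C) (al be : C) : nat -> C := fun n => b (S n) * pq n al be.
(* Taylor coefficients at [t = 0] of the logarithm of [divdiff b (t * al) (t * be)]. *)
Definition log_coef (b : nat -> C) (al be : C) (n : nat) : C :=
  match n with
  | O => 0
  | S m => / INR (S m) * conv (deriv (gfam b al be)) (pinv (gfam b al be)) m
  end.

Lemma peval_gfam b al be t : peval (gfam b al be) t = divdiff b (t * al) (t * be).
Proof. apply cseries_ext. intros n. unfold gfam. rewrite pq_scale. ring. Qed.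

Lemma gfam_bound b al be n : (Cmod al <= 1)%R -> (Cmod be <= 1)%R ->
  (Cmod (gfam b al be n) <= Cmod (deriv b n))%R /\
  (Cmod (deriv (gfam b al be) n) <= Cmod (deriv (deriv b) n))%R.
Proof.
  intros Ha Hb. assert (P : forall n, (Cmod (gfam b al be n) <= Cmod (deriv b n))%R).
  { intros k. unfold gfam, deriv. rewrite !Cmod_mult, Cmod_R, Rabs_pos_eq by apply pos_INR.
    assert (B := pq_bound k al be 1 Ha Hb). rewrite pow1 in B.
    pose proof (Cmod_ge_0 (b (S k))). nra. }
  split; [apply P|]. unfold deriv at 1 2. rewrite !Cmod_mult. apply Rmult_le_compat_l; [apply Cmod_ge_0|apply P].
Qed.

Lemma deriv_log_coef (b : nat -> C) al be n : b 1%nat = 1 ->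
  deriv (gfam b al be) n = conv (deriv (log_coef b al be)) (gfam b al be) n.
Proof.
  intros H1. set (g := gfam b al be).
  assert (G0 : g O <> 0). { unfold g, gfam. rewrite H1, Cmult_1_l. apply C1_nz. }
  rewrite (conv_ext _ (conv (deriv g) (pinv g)) g g n); [|intros k _|reflexivity].
  - rewrite conv_assoc, (conv_ext _ (deriv g) _ psone n); [now rewrite conv_one_r|reflexivity|].
    intros k _. rewrite conv_comm. now apply pinv_spec.
  - unfold deriv at 1. cbn [log_coef]. fold g. field. apply INR_S_neq.
Qed.

(** K must not depend on al and be, since it will serve all pairs of N-th roots of unity while N
    grows. The uniformity comes from one lower bound m on the bidisk and one dilation for the whole
    family. *)
Lemma log_coef_bound b rho : disk b -> inj_disk b -> b 1%nat = 1 -> (0 < rho < 1)%R ->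
  exists K, (0 < K)%R /\ forall al be, (Cmod al <= 1)%R -> (Cmod be <= 1)%R ->
  forall n, (Cmod (log_coef b al be n) <= K * (/ rho) ^ n)%R.
Proof.
  intros Hb Hi H1 Hr.
  assert (N1 : b 1%nat <> 0). { rewrite H1. apply C1_nz. }
  destruct (divdiff_lower b rho Hb Hi N1 Hr) as (m & Hm & Lm).
  destruct (disk_mid rho Hr) as [Q1 Q2]. set (Q := ((1 + / rho) / 2)%R) in *.
  destruct (disk_geom (deriv b) Q (disk_deriv _ Hb) Q1) as (A & HA & B).
  destruct (disk_geom (deriv (deriv b)) Q (disk_deriv _ (disk_deriv _ Hb)) Q1) as (A2 & HA2 & B2).
  destruct (choose_dilation A Q rho (m / 2) HA ltac:(lra) ltac:(lra) Q2 ltac:(lra)) as (s & Hs & Hq & D).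
  assert (Qr : (Q < / rho)%R).
  { apply (Rmult_lt_reg_r rho); [lra|]. rewrite Rinv_l; lra. }
  set (K := (A2 * (2 / m) / (/ rho - Q))%R).
  assert (P2m : (0 < 2 / m)%R) by (apply Rdiv_lt_0_compat; lra).
  assert (HK : (0 < K)%R) by (apply Rdiv_lt_0_compat; [now apply Rmult_lt_0_compat|lra]).
  exists K. split; [exact HK|]. intros al be Ha Hbe n.
  set (g := gfam b al be).
  assert (Gb : forall n, (Cmod (g n) <= A * Q ^ n)%R).
  { intros k. eapply Rle_trans; [apply (gfam_bound b al be k Ha Hbe)|apply B]. }
  assert (Sc : forall t c, (Cmod t <= rho)%R -> (Cmod c <= 1)%R -> (Cmod (t * c) <= rho)%R).
  { intros t c Ht Hc. rewrite Cmod_mult. pose proof (Cmod_ge_0 t). pose proof (Cmod_ge_0 c). nra. }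
  assert (G0 : g O <> 0). { unfold g, gfam. rewrite H1, Cmult_1_l. apply C1_nz. }
  destruct (inv_bound g (pinv g) rho s m ltac:(lra) Hs Hm) as [_ Bh].
  - intros k. now apply pinv_spec.
  - apply (sm_bound g A Q); auto; nra.
  - intros t Ht. split; [|now apply D]. unfold g. rewrite peval_gfam. apply Lm; now apply Sc.
  - destruct n as [|n].
    { simpl. rewrite Cmod_0. lra. }
    assert (Bh' : forall k, (Cmod (pinv g k) <= 2 / m * (/ rho) ^ k)%R).
    { intros k. assert (P : (0 < rho ^ k)%R) by (apply pow_lt; lra).
      rewrite pow_inv. apply (Rmult_le_reg_r (rho ^ k)); [exact P|].
      rewrite (Rmult_assoc (2 / m)), Rinv_l by lra. specialize (Bh k). lra. }
    assert (C1 := Cmod_conv (deriv g) (pinv g) (fun k => A2 * Q ^ k)%R (fun k => 2 / m * (/ rho) ^ k)%R n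
      (fun k _ => Rle_trans _ _ _ (proj2 (gfam_bound b al be k Ha Hbe)) (B2 k)) (fun k _ => Bh' k)).
    rewrite (rsum_ext _ (fun k => A2 * (2 / m) * (Q ^ k * (/ rho) ^ (n - k)))%R) in C1 by (intros; ring).
    rewrite rsum_scal in C1. assert (C2 := rsum_geom Q (/ rho) n ltac:(lra)).
    assert (P0 : (0 < A2 * (2 / m))%R) by now apply Rmult_lt_0_compat.
    apply (Rmult_le_compat_l (A2 * (2 / m))) in C2; [|lra].
    replace (A2 * (2 / m) * ((/ rho) ^ S n / (/ rho - Q)))%R with (K * (/ rho) ^ S n)%R in C2
      by (unfold K; field; lra).
    cbn [log_coef]. fold g. rewrite Cmod_mult.
    apply Rle_trans with (1 * Cmod (conv (deriv g) (pinv g) n))%R; [|lra].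
    apply Rmult_le_compat_r; [apply Cmod_ge_0|apply Cmod_inv_INR].
Qed.

Lemma log_divdiff b al be r : disk b -> inj_disk b -> b 1%nat = 1 -> (0 < r < 1)%R ->
  (Cmod al <= 1)%R -> (Cmod be <= 1)%R ->
  (ln (Cmod (divdiff b (r * al) (r * be)) ^ 2) = 2 * Re (peval (log_coef b al be) r))%R.
Proof.
  intros Hb Hi H1 Hr Ha Hbe. set (R1 := ((1 + r) / 2)%R). set (rho := ((1 + R1) / 2)%R).
  assert (HR : (r < R1 < rho)%R) by (unfold rho, R1; lra). assert (Hrho : (rho < 1)%R) by (unfold rho, R1; lra).
  assert (N1 : b 1%nat <> 0). { rewrite H1. apply C1_nz. }
  destruct (log_coef_bound b rho Hb Hi H1 ltac:(lra)) as (K & HK & B).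
  rewrite <- peval_gfam. rewrite (log_mod_series _ (log_coef b al be) r R1).
  - unfold gfam at 1. rewrite H1. simpl (log_coef b al be 0). simpl pq. rewrite Cmult_1_l, Cmod_1, pow1, ln_1.
    simpl. ring.
  - lra.
  - apply asum_sm; [lra|]. apply (asum_le _ (fun n => Cmod (deriv b n) * R1 ^ n)%R).
    + intros n. rewrite Cmod_mult, Cmod_pow, Cmod_R, Rabs_pos_eq by lra.
      apply Rmult_le_compat_r; [apply pow_le; lra|]. now apply gfam_bound.
    + apply (disk_deriv b Hb). lra.
  - apply (sm_bound _ K (/ rho)); [lra|left; apply Rinv_0_lt_compat; lra| |now apply B].
    apply (Rmult_lt_reg_l rho); [lra|]. rewrite <- Rmult_assoc, Rinv_r; lra.
  - intros n. now apply deriv_log_coef.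
  - intros x Hx. rewrite peval_gfam.
    assert (Sc : forall c, (Cmod c <= 1)%R -> (Cmod (x * c) < 1)%R).
    { intros c Hc. rewrite Cmod_mult, Cmod_R, Rabs_pos_eq by lra. pose proof (Cmod_ge_0 c). nra. }
    destruct (Ceq_dec (x * al) (x * be)) as [->|D].
    + apply deriv_neq; auto.
    + apply divdiff_neq; auto.
Qed.

(** * Comparison of energies *)

Open Scope R_scope.

Lemma Cmod_pow_sub_1 (u : C) j : Cmod u = 1 -> Cmod (u ^ j - 1)%C <= INR j * Cmod (u - 1)%C.
Proof.
  intros Hu. induction j.
  - simpl. replace (1 - 1)%C with (RtoC 0) by ring. rewrite Cmod_0. lra.
  - replace (u ^ S j - 1)%C with (u * (u ^ j - 1) + (u - 1))%C by (rewrite Cpow_S; ring).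
    eapply Rle_trans; [apply Cmod_triangle|]. rewrite Cmod_mult, Hu, S_INR. lra.
Qed.
(* The powers of [u] sum to [0], whereas [|u ^ j - 1| <= j |u - 1|]. *)
Lemma root_separation (u : C) N : (0 < N)%nat -> Cmod u = 1 -> (u ^ N = 1)%C -> u <> RtoC 1 ->
  1 <= INR N * Cmod (1 - u)%C.
Proof.
  intros HN Hu HuN Hu1. apply Rnot_lt_le. intros L.
  replace (1 - u)%C with (- (u - 1))%C in L by ring. rewrite Cmod_opp in L.
  assert (S := geom_root_sum u N HuN Hu1).
  assert (E : csum (fun j => (u ^ j - 1)%C) N = (- INR N)%C).
  { transitivity (csum (fun j => u ^ j)%C N + csum (fun _ => - (1))%C N)%C.
    - rewrite <- csum_plus. reflexivity.
    - rewrite S, csum_const. ring. }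
  assert (B : Cmod (csum (fun j => (u ^ j - 1)%C) N) <= rsum (fun _ => INR N * Cmod (u - 1)%C) N).
  { eapply Rle_trans; [apply Cmod_csum|]. apply rsum_le. intros j Hj.
    eapply Rle_trans; [now apply Cmod_pow_sub_1|]. apply Rmult_le_compat_r; [apply Cmod_ge_0|].
    apply le_INR. lia. }
  rewrite E, Cmod_opp, Cmod_R, Rabs_pos_eq, rsum_const in B by apply pos_INR.
  assert (P : 0 < INR N) by now apply lt_0_INR. nra.
Qed.

Lemma prim_root_ratio N w i j : prim_root N w -> (i < N)%nat -> (j < N)%nat -> i <> j ->
  (w ^ i * Cconj (w ^ j))%C <> RtoC 1.
Proof.
  intros (W1 & W2 & W3) Hi Hj D E.
  assert (Wj := fun k => prim_root_conj N w k (conj W1 (conj W2 W3))).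
  assert (Eq : (w ^ i = w ^ j)%C).
  { replace (w ^ i)%C with ((w ^ i * Cconj (w ^ j)) * w ^ j)%C; [rewrite E; ring|].
    rewrite <- Cmult_assoc, (Cmult_comm (Cconj _)), Wj. ring. }
  assert (Nz : forall k, (w ^ k)%C <> RtoC 0).
  { intros k Z. specialize (Wj k). rewrite Z, Cmult_0_l in Wj. apply RtoC_inj in Wj. lra. }
  assert (X : forall a c, (a < c)%nat -> (c < N)%nat -> (w ^ a)%C = (w ^ c)%C -> False).
  { intros a c Hac Hc F. apply (W3 (c - a)%nat ltac:(lia)).
    replace c with (a + (c - a))%nat in F by lia. rewrite Cpow_add_r in F.
    replace (w ^ (c - a))%C with (/ w ^ a * (w ^ a * w ^ (c - a)))%C by (field; apply Nz).
    rewrite <- F. field. apply Nz. }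
  destruct (Nat.lt_total i j) as [L|[L|L]]; [now apply (X i j)|contradiction|].
  apply (X j i); auto.
Qed.

Lemma prim_root_ratio_pow N w i j : prim_root N w -> ((w ^ i * Cconj (w ^ j)) ^ N = 1)%C.
Proof.
  intros (W1 & _ & _). rewrite Cpow_mult_l, <- Cpow_conj, <- !Cpow_mult_r, (Nat.mul_comm i), (Nat.mul_comm j).
  rewrite !Cpow_mult_r, W1, !Cpow_1_l, Cconj_R. ring.
Qed.

Lemma Cmod2_one_minus (v : C) (rho : R) : Cmod v = 1 ->
  Cmod (1 - rho * v)%C ^ 2 = (1 - rho) ^ 2 + rho * Cmod (1 - v)%C ^ 2.
Proof.
  intros Hv. assert (E := Cmod2_alt v). rewrite Hv in E. rewrite !Cmod2_alt.
  destruct v as [x y]. unfold Re, Im in *; simpl in *.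
  assert (E' : y * y = 1 - x * x) by lra. ring [E'].
Qed.

Lemma ln_le_sub_1 y : 0 < y -> ln y <= y - 1.
Proof.
  intros Hy. assert (E := exp_ineq1_le (ln y)). rewrite exp_ln in E; lra.
Qed.

(** Both regularisations are small relative changes: the first logarithm is ln c + ln (1 + dl^2 k /
    c), the second ln p2 + ln (1 - dl + dl^2 / p2). The added terms lie in [0, dl^2/c] and
    [-2 dl, dl^2/p2]. *)
Lemma error_offdiag dl k c p2 : 0 < dl <= 1 / 2 -> 0 <= k <= 1 -> 0 < c -> c = 1 - k -> 0 < p2 ->
  Rabs (- ln (1 - (1 - dl ^ 2) * k) + ln c + (ln (dl ^ 2 + (1 - dl) * p2) - ln p2))
   <= dl ^ 2 / c + dl ^ 2 / p2 + 2 * dl.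
Proof.
  intros Hd Hk Hc Ec Hp.
  assert (D2 : 0 < dl ^ 2) by (apply pow_lt; lra).
  assert (Y : 0 <= dl ^ 2 * k / c).
  { apply Rmult_le_pos; [apply Rmult_le_pos; lra|]. left; now apply Rinv_0_lt_compat. }
  assert (E1 : ln (1 - (1 - dl ^ 2) * k) = ln c + ln (1 + dl ^ 2 * k / c)).
  { rewrite <- ln_mult by lra. f_equal. rewrite Ec. field. lra. }
  assert (B1 : 0 <= ln (1 + dl ^ 2 * k / c)).
  { rewrite <- ln_1. apply ln_le; lra. }
  assert (B2 : ln (1 + dl ^ 2 * k / c) <= dl ^ 2 / c).
  { eapply Rle_trans; [apply ln_le_sub_1; lra|].
    replace (1 + dl ^ 2 * k / c - 1) with (dl ^ 2 / c * k) by (field; lra).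
    assert (0 < dl ^ 2 / c) by now apply Rdiv_lt_0_compat. nra. }
  set (y := 1 - dl + dl ^ 2 / p2). assert (Q : 0 < dl ^ 2 / p2) by now apply Rdiv_lt_0_compat.
  assert (E2 : ln (dl ^ 2 + (1 - dl) * p2) = ln p2 + ln y).
  { rewrite <- ln_mult by (unfold y; lra). f_equal. unfold y. field. lra. }
  assert (B3 : ln y <= dl ^ 2 / p2).
  { eapply Rle_trans; [apply ln_le_sub_1; unfold y; lra|]. unfold y. lra. }
  assert (B4 : - (2 * dl) <= ln y).
  { apply Rle_trans with (ln (1 - dl)); [|apply ln_le; unfold y; lra].
    assert (I : ln (/ (1 - dl)) <= / (1 - dl) - 1) by (apply ln_le_sub_1, Rinv_0_lt_compat; lra).
    rewrite ln_Rinv in I by lra.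
    assert (/ (1 - dl) - 1 <= 2 * dl); [|lra].
    apply (Rmult_le_reg_r (1 - dl)); [lra|].
    replace ((/ (1 - dl) - 1) * (1 - dl)) with dl by (field; lra). nra. }
  assert (Z : 0 < dl ^ 2 / c) by now apply Rdiv_lt_0_compat.
  rewrite E1, E2. apply Rabs_le. lra.
Qed.

Lemma dsum_diag c N : dsum (fun i j => if Nat.eq_dec i j then c else 0) N = INR N * c.
Proof.
  unfold dsum. rewrite (rsum_ext _ (fun _ => c)); [apply rsum_const|].
  intros i Hi.
  assert (Q : forall M, rsum (fun j => if Nat.eq_dec i j then c else 0) M = if le_lt_dec M i then 0 else c).
  { induction M; cbn [rsum]; [destruct (le_lt_dec 0 i); [reflexivity|lia]|].
    rewrite IHM. destruct (le_lt_dec M i), (le_lt_dec (S M) i), (Nat.eq_dec i M); try lia; ring. }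
  rewrite Q. destruct (le_lt_dec N i); [lia|reflexivity].
Qed.

Definition lnG (b : nat -> C) (r : R) (w : C) (i j : nat) : R :=
  ln (Cmod (divdiff b (r * w ^ i) (r * w ^ j)) ^ 2).
Definition lnZ (rho : R) (w : C) (i j : nat) : R :=
  ln (Cmod (1 - rho * (w ^ i * Cconj (w ^ j))) ^ 2).

(* The energy in the image is regularised with [1 - dl ^ 2] and the one in the disk with [1 - dl], so that
   the singular terms [ln (dl ^ 2)] cancel on the diagonal. *)
Lemma energy_comparison b r : disk b -> inj_disk b -> b 1%nat = RtoC 1 -> 0 < r < 1 ->
  exists K, 0 < K /\ forall N w (x : nat -> R) X dl, (0 < N)%nat -> prim_root N w ->
  (forall i, Rabs (x i) <= X) -> rsum x N = 0 -> 0 < dl <= 1 / 2 ->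
  dsum (fun i j => x i * x j * (lnG b r w i j + lnZ (1 - dl) w i j)) N
    <= X ^ 2 * K * (INR N ^ 2 * (dl ^ 2 * INR N ^ 2 + dl) + INR N).
Proof.
  intros Hb Hi H1 Hr.
  assert (N1 : b 1%nat <> RtoC 0). { rewrite H1. apply C1_nz. }
  destruct (divdiff_lower b r Hb Hi N1 Hr) as (m & Hm & Lm).
  destruct (divdiff_lip b r Hb Hr) as (K1 & HK1 & Lip). destruct (disk_lip b r Hb Hr) as (K2 & HK2 & Lip2).
  set (M := Cmod (divdiff b 0 0) + K1 * (r + r)).
  set (U := 1 + (Cmod (peval b 0) + K2 * r) ^ 2).
  assert (HU : 1 <= U) by (unfold U; pose proof (pow2_ge_0 (Cmod (peval b 0) + K2 * r)); lra).
  assert (C0 : Cmod 0 <= r) by (rewrite Cmod_0; lra).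
  assert (BM : forall z w, Cmod z <= r -> Cmod w <= r -> Cmod (divdiff b z w) <= M).
  { intros z w Hz Hw. specialize (Lip z w 0%C 0%C Hz Hw C0 C0).
    replace (divdiff b z w) with ((divdiff b z w - divdiff b 0 0) + divdiff b 0 0)%C by ring.
    eapply Rle_trans; [apply Cmod_triangle|]. unfold M.
    replace (z - 0)%C with z in Lip by ring. replace (w - 0)%C with w in Lip by ring.
    assert (K1 * (Cmod z + Cmod w) <= K1 * (r + r)) by (apply Rmult_le_compat_l; lra). lra. }
  assert (BU : forall z, Cmod z <= r -> sph (peval b z) <= U).
  { intros z Hz. specialize (Lip2 z 0%C Hz C0). replace (z - 0)%C with z in Lip2 by ring.
    unfold sph, U. apply Rplus_le_compat_l, pow_incr. split; [apply Cmod_ge_0|].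
    replace (peval b z) with ((peval b z - peval b 0) + peval b 0)%C by ring.
    eapply Rle_trans; [apply Cmod_triangle|].
    assert (K2 * Cmod z <= K2 * r) by (apply Rmult_le_compat_l; lra). lra. }
  assert (Hm2 : 0 < m ^ 2) by now apply pow_lt. assert (Hr2 : 0 < r ^ 2) by (apply pow_lt; lra).
  (* The quotient bounds p^2 / c, with p the distance of two roots of unity and c = 1 - [ker] at
     their images; 3 leaves room for dl^2/p^2 + 2 dl. [Kb] bounds what remains on the diagonal. *)
  set (Ka := U ^ 2 / (r ^ 2 * m ^ 2) + 3).
  set (Kb := Rabs (ln (m ^ 2)) + Rabs (ln (M ^ 2)) + 2 * ln U + Rabs (ln (r ^ 2))).
  assert (Hrm : 0 < r ^ 2 * m ^ 2) by now apply Rmult_lt_0_compat.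
  assert (HKa : 3 < Ka).
  { unfold Ka. assert (0 < U ^ 2 / (r ^ 2 * m ^ 2)); [|lra]. apply Rdiv_lt_0_compat; [apply pow_lt; lra|exact Hrm]. }
  assert (HlU : 0 <= ln U) by (rewrite <- ln_1; apply ln_le; lra).
  assert (HKb : 0 <= Kb).
  { unfold Kb. pose proof (Rabs_pos (ln (m ^ 2))). pose proof (Rabs_pos (ln (M ^ 2))).
    pose proof (Rabs_pos (ln (r ^ 2))). lra. }
  exists (Ka + Kb). split; [lra|]. intros N w x X dl HN Hw Hx Hx0 Hd.
  pose proof Hw as (W1 & W2 & W3).
  assert (PN : 0 < INR N) by now apply lt_0_INR.
  assert (D2 : 0 < dl ^ 2) by (apply pow_lt; lra).
  set (z := fun i : nat => (r * w ^ i)%C). set (W := fun i => peval b (z i)).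
  assert (Hz : forall i, Cmod (z i) <= r).
  { intros i. unfold z. rewrite Cmod_mult, Cmod_pow, W2, pow1, Cmod_R, Rabs_pos_eq; lra. }
  assert (Sp : forall i, 1 <= sph (W i) <= U) by (intros; split; [apply sph_pos|apply BU, Hz]).
  assert (LSp : forall i, 0 <= ln (sph (W i)) <= ln U).
  { intros i. destruct (Sp i). split; [rewrite <- ln_1|]; apply ln_le; lra. }
  assert (Gm : forall i j, m <= Cmod (divdiff b (z i) (z j)) <= M) by (intros; split; [apply Lm|apply BM]; apply Hz).
  (* What is left of the two energies after removing all terms that depend on at most one index. Off
     the diagonal it would vanish for dl = 0, since 1 - [ker] = r^2 p^2 |divdiff|^2 / (sph sph). *)
  set (e := fun i j => - ln (1 - (1 - dl ^ 2) * ker (W i) (W j)) + lnG b r w i j + lnZ (1 - dl) w i j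
     - ln (sph (W i)) - ln (sph (W j)) + ln (r ^ 2)).
  (* Off the diagonal 1/p^2 <= N^2 by [root_separation]; on it the error is only bounded, but there
     are just N such pairs. *)
  set (bd := fun i j => Ka * (dl ^ 2 * INR N ^ 2 + dl) + (if Nat.eq_dec i j then Kb else 0)).
  assert (Pd : 0 <= dl ^ 2 * INR N ^ 2 + dl) by (assert (0 < dl ^ 2 * INR N ^ 2) by (apply Rmult_lt_0_compat; [exact D2|now apply pow_lt]); lra).
  assert (He : forall i j, (i < N)%nat -> (j < N)%nat -> Rabs (e i j) <= bd i j).
  { intros i j Hi' Hj'. unfold e, bd, lnG, lnZ. fold (z i) (z j). specialize (Gm i j).
    set (v := (w ^ i * Cconj (w ^ j))%C).
    assert (Hv : Cmod v = 1) by (unfold v; rewrite Cmod_mult, Cmod_conj, !Cmod_pow, W2, !pow1; ring).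
    rewrite Cmod2_one_minus by exact Hv. replace (1 - (1 - dl)) with dl by ring.
    assert (Wj := prim_root_conj N w j Hw).
    assert (Cm : forall t, 0 < t -> m <= t <= M -> Rabs (ln (t ^ 2)) <= Rabs (ln (m ^ 2)) + Rabs (ln (M ^ 2))).
    { intros t Ht0 Ht. assert (ln (m ^ 2) <= ln (t ^ 2)) by (apply ln_le; [exact Hm2|apply pow_incr; lra]).
      assert (ln (t ^ 2) <= ln (M ^ 2)) by (apply ln_le; [now apply pow_lt|apply pow_incr; lra]).
      apply Rabs_le. pose proof (Rabs_pos (ln (m ^ 2))). pose proof (Rabs_pos (ln (M ^ 2))).
      pose proof (Rle_abs (ln (M ^ 2))). pose proof (Rabs_maj2 (ln (m ^ 2))). lra. }
    destruct (Nat.eq_dec i j) as [Eij|Dij].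
    - subst j. assert (Ev : v = RtoC 1) by exact Wj. rewrite Ev.
      replace (1 - 1)%C with (RtoC 0) by ring. rewrite Cmod_0.
      assert (Ek : ker (W i) (W i) = 1).
      { assert (Q := ker_compl (W i) (W i)). replace (W i - W i)%C with (RtoC 0) in Q by ring.
        rewrite Cmod_0 in Q. unfold Rdiv in Q. rewrite pow_i, Rmult_0_l in Q by lia. lra. }
      rewrite Ek. replace (1 - (1 - dl ^ 2) * 1) with (dl ^ 2) by ring.
      replace (dl ^ 2 + (1 - dl) * 0 ^ 2) with (dl ^ 2) by ring.
      specialize (Cm (Cmod (divdiff b (z i) (z i))) ltac:(lra) Gm). specialize (LSp i).
      apply Rabs_le_between in Cm. set (lg := ln (Cmod (divdiff b (z i) (z i)) ^ 2)) in *.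
      assert (0 <= Ka * (dl ^ 2 * INR N ^ 2 + dl)) by (apply Rmult_le_pos; lra).
      pose proof (Rle_abs (ln (r ^ 2))). pose proof (Rabs_maj2 (ln (r ^ 2))).
      apply Rabs_le. unfold Kb. lra.
    - assert (Ne : v <> RtoC 1) by now apply (prim_root_ratio N w i j).
      assert (VN : (v ^ N = 1)%C) by now apply prim_root_ratio_pow.
      assert (Se := root_separation v N HN Hv VN Ne).
      set (p := Cmod (1 - v)%C) in *. assert (Pp : 0 < p).
      { pose proof (Cmod_ge_0 (1 - v)%C). fold p in H. nra. }
      assert (Pp2 : 0 < p ^ 2) by now apply pow_lt.
      assert (Hp : Cmod (w ^ i - w ^ j)%C = p).
      { unfold p. replace (1 - v)%C with (- ((w ^ i - w ^ j) * Cconj (w ^ j)))%C.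
        - rewrite Cmod_opp, Cmod_mult, Cmod_conj, Cmod_pow, W2, pow1. ring.
        - unfold v. replace (- ((w ^ i - w ^ j) * Cconj (w ^ j)))%C with
            ((w ^ j * Cconj (w ^ j)) - w ^ i * Cconj (w ^ j))%C by ring. rewrite Wj. ring. }
      set (G := Cmod (divdiff b (z i) (z j))) in *.
      assert (PG2 : 0 < G ^ 2) by (apply pow_lt; lra).
      set (c := 1 - ker (W i) (W j)). pose proof (Sp i). pose proof (Sp j).
      assert (PS : 0 < sph (W i) * sph (W j)) by (apply Rmult_lt_0_compat; lra).
      assert (Ec : c = p ^ 2 * r ^ 2 * G ^ 2 / (sph (W i) * sph (W j))).
      { unfold c. rewrite ker_compl. unfold W. rewrite <- divdiff_mul; auto; try (eapply Rle_lt_trans; [apply Hz|lra]).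
        unfold z at 1 2. replace (r * w ^ i - r * w ^ j)%C with (r * (w ^ i - w ^ j))%C by ring.
        rewrite !Cmod_mult, Hp, Cmod_R, Rabs_pos_eq by lra. fold G. f_equal. ring. }
      assert (Pprg : 0 < p ^ 2 * r ^ 2 * G ^ 2) by (apply Rmult_lt_0_compat; [apply Rmult_lt_0_compat|]; assumption).
      assert (Pc : 0 < c) by (rewrite Ec; now apply Rdiv_lt_0_compat).
      assert (Lc : ln c = ln (p ^ 2) + ln (r ^ 2) + ln (G ^ 2) - ln (sph (W i)) - ln (sph (W j))).
      { rewrite Ec. unfold Rdiv. rewrite ln_mult by (try apply Rinv_0_lt_compat; assumption).
        rewrite ln_Rinv by exact PS. rewrite !ln_mult by first [assumption|lra|apply Rmult_lt_0_compat; first [assumption|lra]]. ring. }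
      assert (Er := error_offdiag dl (ker (W i) (W j)) c (p ^ 2) Hd (ker_bounds _ _) Pc eq_refl Pp2).
      rewrite Lc in Er.
      match goal with |- Rabs ?A <= _ => replace A with
        (- ln (1 - (1 - dl ^ 2) * ker (W i) (W j)) +
        (ln (p ^ 2) + ln (r ^ 2) + ln (G ^ 2) - ln (sph (W i)) - ln (sph (W j))) +
        (ln (dl ^ 2 + (1 - dl) * p ^ 2) - ln (p ^ 2))) by ring end.
      eapply Rle_trans; [exact Er|].
      assert (Np : 1 <= INR N ^ 2 * p ^ 2).
      { rewrite <- Rpow_mult_distr. rewrite <- (pow1 2). apply pow_incr. lra. }
      assert (I1 : dl ^ 2 / p ^ 2 <= dl ^ 2 * INR N ^ 2).
      { apply (Rmult_le_reg_r (p ^ 2)); [exact Pp2|].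
        replace (dl ^ 2 / p ^ 2 * p ^ 2) with (dl ^ 2 * 1) by (field; lra).
        rewrite Rmult_assoc. apply Rmult_le_compat_l; lra. }
      assert (I2 : dl ^ 2 / c <= U ^ 2 / (r ^ 2 * m ^ 2) * (dl ^ 2 * INR N ^ 2)).
      { replace (dl ^ 2 / c) with (dl ^ 2 / p ^ 2 * (sph (W i) * sph (W j) * / (r ^ 2 * G ^ 2))).
        2:{ rewrite Ec. field. repeat split; lra. }
        rewrite (Rmult_comm (U ^ 2 / _)). apply Rmult_le_compat.
        - apply Rmult_le_pos; [lra|left; now apply Rinv_0_lt_compat].
        - apply Rmult_le_pos; [lra|left; apply Rinv_0_lt_compat, Rmult_lt_0_compat; assumption].
        - exact I1.
        - apply Rmult_le_compat; [lra|left; apply Rinv_0_lt_compat, Rmult_lt_0_compat; assumption| |].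
          + simpl. rewrite Rmult_1_r. apply Rmult_le_compat; lra.
          + apply Rinv_le_contravar; [exact Hrm|]. apply Rmult_le_compat_l; [lra|]. apply pow_incr. lra. }
      assert (0 <= U ^ 2 / (r ^ 2 * m ^ 2) * dl) by (unfold Ka in HKa; apply Rmult_le_pos; lra).
      assert (0 <= dl ^ 2 * INR N ^ 2) by (apply Rmult_le_pos; apply pow2_ge_0).
      unfold Ka. set (T := U ^ 2 / (r ^ 2 * m ^ 2)) in *. set (Y := dl ^ 2 * INR N ^ 2) in *.
      replace ((T + 3) * (Y + dl) + 0) with (T * Y + T * dl + 3 * Y + 3 * dl) by ring. lra. }
  assert (En := energy_nonneg W N x (1 - dl ^ 2) ltac:(nra)).
  assert (HX : 0 <= X) by (eapply Rle_trans; [apply Rabs_pos|apply (Hx O)]).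
  (* The last two sums depend on one index apart from a factor x_j or x_i, so total charge 0 makes
     them vanish. *)
  assert (Dec : dsum (fun i j => x i * x j * (lnG b r w i j + lnZ (1 - dl) w i j)) N
     = dsum (fun i j => x i * x j * e i j) N
     + (-1) * dsum (fun i j => x i * x j * - ln (1 - (1 - dl ^ 2) * ker (W i) (W j))) N
     + (dsum (fun i j => (x i * ln (sph (W i)) + - ln (r ^ 2) * x i) * x j) N
     + dsum (fun i j => x i * (x j * ln (sph (W j)))) N)).
  { rewrite <- dsum_scal, <- !dsum_plus. apply dsum_ext. intros i j _ _. unfold e. ring. }
  rewrite Dec, !dsum_mult, Hx0.
  assert (Be : dsum (fun i j => x i * x j * e i j) N <= dsum (fun i j => X ^ 2 * bd i j) N).
  { apply dsum_le. intros i j Hi' Hj'. eapply Rle_trans; [apply Rle_abs|].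
    rewrite !Rabs_mult. apply Rmult_le_compat; [apply Rmult_le_pos; apply Rabs_pos|apply Rabs_pos| |now apply He].
    simpl. rewrite Rmult_1_r. apply Rmult_le_compat; auto using Rabs_pos. }
  rewrite dsum_scal in Be. unfold bd in Be. rewrite dsum_plus, dsum_const, dsum_diag in Be.
  assert (X ^ 2 * (INR N * INR N * (Ka * (dl ^ 2 * INR N ^ 2 + dl)) + INR N * Kb)
     <= X ^ 2 * (Ka + Kb) * (INR N ^ 2 * (dl ^ 2 * INR N ^ 2 + dl) + INR N)); [|lra].
  rewrite (Rmult_assoc (X ^ 2)). apply Rmult_le_compat_l; [apply pow2_ge_0|].
  assert (0 <= INR N ^ 2 * (dl ^ 2 * INR N ^ 2 + dl)) by (apply Rmult_le_pos; [apply pow2_ge_0|exact Pd]).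
  assert (0 <= Kb * (INR N ^ 2 * (dl ^ 2 * INR N ^ 2 + dl))) by now apply Rmult_le_pos.
  assert (0 <= Ka * INR N) by (apply Rmult_le_pos; lra). nra.
Qed.

(** * Charges at roots of unity *)

Open Scope C_scope.

Definition dft (x : nat -> R) (w : C) (N n : nat) : C := csum (fun i => x i * (w ^ i) ^ n) N.
Definition qform (x : nat -> R) (w : C) (N : nat) (phi : C -> C -> C) : C :=
  csum (fun i => csum (fun j => x i * x j * phi (w ^ i) (w ^ j)) N) N.

Lemma csum_prod u v M N : csum (fun i => csum (fun j => u i * v j) N) M = csum u M * csum v N.
Proof.
  rewrite (csum_ext _ (fun i => csum v N * u i)).
  - rewrite csum_scal. ring.
  - intros i _. rewrite csum_scal. ring.
Qed.
Lemma Re_real_mult (t : R) (z : C) : Re (t * z) = (t * Re z)%R.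
Proof. unfold Re. simpl. ring. Qed.
Lemma Cconj_csum u N : Cconj (csum u N) = csum (fun i => Cconj (u i)) N.
Proof.
  induction N; simpl.
  - unfold Cconj; simpl. apply injective_projections; simpl; ring.
  - now rewrite Cplus_conj, IHN.
Qed.
Lemma dsum_Re (F : nat -> nat -> C) N : dsum (fun i j => Re (F i j)) N = Re (csum (fun i => csum (fun j => F i j) N) N).
Proof. unfold dsum. rewrite Re_csum. apply rsum_ext. intros. now rewrite Re_csum. Qed.

Lemma qform_cseries x w N (U : C -> C -> nat -> C) : (forall i j, asum (U (w ^ i) (w ^ j))) ->
  qform x w N (fun al be => cseries (U al be)) = cseries (fun n => qform x w N (fun al be => U al be n)).
Proof.
  intros H. unfold qform.
  assert (A : forall i j, asum (fun n => x i * x j * U (w ^ i) (w ^ j) n)) by (intros; apply asum_scal, H).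
  rewrite (cseries_csum (fun i n => csum (fun j => x i * x j * U (w ^ i) (w ^ j) n) N)).
  - apply csum_ext. intros i _. rewrite (cseries_csum (fun j n => x i * x j * U (w ^ i) (w ^ j) n)) by auto.
    apply csum_ext. intros j _. rewrite cseries_scal; auto.
  - intros i. apply (asum_csum (fun j n => x i * x j * U (w ^ i) (w ^ j) n)). auto.
Qed.
Lemma qform_asum x w N (U : C -> C -> nat -> C) : (forall i j, asum (U (w ^ i) (w ^ j))) ->
  asum (fun n => qform x w N (fun al be => U al be n)).
Proof.
  intros H. unfold qform. apply (asum_csum (fun i n => csum (fun j => x i * x j * U (w ^ i) (w ^ j) n) N)).
  intros i. apply (asum_csum (fun j n => x i * x j * U (w ^ i) (w ^ j) n)). intros j. apply asum_scal, H.
Qed.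
Lemma qform_ext x w N phi psi : (forall i j, phi (w ^ i) (w ^ j) = psi (w ^ i) (w ^ j)) -> qform x w N phi = qform x w N psi.
Proof. intros H. apply csum_ext. intros i _. apply csum_ext. intros j _. now rewrite H. Qed.
Lemma qform_plus x w N phi psi : qform x w N (fun al be => phi al be + psi al be) = qform x w N phi + qform x w N psi.
Proof.
  unfold qform. rewrite <- csum_plus. apply csum_ext. intros i _. rewrite <- csum_plus.
  apply csum_ext. intros j _. ring.
Qed.
Lemma qform_mono x w N c p q : qform x w N (fun al be => c * al ^ p * be ^ q) = c * dft x w N p * dft x w N q.
Proof.
  unfold qform, dft. rewrite <- Cmult_assoc, <- csum_prod, <- csum_scal.
  apply csum_ext. intros i _. rewrite <- csum_scal. apply csum_ext. intros j _. ring.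
Qed.
Lemma qform_scal x w N c phi : qform x w N (fun al be => c * phi al be) = c * qform x w N phi.
Proof.
  unfold qform. rewrite <- csum_scal. apply csum_ext. intros i _. rewrite <- csum_scal.
  apply csum_ext. intros j _. ring.
Qed.
Lemma qform_bound x (w : C) N (phi : C -> C -> C) X B : (forall i, Rabs (x i) <= X)%R -> (forall i j, Cmod (phi (w ^ i)%C (w ^ j)%C) <= B)%R ->
  (Cmod (qform x w N phi) <= INR N ^ 2 * X ^ 2 * B)%R.
Proof.
  intros Hx Hp. assert (HX : (0 <= X)%R) by (eapply Rle_trans; [apply Rabs_pos|apply (Hx O)]).
  apply Rle_trans with (rsum (fun _ => rsum (fun _ => X ^ 2 * B)%R N) N).
  - unfold qform. eapply Rle_trans; [apply Cmod_csum|]. apply rsum_le. intros i _.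
    eapply Rle_trans; [apply Cmod_csum|]. apply rsum_le. intros j _.
    rewrite !Cmod_mult, !Cmod_R. apply Rmult_le_compat; auto using Cmod_ge_0.
    + apply Rmult_le_pos; apply Rabs_pos.
    + simpl. rewrite Rmult_1_r. apply Rmult_le_compat; auto using Rabs_pos.
  - rewrite !rsum_const. right. ring.
Qed.

(** [log_mod_series] for the polynomial g = 1 - v z, whose logarithm has the coefficients -v^n /
    n. *)
Lemma ln_one_minus (v : C) (rho : R) : Cmod v = 1%R -> (0 < rho < 1)%R ->
  (ln (Cmod (1 - rho * v)%C ^ 2) = -2 * Re (cseries (fun n => match n with O => 0 | S m => / INR (S m) * (rho * v) ^ n end)%C))%R.
Proof.
  intros Hv Hr.
  set (g := fun n : nat => match n with O => RtoC 1 | S O => - v | _ => RtoC 0 end).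
  set (L := fun n : nat => match n with O => RtoC 0 | S m => - (/ INR (S m) * v ^ n) end).
  set (R1 := ((1 + rho) / 2)%R). assert (HR : (rho < R1 < 1)%R) by (unfold R1; lra).
  assert (Sg : sm g R1).
  { apply asum_sm; [lra|]. apply (asum_geom _ 1 R1); [lra|]. intros [|[|n]]; simpl.
    - rewrite Cmult_1_l, Cmod_1. lra.
    - rewrite Cmod_mult, Cmod_opp, Hv, Cmult_1_r, Cmod_R, Rabs_pos_eq; lra.
    - rewrite Cmult_0_l, Cmod_0. assert (0 <= R1 ^ n)%R by (apply pow_le; lra). nra. }
  assert (Eg : forall x : R, (0 <= x <= rho)%R -> peval g x = 1 - x * v).
  { intros x Hx. unfold peval. rewrite (cseries_split _ 2).
    - rewrite (cseries_ext _ (fun _ => 0)) by (intros n; simpl; ring). rewrite cseries_0. simpl. ring.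
    - apply (sm_asum g R1 _ Sg). rewrite Cmod_R, Rabs_pos_eq; lra. }
  assert (LB : forall n, (Cmod (L n) <= 1 * 1 ^ n)%R).
  { intros [|n]; [simpl; rewrite Cmod_0; lra|]. unfold L. rewrite Cmod_opp, Cmod_mult, Cmod_pow, Hv, !pow1.
    rewrite !Rmult_1_r. apply Cmod_inv_INR. }
  rewrite <- Eg by lra. rewrite (log_mod_series g L rho R1); auto.
  - simpl (g O). rewrite Cmod_1, pow1, ln_1. simpl (Re (L O)).
    replace (peval L rho) with (- cseries (fun n => match n with O => 0 | S m => / INR (S m) * (rho * v) ^ n end)).
    + unfold Re. simpl. ring.
    + match goal with |- - ?A = _ => replace (- A) with (- (1) * A) by ring end. rewrite <- cseries_scal.
      * apply cseries_ext. intros [|n]; [simpl; ring|]. unfold L. rewrite Cpow_mult_l. ring.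
      * apply (asum_geom _ 1 rho); [lra|]. intros [|n]; [rewrite Cmod_0; simpl; lra|].
        rewrite Cmod_mult, Cmod_pow, (Cmod_mult rho), Hv, Cmod_R, Rabs_pos_eq, Rmult_1_r by lra.
        apply Rmult_le_compat_r; [apply pow_le; lra|apply Cmod_inv_INR].
  - lra.
  - apply (sm_bound L 1 1 R1); auto; lra.
  - intros n. assert (DL : forall k, deriv L k = - v ^ S k).
    { intros k. unfold deriv, L. field. apply INR_S_neq. }
    destruct n as [|[|n]].
    + simpl conv. rewrite DL. unfold deriv, g. simpl. ring.
    + rewrite conv_comm. simpl conv. unfold tl. rewrite !DL. unfold deriv, g. simpl. ring.
    + rewrite conv_comm. simpl conv. rewrite !DL.
      replace (conv (tl (tl g)) (deriv L) n) with (RtoC 0); [unfold deriv, tl, g; simpl; ring|].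
      symmetry. rewrite (conv_ext _ (fun _ => 0) _ (deriv L)); [apply conv_0_l| |reflexivity].
      intros k _. reflexivity.
  - intros x Hx. rewrite Eg by exact Hx. intros Z.
    assert (Q : Cmod (x * v) = 1%R). { replace (x * v) with (1 - (1 - x * v)) by ring. rewrite Z.
      replace (1 - 0) with (RtoC 1) by ring. apply Cmod_1. }
    rewrite Cmod_mult, Hv, Cmod_R, Rabs_pos_eq in Q; lra.
Qed.

Section Charges.
Context (x : nat -> R) (w : C) (N : nat) (Hw : prim_root N w) (HN : (10 < N)%nat).
(** The range stops at N - 5 because real charges with frequencies 1 and 5 also have the frequencies
    N - 1 and N - 5. *)
Context (Hx : forall n, (n < N - 5)%nat -> n <> 1%nat -> n <> 5%nat -> dft x w N n = 0).
Definition spec (x : nat -> R) (w : C) (N n : nat) : R := (Cmod (dft x w N n) ^ 2)%R.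
Let Sp := spec x w N.

Lemma spec_eq n : RtoC (Sp n) = csum (fun i => csum (fun j => x i * x j * (w ^ i * Cconj (w ^ j)) ^ n) N) N.
Proof.
  unfold Sp, spec. rewrite Cmod2_conj. unfold dft. rewrite Cconj_csum, <- csum_prod.
  apply csum_ext. intros i _. apply csum_ext. intros j _.
  rewrite !Cmult_conj, Cconj_R, !Cpow_conj, Cpow_mult_l. ring.
Qed.
Lemma spec_periodic n : Sp (N + n) = Sp n.
Proof.
  destruct Hw as (W1 & _). unfold Sp, spec. do 2 f_equal. apply csum_ext. intros i _.
  rewrite Cpow_add_r, <- (Cpow_mult_r w i N), (Nat.mul_comm i N), Cpow_mult_r, W1, Cpow_1_l. ring.
Qed.
(** Parseval: the total of the power spectrum is N times the sum of the x_i^2. *)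
Lemma spec_total X : (forall i, Rabs (x i) <= X)%R -> (rsum Sp N <= INR N ^ 2 * X ^ 2)%R.
Proof.
  intros HX.
  pose proof Hw as (W1 & W2 & W3).
  assert (Wj := fun j => prim_root_conj N w j Hw).
  assert (E : RtoC (rsum Sp N) = csum (fun i => csum (fun j => if Nat.eq_dec i j then INR N * (x i * x i) else 0) N) N).
  { rewrite RtoC_rsum. rewrite (csum_ext _ _ N (fun n _ => spec_eq n)), csum_swap.
    apply csum_ext. intros i Hi. rewrite csum_swap. apply csum_ext. intros j Hj. rewrite csum_scal.
    destruct (Nat.eq_dec i j) as [<-|D].
    - rewrite (csum_ext _ (fun _ => 1)); [rewrite csum_const; ring|]. intros k _. rewrite Wj. apply Cpow_1_l.
    - rewrite geom_root_sum; [ring|now apply prim_root_ratio_pow|now apply (prim_root_ratio N w i j)]. }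
  assert (E' : rsum Sp N = dsum (fun i j => if Nat.eq_dec i j then (INR N * (x i * x i))%R else 0%R) N).
  { change (rsum Sp N) with (Re (RtoC (rsum Sp N))). rewrite E, <- dsum_Re. apply dsum_ext. intros i j _ _.
    destruct (Nat.eq_dec i j); [|reflexivity]. unfold Re. simpl. ring. }
  rewrite E'. apply Rle_trans with (dsum (fun i j => if Nat.eq_dec i j then (INR N * X ^ 2)%R else 0%R) N).
  - apply dsum_le. intros i j _ _. destruct (Nat.eq_dec i j); [|lra].
    apply Rmult_le_compat_l; [apply pos_INR|]. specialize (HX i). pose proof (Rabs_pos (x i)).
    rewrite <- (Rabs_pos_eq (x i * x i)) by apply Rle_0_sqr. rewrite Rabs_mult. simpl. rewrite Rmult_1_r.
    apply Rmult_le_compat; auto.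
  - rewrite dsum_diag. right. ring.
Qed.

(** Expanding the logarithm turns the energy into twice the sum of rho^n |dft n|^2 / n. Frequencies
    1 and 5 give the main term; the next nonzero ones have n >= N - 5, so 1/n is small there. *)
Lemma lnZ_sum rho X : (0 < rho < 1)%R -> (forall i, Rabs (x i) <= X)%R ->
  (- dsum (fun i j => x i * x j * lnZ rho w i j) N <=
   2 * (Sp 1 + Sp 5 / 5) + 2 / (INR N - 5) * (INR N ^ 2 * X ^ 2 / (1 - rho ^ N)))%R.
Proof.
  intros Hr HX. pose proof Hw as (W1 & W2 & W3).
  assert (HV : forall i j, Cmod (w ^ i * Cconj (w ^ j)) = 1%R).
  { intros i j. rewrite Cmod_mult, Cmod_conj, !Cmod_pow, W2, !pow1. ring. }
  set (t := fun n : nat => match n with O => 0%R | S m => (/ INR (S m) * rho ^ n * Sp n)%R end).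
  set (U := fun (al be : C) (n : nat) => match n with O => RtoC 0 | S m => / INR (S m) * (rho * (al * Cconj be)) ^ n end).
  assert (AU : forall i j, asum (U (w ^ i) (w ^ j))).
  { intros i j. apply (asum_geom _ 1 rho); [lra|]. intros [|n]; [unfold U; rewrite Cmod_0; simpl; lra|].
    unfold U. rewrite Cmod_mult, Cmod_pow, (Cmod_mult rho), HV, Cmod_R, Rabs_pos_eq, Rmult_1_r by lra.
    apply Rmult_le_compat_r; [apply pow_le; lra|apply Cmod_inv_INR]. }
  assert (Et : forall n, qform x w N (fun al be => U al be n) = RtoC (t n)).
  { intros [|n].
    - unfold qform, U, t. rewrite (csum_ext _ (fun _ => 0)); [apply csum_0|]. intros i _.
      rewrite (csum_ext _ (fun _ => 0)); [apply csum_0|]. intros j _. ring.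
    - unfold t. rewrite !RtoC_mult, RtoC_inv, spec_eq, <- csum_scal by (apply not_0_INR; lia). unfold qform. apply csum_ext. intros i _.
      rewrite <- csum_scal. apply csum_ext. intros j _. unfold U. rewrite Cpow_mult_l, RtoC_pow. ring. }
  assert (E : dsum (fun i j => x i * x j * lnZ rho w i j)%R N = (- (2) * Series t)%R).
  { rewrite (dsum_ext _ (fun i j => - (2) * Re (x i * x j * cseries (U (w ^ i) (w ^ j)))%C)%R).
    - rewrite dsum_scal, dsum_Re. f_equal.
      change (Re (qform x w N (fun al be => cseries (U al be))) = Series t). rewrite qform_cseries by exact AU.
      rewrite Re_cseries. apply Series_ext. intros n. now rewrite Et.
    - intros i j _ _. unfold lnZ. rewrite ln_one_minus by (try apply HV; lra).
      rewrite <- RtoC_mult, Re_real_mult. unfold U. ring. }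
  assert (St : ex_series t).
  { assert (Q := asum_re _ (qform_asum x w N U AU)). revert Q. apply ex_series_ext. intros n. now rewrite Et. }
  assert (Sp0 : forall n, (0 <= Sp n)%R) by (intros; apply pow2_ge_0).
  assert (SpB : forall n, (Sp n <= (INR N * X) ^ 2)%R).
  { intros n. apply pow_incr. split; [apply Cmod_ge_0|]. unfold dft. eapply Rle_trans; [apply Cmod_csum|].
    rewrite <- rsum_const. apply rsum_le. intros i _. rewrite Cmod_mult, !Cmod_pow, W2, !pow1, Cmod_R, Rmult_1_r. apply HX. }
  set (y := fun n => (rho ^ n * Sp n)%R).
  assert (Sy : ex_series y).
  { apply (ex_series_le (V := R_CompleteNormedModule) _ (fun n => (INR N * X) ^ 2 * rho ^ n)%R).
    - intros n. unfold norm; simpl; unfold abs; simpl. unfold y. rewrite Rabs_pos_eq.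
      + rewrite Rmult_comm. apply Rmult_le_compat_r; [apply pow_le; lra|apply SpB].
      + apply Rmult_le_pos; [apply pow_le; lra|apply Sp0].
    - eexists. apply geom_scal_series. lra. }
  assert (y0 : forall n, (0 <= y n)%R) by (intros; apply Rmult_le_pos; [apply pow_le; lra|apply Sp0]).
  assert (RN : (0 <= rho ^ N < 1)%R).
  { split; [apply pow_le; lra|]. apply pow_lt_1_compat; [lra|lia]. }
  (* The spectrum has period N, so the series equals its first N terms plus rho^N times itself;
     Parseval bounds those terms. *)
  assert (Yb : (Series y <= INR N ^ 2 * X ^ 2 / (1 - rho ^ N))%R).
  { assert (EY := Series_incr_n y N ltac:(lia) Sy). rewrite sum_f_rsum in EY.
    replace (S (pred N)) with N in EY by lia.
    rewrite (Series_ext (fun k => y (N + k)%nat) (fun k => rho ^ N * y k)%R), Series_scal_l in EY.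
    2:{ intros n. unfold y. rewrite spec_periodic, pow_add. ring. }
    assert (B : (rsum y N <= rsum Sp N)%R).
    { apply rsum_le. intros n _. unfold y. rewrite <- (Rmult_1_l (Sp n)) at 2.
      apply Rmult_le_compat_r; [apply Sp0|]. rewrite <- (pow1 n). apply pow_incr. lra. }
    assert (B2 := spec_total X HX).
    apply (Rmult_le_reg_r (1 - rho ^ N)); [lra|].
    replace (INR N ^ 2 * X ^ 2 / (1 - rho ^ N) * (1 - rho ^ N))%R with (INR N ^ 2 * X ^ 2)%R by (field; lra). nra. }
  assert (N5 : (0 < INR N - 5)%R).
  { apply lt_INR in HN. replace (INR 10) with 10%R in HN by (simpl; ring). lra. }
  assert (T6 : (Series (fun k => t (6 + k)%nat) <= / (INR N - 5) * Series y)%R).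
  { apply Rle_trans with (Series (fun k => / (INR N - 5) * y (6 + k)%nat)%R).
    - apply Series_le.
      + intros k. change (t (6 + k)%nat) with (/ INR (6 + k) * rho ^ (6 + k) * Sp (6 + k))%R.
        assert (P6 : (0 < INR (6 + k))%R) by (apply lt_0_INR; lia).
        assert (PI6 : (0 < / INR (6 + k))%R) by now apply Rinv_0_lt_compat.
        rewrite Rmult_assoc. fold (y (6 + k)%nat). split; [apply Rmult_le_pos; [lra|apply y0]|].
        destruct (le_lt_dec (N - 5) (6 + k)) as [L|L].
        * apply Rmult_le_compat_r; [apply y0|]. apply Rinv_le_contravar; [exact N5|].
          apply le_INR in L. rewrite minus_INR in L by lia. replace (INR 5) with 5%R in L by (simpl; ring). exact L.
        * unfold y, Sp, spec. rewrite Hx by lia. rewrite Cmod_0. right. simpl. ring.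
      + apply (ex_series_scal (V := R_NormedModule)). now apply (ex_series_incr_n y 6).
    - rewrite Series_scal_l. apply Rmult_le_compat_l; [left; now apply Rinv_0_lt_compat|].
      rewrite (Series_incr_n y 6 ltac:(lia) Sy), sum_f_rsum.
      assert (0 <= rsum y 6)%R by (rewrite <- (rsum_0 6); apply rsum_le; auto). simpl pred. lra. }
  assert (T5 : (rsum t 6 <= Sp 1 + Sp 5 / 5)%R).
  { assert (Z : forall n, (n < N - 5)%nat -> n <> 1%nat -> n <> 5%nat -> Sp n = 0%R).
    { intros n H1 H2 H3. unfold Sp, spec. rewrite Hx by auto. rewrite Cmod_0. ring. }
    cbn [rsum]. unfold t. rewrite (Z 2%nat), (Z 3%nat), (Z 4%nat) by lia.
    pose proof (Sp0 1%nat). pose proof (Sp0 5%nat).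
    assert (rho ^ 1 <= 1)%R by (simpl; lra).
    assert (rho ^ 5 <= 1)%R by (rewrite <- (pow1 5); apply pow_incr; lra).
    replace (INR 1) with 1%R by (simpl; ring). replace (INR 5) with 5%R by (simpl; ring).
    assert (rho ^ 1 * Sp 1 <= 1 * Sp 1)%R by (apply Rmult_le_compat_r; lra).
    assert (rho ^ 5 * Sp 5 <= 1 * Sp 5)%R by (apply Rmult_le_compat_r; lra). lra. }
  rewrite E, (Series_incr_n t 6 ltac:(lia) St), sum_f_rsum. simpl pred.
  assert (/ (INR N - 5) * Series y <= / (INR N - 5) * (INR N ^ 2 * X ^ 2 / (1 - rho ^ N)))%R.
  { apply Rmult_le_compat_l; [left; now apply Rinv_0_lt_compat|exact Yb]. }
  unfold Rdiv at 2. lra.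
Qed.

(** Truncation of the Taylor series in the scale t = r. The N^2 pairs multiply the tail, but it
    decays like (r/rho)^M, and M will be N - 5. *)
Lemma lnG_sum b r rho K X : disk b -> inj_disk b -> b 1%nat = 1 -> (0 < r < rho)%R -> (rho < 1)%R ->
  (forall al be, (Cmod al <= 1)%R -> (Cmod be <= 1)%R -> forall n, (Cmod (log_coef b al be n) <= K * (/ rho) ^ n)%R) ->
  (forall i, Rabs (x i) <= X)%R -> forall M,
  (2 * Re (csum (fun n => r ^ n * qform x w N (fun al be => log_coef b al be n))%C M)
    - 2 * (INR N ^ 2 * X ^ 2 * K * (r / rho) ^ M / (1 - r / rho))
   <= dsum (fun i j => x i * x j * lnG b r w i j) N)%R.
Proof.
  intros Hb Hi H1 Hr Hrho HK HX M. pose proof Hw as (W1 & W2 & W3).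
  assert (Wi : forall i, (Cmod (w ^ i) <= 1)%R) by (intros; rewrite Cmod_pow, W2, pow1; lra).
  assert (Q : (0 <= r / rho < 1)%R).
  { split; [apply Rmult_le_pos; [lra|left; apply Rinv_0_lt_compat; lra]|].
    apply (Rmult_lt_reg_r rho); [lra|]. unfold Rdiv. rewrite Rmult_assoc, Rinv_l; lra. }
  set (U := fun al be n => log_coef b al be n * r ^ n).
  assert (UB : forall i j n, (Cmod (U (w ^ i)%C (w ^ j)%C n) <= K * (r / rho) ^ n)%R).
  { intros i j n. unfold U. rewrite Cmod_mult, Cmod_pow, Cmod_R, (Rabs_pos_eq r) by lra.
    unfold Rdiv. rewrite Rpow_mult_distr, (Rmult_comm (r ^ n)), <- Rmult_assoc.
    apply Rmult_le_compat_r; [apply pow_le; lra|]. now apply HK. }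
  assert (AU : forall i j, asum (U (w ^ i) (w ^ j))).
  { intros i j. apply (asum_geom _ K (r / rho)); auto. }
  set (A := fun n => qform x w N (fun al be => U al be n)).
  assert (E : dsum (fun i j => x i * x j * lnG b r w i j)%R N = (2 * Re (cseries A))%R).
  { rewrite (dsum_ext _ (fun i j => 2 * Re (x i * x j * cseries (U (w ^ i) (w ^ j)))%C)%R).
    - rewrite dsum_scal, dsum_Re. f_equal.
      change (Re (qform x w N (fun al be => cseries (U al be))) = Re (cseries A)). now rewrite qform_cseries by exact AU.
    - intros i j _ _. unfold lnG. rewrite log_divdiff by (auto; lra). change (peval (log_coef b (w ^ i) (w ^ j)) r) with (cseries (U (w ^ i) (w ^ j))).
      rewrite <- RtoC_mult, Re_real_mult. ring. }
  rewrite E, (cseries_split A M (qform_asum x w N U AU)).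
  assert (T : (Cmod (cseries (fun n => A (M + n)%nat)) <= INR N ^ 2 * X ^ 2 * K * (r / rho) ^ M / (1 - r / rho))%R).
  { apply cseries_geom; [exact Q|]. intros n. eapply Rle_trans; [apply (qform_bound _ _ _ _ X (K * (r / rho) ^ (M + n))); auto|].
    rewrite pow_add. right. ring. }
  assert (EA : csum A M = csum (fun n => r ^ n * qform x w N (fun al be => log_coef b al be n)) M).
  { apply csum_ext. intros n _. unfold A. rewrite <- qform_scal. apply qform_ext. intros i j. unfold U. ring. }
  rewrite EA. assert (RT := re_le_Cmod (cseries (fun n => A (M + n)%nat))). apply Rabs_le_between in RT.
  match goal with |- (_ <= 2 * Re (?a + ?c))%R => change (Re (a + c)) with (Re a + Re c)%R end. lra.
Qed.
End Charges.

(** * Homogeneous polynomials tested against sparse charges *)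

(** Homogeneous polynomials as functions, generated from monomials: enough for [qform], which is
    additive and factors on monomials. The last constructor replaces functional extensionality. *)
Inductive homog : nat -> (C -> C -> C) -> Prop :=
| homog_mono p q c : homog (p + q) (fun al be => c * al ^ p * be ^ q)
| homog_plus n phi psi : homog n phi -> homog n psi -> homog n (fun al be => phi al be + psi al be)
| homog_ext n phi psi : (forall al be, phi al be = psi al be) -> homog n phi -> homog n psi.

Lemma homog_mult m n phi psi : homog m phi -> homog n psi -> homog (m + n) (fun al be => phi al be * psi al be).
Proof.
  intros H1 H2. induction H1 as [p q c|m f g Hf IHf Hg IHg|m f g E Hf IHf].
  - induction H2 as [p' q' c'|n f g Hf IHf Hg IHg|n f g E Hf IHf].
    + replace (p + q + (p' + q'))%nat with ((p + p') + (q + q'))%nat by lia.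
      apply (homog_ext _ (fun al be => c * c' * al ^ (p + p') * be ^ (q + q'))); [|constructor].
      intros al be. rewrite !Cpow_add_r. ring.
    + eapply homog_ext; [|apply (homog_plus _ _ _ IHf IHg)]. intros; simpl; ring.
    + eapply homog_ext; [|apply IHf]. intros; simpl. now rewrite E.
  - eapply homog_ext; [|apply (homog_plus _ _ _ IHf IHg)]. intros; simpl; ring.
  - eapply homog_ext; [|apply IHf]. intros; simpl. now rewrite E.
Qed.
Lemma homog_const c : homog 0 (fun _ _ => c).
Proof. apply (homog_ext _ (fun al be => c * al ^ 0 * be ^ 0)); [intros; simpl; ring|apply (homog_mono 0 0)]. Qed.
Lemma homog_scal n c phi : homog n phi -> homog n (fun al be => c * phi al be).
Proof. intros H. apply (homog_mult 0 n (fun _ _ => c) phi (homog_const c) H). Qed.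
Lemma homog_conv n : forall d (a b : C -> C -> nat -> C),
  (forall k, (k <= n)%nat -> homog (k + d) (fun al be => a al be k)) ->
  (forall k, (k <= n)%nat -> homog k (fun al be => b al be k)) ->
  homog (n + d) (fun al be => conv (a al be) (b al be) n).
Proof.
  induction n; intros d a b Ha Hb; simpl.
  - rewrite <- (Nat.add_0_r d). apply (homog_mult d 0 (fun al be => a al be O) (fun al be => b al be O)).
    + apply (Ha O). lia.
    + apply (Hb O). lia.
  - change (S (n + d)) with (S n + d)%nat. apply homog_plus.
    + rewrite Nat.add_comm. apply (homog_mult d (S n) (fun al be => a al be O) (fun al be => b al be (S n))).
      * apply (Ha O). lia.
      * apply Hb. lia.
    + replace (S n + d)%nat with (n + S d)%nat by lia.
      apply (IHn (S d) (fun al be => tl (a al be)) b); [|intros; apply Hb; lia].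
      intros k Hk. unfold tl. replace (k + S d)%nat with (S k + d)%nat by lia. apply Ha. lia.
Qed.
Lemma homog_pq n : homog n (pq n).
Proof.
  induction n.
  - apply (homog_ext _ (fun _ _ => 1)); [reflexivity|apply homog_const].
  - apply (homog_ext _ (fun al be => al ^ S n + be * pq n al be)); [reflexivity|]. apply homog_plus.
    + assert (M := homog_mono (S n) 0 1). rewrite Nat.add_0_r in M.
      eapply homog_ext; [|exact M]. intros; simpl; ring.
    + apply (homog_mult 1 n (fun _ be => be) (pq n)); [|exact IHn].
      apply (homog_ext _ (fun al be => 1 * al ^ 0 * be ^ 1)); [intros; simpl; ring|apply (homog_mono 0 1)].
Qed.
Lemma homog_log_coef b n : homog n (fun al be => log_coef b al be n).
Proof.
  assert (G : forall k, homog k (fun al be => gfam b al be k)) by (intros; apply homog_scal, homog_pq).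
  assert (P : forall m k, (k <= m)%nat -> homog k (fun al be => pinv (gfam b al be) k)).
  { induction m; intros k Hk.
    - replace k with O by lia. apply (homog_ext _ (fun _ _ => / (b 1%nat * 1))); [reflexivity|apply homog_const].
    - destruct (le_lt_dec k m) as [L|L]; [now apply IHm|]. replace k with (S m) by lia.
      apply (homog_ext _ (fun al be => - / (b 1%nat * 1) * conv (tl (gfam b al be)) (pinv (gfam b al be)) m)).
      + intros al be. rewrite pinv_S. unfold gfam at 3. simpl pq. ring.
      + apply homog_scal. replace (S m) with (m + 1)%nat by lia.
        apply (homog_conv m 1 (fun al be => tl (gfam b al be)) (fun al be => pinv (gfam b al be))).
        * intros j Hj. unfold tl. rewrite Nat.add_1_r. apply G.
        * exact IHm. }
  destruct n as [|m]; simpl; [apply homog_const|]. apply homog_scal. rewrite <- Nat.add_1_r.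
  apply (homog_conv m 1 (fun al be => deriv (gfam b al be)) (fun al be => pinv (gfam b al be))).
  - intros k Hk. unfold deriv. rewrite Nat.add_1_r. apply homog_scal, G.
  - intros k Hk. now apply (P m).
Qed.

Definition sparse (x : nat -> R) (w : C) (N : nat) : Prop :=
  forall n, (n < N - 5)%nat -> n <> 1%nat -> n <> 5%nat -> dft x w N n = 0.

(** A monomial of bidegree (p, q) gives dft p * dft q, and both factors survive only for p, q in {1,
    5}; outside degrees 2 and 6 this leaves (5, 5). The number c depends on phi alone, not on the
    charges or on N. *)
Lemma qform_homog n phi : homog n phi -> n <> 2%nat -> n <> 6%nat ->
  exists c, forall x w N, sparse x w N -> (n < N - 5)%nat ->
  qform x w N phi = if Nat.eq_dec n 10 then c * (dft x w N 5 * dft x w N 5) else 0.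
Proof.
  intros H N2 N6. induction H as [p q c|n f g Hf IHf Hg IHg|n f g E Hf IHf].
  - destruct (classic (p = 5%nat /\ q = 5%nat)) as [[-> ->]|D].
    + exists c. intros x w N HS HN. rewrite (qform_mono x w N c 5 5).
      destruct (Nat.eq_dec (5 + 5) 10); [ring|lia].
    + exists 0. intros x w N HS HN. rewrite (qform_mono x w N c p q).
      assert (Z : dft x w N p = 0 \/ dft x w N q = 0).
      { destruct (Nat.eq_dec p 1), (Nat.eq_dec p 5), (Nat.eq_dec q 1), (Nat.eq_dec q 5); try lia;
          first [left; apply HS; lia|right; apply HS; lia]. }
      destruct (Nat.eq_dec (p + q) 10), Z as [-> | ->]; ring.
  - destruct (IHf N2 N6) as [c1 H1]. destruct (IHg N2 N6) as [c2 H2]. exists (c1 + c2).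
    intros x w N HS HN. rewrite qform_plus, H1, H2 by auto. destruct (Nat.eq_dec n 10); ring.
  - destruct (IHf N2 N6) as [c1 H1]. exists c1. intros x w N HS HN. rewrite <- H1 by auto.
    apply qform_ext. intros. now rewrite E.
Qed.

(** * The Grunsky inequality for odd univalent functions *)

Definition odd_series (b : nat -> C) : Prop := forall n, b (2 * n)%nat = 0.

(** Oddness kills g_1, g_3, g_5, so the logarithm of 1 + g_2 t^2 + g_4 t^4 + g_6 t^6 + ... has
    coefficients g_2 and g_6 - g_2 g_4 + g_2^3 / 3 in degrees 2 and 6. *)
Lemma log_coef_2_6 (b : nat -> C) al be : b 1%nat = 1 -> odd_series b ->
  log_coef b al be 2 = b 3%nat * pq 2 al be /\
  log_coef b al be 6 = b 7%nat * pq 6 al be - b 3%nat * b 5%nat * (pq 2 al be * pq 4 al be)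
    + b 3%nat * b 3%nat * b 3%nat / 3 * (pq 2 al be * pq 2 al be * pq 2 al be).
Proof.
  intros H1 Ho. set (g := gfam b al be). set (d := deriv (log_coef b al be)).
  assert (E : forall n, deriv g n = conv d g n) by (intros; now apply deriv_log_coef).
  assert (g0 : g O = 1) by (unfold g, gfam; rewrite H1; simpl; ring).
  assert (g1 : g 1%nat = 0) by (unfold g, gfam; replace (b 2%nat) with (RtoC 0) by (symmetry; exact (Ho 1%nat)); ring).
  assert (g3 : g 3%nat = 0) by (unfold g, gfam; replace (b 4%nat) with (RtoC 0) by (symmetry; exact (Ho 2%nat)); ring).
  assert (g5 : g 5%nat = 0) by (unfold g, gfam; replace (b 6%nat) with (RtoC 0) by (symmetry; exact (Ho 3%nat)); ring).
  assert (Dg : forall n, deriv g n = INR (S n) * g (S n)) by reflexivity.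
  assert (I2 : RtoC (INR 2) = 2) by (f_equal; simpl; ring).
  assert (I4 : RtoC (INR 4) = 4) by (f_equal; simpl; ring).
  assert (I6 : RtoC (INR 6) = 6) by (f_equal; simpl; ring).
  assert (d0 : d O = 0).
  { assert (Q := E O). rewrite Dg, g1 in Q. simpl conv in Q. rewrite g0 in Q.
    replace (d O) with (d O * 1) by ring. rewrite <- Q. ring. }
  assert (d1 : d 1%nat = 2 * g 2%nat).
  { assert (Q := E 1%nat). rewrite Dg, I2 in Q. simpl conv in Q. unfold tl in Q. rewrite g0, d0 in Q.
    rewrite Q. ring. }
  assert (d2 : d 2%nat = 0).
  { assert (Q := E 2%nat). rewrite Dg, g3 in Q. simpl conv in Q. unfold tl in Q. rewrite g0, g1, d0 in Q.
    transitivity (0 * g 2%nat + (d 1%nat * 0 + d 2%nat * 1)); [ring|]. rewrite <- Q. ring. }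
  assert (d3 : d 3%nat = 4 * g 4%nat - 2 * g 2%nat * g 2%nat).
  { assert (Q := E 3%nat). rewrite Dg, I4 in Q. simpl conv in Q. unfold tl in Q. rewrite g0, g1, d0, d1, d2 in Q.
    rewrite Q. ring. }
  assert (d4 : d 4%nat = 0).
  { assert (Q := E 4%nat). rewrite Dg, g5 in Q. simpl conv in Q. unfold tl in Q. rewrite g0, g1, g3, d0, d2 in Q.
    transitivity (0 * g 4%nat + (d 1%nat * 0 + (0 * g 2%nat + (d 3%nat * 0 + d 4%nat * 1)))); [ring|]. rewrite <- Q. ring. }
  assert (d5 : d 5%nat = 6 * g 6%nat - 6 * (g 2%nat * g 4%nat) + 2 * (g 2%nat * g 2%nat * g 2%nat)).
  { assert (Q := E 5%nat). rewrite Dg, I6 in Q. simpl conv in Q. unfold tl in Q.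
    rewrite g0, g1, g3, d0, d1, d2, d3, d4 in Q. rewrite Q. ring. }
  assert (Ld : forall n, log_coef b al be (S n) = / INR (S n) * d n).
  { intros n. unfold d. change (deriv (log_coef b al be) n) with (INR (S n) * log_coef b al be (S n)).
    field. apply INR_S_neq. }
  split; rewrite Ld.
  - rewrite d1, I2. unfold g, gfam. field.
  - rewrite d5, I6. unfold g, gfam. field.
Qed.

Lemma qform_log_coef_2_6 (b : nat -> C) x w N : b 1%nat = 1 -> odd_series b -> sparse x w N -> (15 < N)%nat ->
  qform x w N (fun al be => log_coef b al be 2) = b 3%nat * (dft x w N 1 * dft x w N 1) /\
  qform x w N (fun al be => log_coef b al be 6) =
   2 * (b 7%nat - 2 * b 3%nat * b 5%nat + b 3%nat * b 3%nat * b 3%nat) * (dft x w N 1 * dft x w N 5).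
Proof.
  intros H1 Ho HS HN. split.
  - rewrite (qform_ext x w N _ (fun al be => (fun al be => b 3%nat * al ^ 0 * be ^ 2) al be +
      ((fun al be => b 3%nat * al ^ 1 * be ^ 1) al be + (fun al be => b 3%nat * al ^ 2 * be ^ 0) al be))).
    + rewrite !qform_plus, !qform_mono. rewrite (HS 0%nat), (HS 2%nat) by lia. ring.
    + intros i j. destruct (log_coef_2_6 b (w ^ i) (w ^ j) H1 Ho) as [-> _].
      generalize (w ^ i) (w ^ j). intros al be. simpl. ring.
  - set (A := b 7%nat). set (B := b 3%nat * b 5%nat). set (D := b 3%nat * b 3%nat * b 3%nat).
    set (m := fun c p q (al be : C) => c * al ^ p * be ^ q).
    (* Only the two mixed monomials with exponents 1 and 5 matter. They occur once in [pq 6], twice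
       in [pq 2] [pq 4] and three times in the cube of [pq 2], hence A - 2 B + D. *)
    rewrite (qform_ext x w N _ (fun al be => m (A - B + D / 3) 0%nat 6%nat al be + (m (A - 2 * B + D) 1%nat 5%nat al be
      + (m (A - 3 * B + 2 * D) 2%nat 4%nat al be + (m (A - 3 * B + 7 * D / 3) 3%nat 3%nat al be
      + (m (A - 3 * B + 2 * D) 4%nat 2%nat al be + (m (A - 2 * B + D) 5%nat 1%nat al be
      + m (A - B + D / 3) 6%nat 0%nat al be))))))).
    + rewrite !qform_plus. unfold m. rewrite !qform_mono.
      rewrite (HS 0%nat), (HS 2%nat), (HS 3%nat), (HS 4%nat), (HS 6%nat) by lia.
      unfold A, B, D. ring.
    + intros i j. destruct (log_coef_2_6 b (w ^ i) (w ^ j) H1 Ho) as [_ ->].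
      fold A. fold B. fold D. generalize (w ^ i) (w ^ j). intros al be. unfold m. simpl. field.
Qed.

(** c is the coefficient of al^5 be^5 in degree 10. Its value is not computed; what matters is that
    it is the same for all charges and all N. *)
Lemma qform_log_coef_sum (b : nat -> C) : b 1%nat = 1 -> odd_series b ->
  exists c, forall x w N (r : R), sparse x w N -> (15 < N)%nat ->
  csum (fun n => r ^ n * qform x w N (fun al be => log_coef b al be n)) (N - 5) =
   r ^ 2 * b 3%nat * (dft x w N 1 * dft x w N 1)
   + 2 * r ^ 6 * (b 7%nat - 2 * b 3%nat * b 5%nat + b 3%nat * b 3%nat * b 3%nat) * (dft x w N 1 * dft x w N 5)
   + r ^ 10 * c * (dft x w N 5 * dft x w N 5).
Proof.
  intros H1 Ho. destruct (qform_homog 10 _ (homog_log_coef b 10) ltac:(lia) ltac:(lia)) as [c Hc].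
  exists c. intros x w N r HS HN. destruct (qform_log_coef_2_6 b x w N H1 Ho HS HN) as [E2 E6].
  set (T2 := r ^ 2 * b 3%nat * (dft x w N 1 * dft x w N 1)).
  set (T6 := 2 * r ^ 6 * (b 7%nat - 2 * b 3%nat * b 5%nat + b 3%nat * b 3%nat * b 3%nat) * (dft x w N 1 * dft x w N 5)).
  set (T10 := r ^ 10 * c * (dft x w N 5 * dft x w N 5)).
  rewrite (csum_ext _ (fun n => (if Nat.eq_dec n 2 then T2 else 0) + ((if Nat.eq_dec n 6 then T6 else 0)
     + (if Nat.eq_dec n 10 then T10 else 0)))).
  - rewrite !csum_plus, !csum_delta.
    destruct (le_lt_dec (N - 5) 2), (le_lt_dec (N - 5) 6), (le_lt_dec (N - 5) 10); try lia. ring.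
  - intros n Hn. destruct (Nat.eq_dec n 2) as [->|D2].
    { rewrite E2. destruct (Nat.eq_dec 2 6), (Nat.eq_dec 2 10); try lia. unfold T2. ring. }
    destruct (Nat.eq_dec n 6) as [->|D6].
    { rewrite E6. destruct (Nat.eq_dec 6 10); try lia. unfold T6. ring. }
    destruct (qform_homog n _ (homog_log_coef b n) D2 D6) as [c' Hc'].
    destruct (Nat.eq_dec n 10) as [->|D10].
    + rewrite (Hc x w N HS Hn). destruct (Nat.eq_dec 10 10); [|lia]. unfold T10. ring.
    + rewrite (Hc' x w N HS Hn). destruct (Nat.eq_dec n 10); [lia|]. ring.
Qed.

(** The positivity of the energy was proved for real charges, hence a real part. It splits into the
    four frequencies 1, 5, N - 1, N - 5, with amplitudes half of y1, y5 or their conjugates. *)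
Lemma charges_exist (y1 y5 : C) N w : (15 < N)%nat -> prim_root N w ->
  exists x : nat -> R, sparse x w N /\ rsum x N = 0%R /\ (forall i, (Rabs (x i) <= Cmod y1 + Cmod y5)%R) /\
  dft x w N 1 = INR N / 2 * y1 /\ dft x w N 5 = INR N / 2 * y5.
Proof.
  intros HN Hw. pose proof Hw as (W1 & W2 & W3).
  (* The conjugates are there because [dft] at 1 and 5 picks the amplitudes of w^(-i) and w^(-5i),
     which are then y1/2 and y5/2. *)
  exists (fun i => Re (Cconj y1 * w ^ i + Cconj y5 * (w ^ i) ^ 5)). set (x := fun i => Re _).
  assert (Cw : forall k, (k <= N)%nat -> Cconj (w ^ k) = w ^ (N - k)).
  { intros k Hk. assert (E : w ^ k * Cconj (w ^ k) = 1).
    { rewrite <- Cmod2_conj, Cmod_pow, W2, !pow1. reflexivity. }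
    assert (E2 : w ^ k * w ^ (N - k) = 1) by (rewrite <- Cpow_add_r, <- W1; f_equal; lia).
    replace (Cconj (w ^ k)) with (w ^ k * w ^ (N - k) * Cconj (w ^ k)) by (rewrite E2; ring).
    replace (w ^ k * w ^ (N - k) * Cconj (w ^ k)) with (w ^ (N - k) * (w ^ k * Cconj (w ^ k))) by ring.
    rewrite E. ring. }
  set (T := fun m => csum (fun i => (w ^ m) ^ i) N).
  assert (X : forall n, dft x w N n = / 2 * (Cconj y1 * T (n + 1)%nat + y1 * T (n + (N - 1))%nat
     + (Cconj y5 * T (n + 5)%nat + y5 * T (n + (N - 5))%nat))).
  { intros n. unfold dft, T. rewrite <- !csum_scal, <- !csum_plus, <- csum_scal. apply csum_ext. intros i _.
    unfold x. rewrite re_alt, !Cplus_conj, !Cmult_conj, !Cconj_conj.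
    assert (S1 : forall k m, (w ^ i) ^ k * (w ^ i) ^ m = (w ^ (m + k)) ^ i).
    { intros k m. rewrite <- Cpow_add_r, <- !Cpow_mult_r. f_equal. lia. }
    assert (S2 : forall k, (k <= N)%nat -> Cconj ((w ^ i) ^ k) = (w ^ i) ^ (N - k)).
    { intros k Hk. rewrite <- Cpow_mult_r, Nat.mul_comm, Cpow_mult_r, Cpow_conj, Cw by exact Hk.
      rewrite <- !Cpow_mult_r. f_equal. lia. }
    rewrite (S2 5%nat) by lia.
    assert (S3 := S2 1%nat ltac:(lia)). rewrite Cpow_1_r in S3. rewrite S3.
    rewrite <- (S1 1%nat n), <- (S1 (N - 1)%nat n), <- (S1 5%nat n), <- (S1 (N - 5)%nat n), Cpow_1_r. field. }
  assert (T0 : forall m, (0 < m < 2 * N)%nat -> m <> N -> T m = 0).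
  { intros m Hm D. apply prim_root_sum; [exact Hw|]. intros Z. apply Nat.Div0.mod_divides in Z.
    destruct Z as [[|[|c]] Hc]; nia. }
  assert (TN : T N = INR N). { apply prim_root_sum1; [exact Hw|]. apply Nat.Div0.mod_same. }
  assert (HS : sparse x w N).
  { intros n H1 H2 H3. rewrite X, !T0 by lia. ring. }
  split; [exact HS|]. split.
  { assert (Z := HS O ltac:(lia) ltac:(lia) ltac:(lia)). unfold dft in Z.
    rewrite (csum_ext _ (fun i => RtoC (x i))), <- RtoC_rsum in Z by (intros; simpl; ring).
    now apply RtoC_inj in Z. }
  split.
  { intros i. unfold x. eapply Rle_trans; [apply re_le_Cmod|]. eapply Rle_trans; [apply Cmod_triangle|].
    rewrite !Cmod_mult, !Cmod_conj, !Cmod_pow, W2, !pow1. lra. }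
  split; rewrite X.
  - replace (1 + (N - 1))%nat with N by lia. rewrite TN, !T0 by lia. field.
  - replace (5 + (N - 5))%nat with N by lia. rewrite TN, !T0 by lia. field.
Qed.

(** With d = mu^(-3), (1 - d)^N (1 + d)^N <= 1 and Bernoulli gives (1 + d)^N >= 1 + N d = 1 + 1/mu.
    It controls the denominator 1 - rho^N of [lnZ_sum]. *)
Lemma rho_pow_gap mu N : (1 <= mu)%R -> INR N = (mu ^ 2)%R ->
  (/ (2 * mu) <= 1 - (1 - / mu ^ 3) ^ N)%R.
Proof.
  intros Hmu HN. set (d := (/ mu ^ 3)%R).
  assert (M3 : (1 <= mu ^ 3)%R) by (rewrite <- (pow1 3); apply pow_incr; lra).
  assert (Hd : (0 < d <= 1)%R).
  { split; [apply Rinv_0_lt_compat; lra|]. unfold d. rewrite <- Rinv_1. apply Rinv_le_contravar; lra. }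
  assert (B := poly N d (proj1 Hd)).
  assert (E : (INR N * d = / mu)%R) by (rewrite HN; unfold d; field; lra). rewrite E in B.
  assert (P : ((1 - d) ^ N * (1 + d) ^ N <= 1)%R).
  { rewrite <- Rpow_mult_distr. apply Rle_trans with (1 ^ N)%R; [apply pow_incr; nra|rewrite pow1; lra]. }
  assert (Q : (0 <= (1 - d) ^ N)%R) by (apply pow_le; lra).
  assert (I : (0 < / mu)%R) by (apply Rinv_0_lt_compat; lra).
  assert (R1 : ((1 - d) ^ N * (1 + / mu) <= 1)%R) by nra.
  replace (/ (2 * mu))%R with (/ mu / 2)%R by (field; lra).
  assert (I1 : (/ mu <= 1)%R) by (rewrite <- Rinv_1; apply Rinv_le_contravar; lra). nra.
Qed.

(* With [N = M ^ 2] points and [dl = M ^ -3] every error term is [O (1 / M)]. *)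
Lemma weak_grunsky b (r : R) : disk b -> inj_disk b -> b 1%nat = 1 -> odd_series b -> (0 < r < 1)%R ->
  exists c, forall y1 y5,
  (Re (r ^ 2 * b 3%nat * (y1 * y1)
     + 2 * r ^ 6 * (b 7%nat - 2 * b 3%nat * b 5%nat + b 3%nat * b 3%nat * b 3%nat) * (y1 * y5)
     + r ^ 10 * c * (y5 * y5))%C <= Cmod y1 ^ 2 + Cmod y5 ^ 2 / 5)%R.
Proof.
  intros Hb Hi H1 Ho Hr. destruct (qform_log_coef_sum b H1 Ho) as [c Hc]. exists c. intros y1 y5.
  set (a2 := r ^ 2 * b 3%nat) in *.
  set (a6 := 2 * r ^ 6 * (b 7%nat - 2 * b 3%nat * b 5%nat + b 3%nat * b 3%nat * b 3%nat)) in *.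
  set (a10 := r ^ 10 * c) in *.
  set (T := Re _). set (B := (Cmod y1 ^ 2 + Cmod y5 ^ 2 / 5)%R). set (X := (Cmod y1 + Cmod y5)%R).
  destruct (energy_comparison b r Hb Hi H1 Hr) as (K & HK & EC).
  set (rho := ((1 + r) / 2)%R). assert (Hrho : (r < rho < 1)%R) by (unfold rho; lra).
  destruct (log_coef_bound b rho Hb Hi H1 ltac:(lra)) as (K2 & HK2 & LB).
  set (q := (r / rho)%R).
  assert (Hq : (0 < q < 1)%R).
  { split; [apply Rdiv_lt_0_compat; lra|]. apply (Rmult_lt_reg_r rho); [lra|].
    unfold q, Rdiv. rewrite Rmult_assoc, Rinv_l; lra. }
  destruct (linear_le_pow q 1 Hq) as (KQ & HKQ & LQ).
  (* The three summands come from the comparison of energies, the Taylor tail and the high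
     frequencies. The outer 2 compensates the 1/2 left from the amplitudes N/2 and the doubled main
     terms. *)
  set (Cst := (2 * (3 * X ^ 2 * K + 2 * X ^ 2 * K2 * (2 * KQ) / (1 - q) + 8 * X ^ 2))%R).
  assert (HX2 : (0 <= X ^ 2)%R) by apply pow2_ge_0.
  assert (Main : forall M, (5 <= M)%nat -> (T - B <= Cst / INR M)%R).
  { intros M HM. set (N := (M * M)%nat). set (mu := INR M).
    assert (Hmu : (5 <= mu)%R) by (apply le_INR in HM; replace (INR 5) with 5%R in HM by (simpl; ring); exact HM).
    assert (HN : INR N = (mu ^ 2)%R) by (unfold N; rewrite mult_INR; unfold mu; ring).
    assert (N15 : (15 < N)%nat) by (unfold N; nia).
    destruct (prim_root_exists N ltac:(lia)) as [w Hw].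
    destruct (charges_exist y1 y5 N w N15 Hw) as (x & HS & Hx0 & HxX & X1 & X5). fold X in HxX.
    (* Relative to N^2, the comparison needs dl N to tend to 0 and the high frequencies, of order
       1/(N^2 dl), need dl N^2 to tend to infinity. *)
    set (dl := (/ mu ^ 3)%R).
    assert (M3 : (25 * mu <= mu ^ 3)%R) by (simpl; nra).
    assert (Hdl : (0 < dl <= 1 / 2)%R).
    { split; [apply Rinv_0_lt_compat; lra|]. unfold dl. apply (Rmult_le_reg_r (mu ^ 3)); [lra|]. rewrite Rinv_l; lra. }
    assert (E1 := EC N w x X dl ltac:(lia) Hw HxX Hx0 Hdl).
    rewrite (dsum_ext _ (fun i j => x i * x j * lnG b r w i j + x i * x j * lnZ (1 - dl) w i j)%R) in E1 by (intros; ring).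
    rewrite dsum_plus in E1.
    assert (E2 := lnG_sum x w N Hw b r rho K2 X Hb Hi H1 ltac:(lra) ltac:(lra) LB HxX (N - 5)).
    rewrite Hc in E2 by auto.
    replace (Re _) with (mu ^ 4 / 4 * T)%R in E2.
    2:{ rewrite X1, X5, HN. unfold T. rewrite <- Re_real_mult. f_equal.
        rewrite RtoC_div, !RtoC_pow by lra. unfold a2, a6, a10. field. }
    assert (E3 := lnZ_sum x w N Hw ltac:(lia) HS (1 - dl) X ltac:(lra) HxX).
    assert (S1 : forall y, (Cmod (INR N / 2 * y) ^ 2 = mu ^ 4 / 4 * Cmod y ^ 2)%R).
    { intros y. rewrite HN, <- (RtoC_div (mu ^ 2) 2) by lra. rewrite Cmod_mult, Cmod_R, Rabs_pos_eq; [field|nra]. }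
    unfold spec in E3. rewrite X1, X5, !S1 in E3. rewrite HN in *.
    set (G := dsum (fun i j => x i * x j * lnG b r w i j)%R N) in *.
    set (Z := dsum (fun i j => x i * x j * lnZ (1 - dl) w i j)%R N) in *.
    assert (Im : (0 < / mu)%R) by (apply Rinv_0_lt_compat; lra).
    assert (Pm : forall k, (0 < mu ^ k)%R) by (intros; apply pow_lt; lra).
    assert (B1 : ((mu ^ 2) ^ 2 * (dl ^ 2 * (mu ^ 2) ^ 2 + dl) + mu ^ 2 <= mu ^ 4 * (3 * / mu))%R).
    { replace ((mu ^ 2) ^ 2 * (dl ^ 2 * (mu ^ 2) ^ 2 + dl) + mu ^ 2)%R with (2 * mu ^ 2 + mu)%R by (unfold dl; field; lra).
      replace (mu ^ 4 * (3 * / mu))%R with (3 * mu ^ 3)%R by (field; lra). simpl. nra. }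
    assert (B2 : (q ^ (N - 5) <= 2 * KQ * / mu)%R).
    { specialize (LQ (N - 5)%nat). rewrite pow1 in LQ.
      assert (I5 : (INR N / 2 <= INR (S (N - 5)))%R).
      { rewrite S_INR, minus_INR by lia. rewrite HN. replace (INR 5) with 5%R by (simpl; ring). nra. }
      rewrite HN in I5. assert (Q0 : (0 <= q ^ (N - 5))%R) by (apply pow_le; lra).
      assert (mu ^ 2 / 2 * q ^ (N - 5) <= KQ)%R by nra.
      apply (Rmult_le_reg_l (mu ^ 2 / 2)); [specialize (Pm 2%nat); lra|].
      replace (mu ^ 2 / 2 * (2 * KQ * / mu))%R with (KQ * mu)%R by (field; lra). nra. }
    assert (Gap := rho_pow_gap mu N ltac:(lra) HN). fold dl in Gap.
    assert (B3 : (2 / (mu ^ 2 - 5) * ((mu ^ 2) ^ 2 * X ^ 2 / (1 - (1 - dl) ^ N)) <= mu ^ 4 * (8 * X ^ 2 * / mu))%R).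
    { assert (D1 : (mu ^ 2 / 2 <= mu ^ 2 - 5)%R) by nra.
      assert (I2m : (0 < / (2 * mu))%R) by (apply Rinv_0_lt_compat; lra).
      assert (D2 : (mu / 4 <= (mu ^ 2 - 5) * (1 - (1 - dl) ^ N))%R).
      { replace (mu / 4)%R with (mu ^ 2 / 2 * / (2 * mu))%R by (field; lra).
        specialize (Pm 2%nat). apply Rmult_le_compat; lra. }
      replace (2 / (mu ^ 2 - 5) * ((mu ^ 2) ^ 2 * X ^ 2 / (1 - (1 - dl) ^ N)))%R with
        (mu ^ 4 * (2 * X ^ 2) * / ((mu ^ 2 - 5) * (1 - (1 - dl) ^ N)))%R by (field; split; nra).
      replace (mu ^ 4 * (8 * X ^ 2 * / mu))%R with (mu ^ 4 * (2 * X ^ 2) * / (mu / 4))%R by (field; lra).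
      apply Rmult_le_compat_l; [specialize (Pm 4%nat); apply Rmult_le_pos; lra|].
      apply Rinv_le_contravar; lra. }
    assert (B4 : ((mu ^ 2) ^ 2 * X ^ 2 * K2 * q ^ (N - 5) / (1 - q) <= mu ^ 4 * (X ^ 2 * K2 * (2 * KQ * / mu) / (1 - q)))%R).
    { replace ((mu ^ 2) ^ 2 * X ^ 2 * K2 * q ^ (N - 5) / (1 - q))%R with (mu ^ 4 * (X ^ 2 * K2 / (1 - q)) * q ^ (N - 5))%R by (field; lra).
      replace (mu ^ 4 * (X ^ 2 * K2 * (2 * KQ * / mu) / (1 - q)))%R with (mu ^ 4 * (X ^ 2 * K2 / (1 - q)) * (2 * KQ * / mu))%R by (field; lra).
      apply Rmult_le_compat_l; [|exact B2]. specialize (Pm 4%nat). apply Rmult_le_pos; [lra|].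
      apply Rmult_le_pos; [apply Rmult_le_pos; lra|]. left. apply Rinv_0_lt_compat. lra. }
    assert (B5 : (X ^ 2 * K * ((mu ^ 2) ^ 2 * (dl ^ 2 * (mu ^ 2) ^ 2 + dl) + mu ^ 2) <= X ^ 2 * K * (mu ^ 4 * (3 * / mu)))%R).
    { apply Rmult_le_compat_l; [apply Rmult_le_pos; lra|exact B1]. }
    fold q in E2.
    assert (Fin : (mu ^ 4 * (T - B) <= mu ^ 4 * (Cst / mu))%R).
    { replace (mu ^ 4 * (Cst / mu))%R with (2 * (X ^ 2 * K * (mu ^ 4 * (3 * / mu)) +
        2 * (mu ^ 4 * (X ^ 2 * K2 * (2 * KQ * / mu) / (1 - q))) + mu ^ 4 * (8 * X ^ 2 * / mu)))%R.
      2:{ unfold Cst. field. lra. }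
      unfold B. lra. }
    apply (Rmult_le_reg_l (mu ^ 4)); [apply Pm|exact Fin]. }
  apply Rnot_lt_le. intros L.
  destruct (INR_unbounded (Cst / (T - B))) as [M0 HM0]. set (M := (M0 + 5)%nat).
  specialize (Main M ltac:(lia)). assert (PM : (0 < INR M)%R) by (apply lt_0_INR; lia).
  assert (HM : (Cst / (T - B) < INR M)%R) by (unfold M; rewrite plus_INR; pose proof (pos_INR 5); lra).
  apply (Rmult_le_compat_r (INR M)) in Main; [|lra].
  replace (Cst / INR M * INR M)%R with Cst in Main by (field; lra).
  apply (Rmult_lt_compat_r (T - B)) in HM; [|lra].
  replace (Cst / (T - B) * (T - B))%R with Cst in HM by (field; lra). lra.
Qed.

(* Polarisation: adding the inequality at [(1 + conj a, 5 conj d)] and at [i (1 - conj a, - 5 conj d)]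
   removes the unknown coefficient [e]. *)
Lemma polarize (a d e : C) :
  (forall y1 y5, (Re (a * (y1 * y1) + 2 * d * (y1 * y5) + e * (y5 * y5))%C <= Cmod y1 ^ 2 + Cmod y5 ^ 2 / 5)%R) ->
  (Cmod a ^ 2 + 5 * Cmod d ^ 2 <= 1)%R.
Proof.
  intros H. assert (H1 := H (1 + Cconj a) (5 * Cconj d)). assert (H2 := H (Ci * (1 - Cconj a)) (- (5 * Ci * Cconj d))).
  rewrite !Cmod2_alt in *. destruct a as [p q], d as [s t], e as [u v].
  unfold Re, Im in *; simpl in *. lra.
Qed.

Lemma area_bound b : disk b -> inj_disk b -> b 1%nat = 1 -> odd_series b ->
  (Cmod (b 3%nat) ^ 2 + 5 * Cmod (b 7%nat - 2 * b 3%nat * b 5%nat + b 3%nat * b 3%nat * b 3%nat)%C ^ 2 <= 1)%R.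
Proof.
  intros Hb Hi H1 Ho. set (om := (b 7%nat - 2 * b 3%nat * b 5%nat + b 3%nat * b 3%nat * b 3%nat)%C).
  set (S := (Cmod (b 3%nat) ^ 2 + 5 * Cmod om ^ 2)%R). apply Rnot_lt_le. intros L.
  (* For r = 1 - e, Bernoulli gives r^12 S >= (1 - 12 e) S = (S + 1)/2 > 1. Here r^12 is the smaller
     of the two factors r^4 and r^12 that the squared moduli carry. *)
  set (e := ((S - 1) / (24 * S))%R).
  assert (He : (0 < e)%R) by (apply Rdiv_lt_0_compat; lra).
  assert (Ee : (24 * (e * S) = S - 1)%R) by (unfold e; field; lra).
  assert (He1 : (e < 1)%R) by nra.
  destruct (weak_grunsky b (1 - e) Hb Hi H1 Ho ltac:(lra)) as [c Hc]. fold om in Hc.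
  assert (P : (Cmod ((1 - e)%R ^ 2 * b 3%nat)%C ^ 2 + 5 * Cmod ((1 - e)%R ^ 6 * om)%C ^ 2 <= 1)%R).
  { apply (polarize _ _ ((1 - e)%R ^ 10 * c)). intros y1 y5. eapply Rle_trans; [|apply Hc].
    right. f_equal. ring. }
  rewrite !Cmod_mult, !Cmod_pow, Cmod_R, Rabs_pos_eq in P by lra.
  assert (Bern : forall n, (1 - INR n * e <= (1 - e) ^ n)%R).
  { induction n; [simpl; lra|]. rewrite S_INR. simpl. pose proof (pos_INR n).
    assert (0 <= INR n * (e * e))%R by (apply Rmult_le_pos; [lra|nra]). nra. }
  assert (B12 := Bern 12%nat). replace (INR 12) with 12%R in B12 by (simpl; ring).
  assert (P4 : ((1 - e) ^ 12 <= (1 - e) ^ 4)%R).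
  { replace 12%nat with (4 + 8)%nat by lia. rewrite pow_add.
    assert (0 <= (1 - e) ^ 4)%R by (apply pow_le; lra).
    assert ((1 - e) ^ 8 <= 1)%R by (rewrite <- (pow1 8); apply pow_incr; lra). nra. }
  assert (Q1 : ((1 - e) ^ 12 * S <= 1)%R).
  { eapply Rle_trans; [|exact P]. unfold S. rewrite !Rpow_mult_distr, <- !pow_mult. simpl (2 * 2)%nat. simpl (6 * 2)%nat.
    pose proof (pow2_ge_0 (Cmod (b 3%nat))).
    assert ((1 - e) ^ 12 * Cmod (b 3%nat) ^ 2 <= (1 - e) ^ 4 * Cmod (b 3%nat) ^ 2)%R by (apply Rmult_le_compat_r; lra). lra. }
  assert ((1 - 12 * e) * S <= (1 - e) ^ 12 * S)%R by (apply Rmult_le_compat_r; lra). lra.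
Qed.

(** * From the class S to odd univalent power series *)

Lemma csum_lim u : asum u -> forall eps, (0 < eps)%R -> exists N0, forall N, (N0 <= N)%nat ->
  (Cmod (cseries u - csum u N) < eps)%R.
Proof.
  intros Hu eps He. destruct (series_tail _ Hu eps He) as [N0 H]. exists N0. intros N HN.
  rewrite (cseries_split u N Hu). replace (csum u N + cseries (fun n => u (N + n)%nat) - csum u N) with (cseries (fun n => u (N + n)%nat)) by ring.
  eapply Rle_lt_trans; [apply cseries_bound, asum_shift, Hu|]. eapply Rle_lt_trans; [apply Rle_abs|]. now apply H.
Qed.
(** The partial sums of length 2N of one series are those of length N of the other. *)
Lemma cseries_odd u : asum u -> (forall n, u (2 * n)%nat = 0) -> asum (fun n => u (S (2 * n))) ->
  cseries u = cseries (fun n => u (S (2 * n))).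
Proof.
  intros Hu H0 Hv. assert (E : forall N, csum u (2 * N) = csum (fun n => u (S (2 * n))) N).
  { induction N; [reflexivity|]. replace (2 * S N)%nat with (S (S (2 * N))) by lia.
    cbn [csum]. rewrite IHN, H0. ring. }
  replace (cseries u) with (cseries (fun n => u (S (2 * n))) + (cseries u - cseries (fun n => u (S (2 * n))))) by ring.
  rewrite (Cmod_eq_0 (cseries u - _)); [ring|].
  apply Rle_antisym; [|apply Cmod_ge_0]. apply le_epsilon. intros e He.
  destruct (csum_lim u Hu (e / 2) ltac:(lra)) as [N1 B1]. destruct (csum_lim _ Hv (e / 2) ltac:(lra)) as [N2 B2].
  specialize (B1 (2 * (N1 + N2))%nat ltac:(lia)). specialize (B2 (N1 + N2)%nat ltac:(lia)). rewrite E in B1.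
  set (P := csum _ (N1 + N2)) in *.
  match goal with |- (Cmod (?A - ?D) <= _)%R => replace (A - D) with ((A - P) + - (D - P)) by ring end.
  eapply Rle_trans; [apply Cmod_triangle|]. rewrite Cmod_opp. lra.
Qed.

Lemma is_series_C_parts (u : nat -> C) (l : C) : is_series (K := C_AbsRing) (V := C_NormedModule) u l ->
  is_series (fun n => Re (u n)) (Re l) /\ is_series (fun n => Im (u n)) (Im l).
Proof.
  intros H.
  assert (Q : forall eps : posreal, exists N, forall n, (N <= n)%nat -> (Cmod (sum_n u n - l) < eps)%R).
  { intros eps. exact (proj1 (filterlim_locally_ball_norm (K := C_AbsRing) (U := C_NormedModule) _ _) H eps). }
  assert (ER : forall n, Re (sum_n u n) = sum_f_R0 (fun k => Re (u k)) n).
  { induction n; [now rewrite sum_O|]. rewrite sum_Sn. simpl sum_f_R0. now rewrite <- IHn. }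
  assert (EI : forall n, Im (sum_n u n) = sum_f_R0 (fun k => Im (u k)) n).
  { induction n; [now rewrite sum_O|]. rewrite sum_Sn. simpl sum_f_R0. now rewrite <- IHn. }
  split; apply is_series_Reals; intros eps He; destruct (Q (mkposreal eps He)) as [N HN]; exists N; intros n Hn;
    specialize (HN n Hn); simpl in HN; unfold Rdist.
  - rewrite <- ER. eapply Rle_lt_trans; [|exact HN]. apply (re_le_Cmod (sum_n u n - l)).
  - rewrite <- EI. eapply Rle_lt_trans; [|exact HN]. apply (im_le_Cmod (sum_n u n - l)).
Qed.
Lemma pow_n_Cpow (z : C) n : pow_n (K := C_AbsRing) z n = z ^ n.
Proof. induction n; [reflexivity|]. rewrite Cpow_S, <- IHn. reflexivity. Qed.

(** Convergence at a larger x < 1 makes the terms tend to 0, which places x within the radius of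
    convergence; the convergence at r < x is then absolute. *)
Lemma real_disk (u : nat -> R) : (forall r, (0 <= r < 1)%R -> ex_series (fun n => u n * r ^ n)%R) ->
  forall r, (0 <= r < 1)%R -> ex_series (fun n => Rabs (u n) * r ^ n)%R.
Proof.
  intros H r Hr. set (x := ((1 + r) / 2)%R).
  assert (C : Rbar_le x (CV_radius u)).
  { apply Rbar_not_lt_le. intros L.
    apply (CV_disk_outside u x).
    - rewrite Rabs_pos_eq by (unfold x; lra). exact L.
    - apply ex_series_lim_0, H. unfold x; lra. }
  assert (D := CV_disk_inside u r). apply (ex_series_ext (fun n => Rabs (u n * r ^ n))).
  - intros n. rewrite Rabs_mult, (Rabs_pos_eq (r ^ n)); [reflexivity|apply pow_le; lra].
  - apply D. eapply Rbar_lt_le_trans; [|exact C]. simpl. rewrite Rabs_pos_eq; unfold x; lra.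
Qed.

Lemma pseries_disk (a : nat -> C) (f : C -> C) : (forall z, (Cmod z < 1)%R -> is_pseries a z (f z)) ->
  disk a /\ forall z, (Cmod z < 1)%R -> f z = peval a z.
Proof.
  intros H.
  assert (P : forall z, (Cmod z < 1)%R -> is_series (fun n => Re (a n * z ^ n)) (Re (f z)) /\
     is_series (fun n => Im (a n * z ^ n)) (Im (f z))).
  { intros z Hz. apply is_series_C_parts. eapply is_series_ext; [|exact (H z Hz)].
    intros n. rewrite <- pow_n_Cpow. apply Cmult_comm. }
  assert (Ar : forall n (r : R), Re (a n * r ^ n) = (Re (a n) * r ^ n)%R /\ Im (a n * r ^ n) = (Im (a n) * r ^ n)%R).
  { intros n r. rewrite <- RtoC_pow. unfold Re, Im. simpl. split; ring. }
  assert (Cr : forall r : R, (0 <= r < 1)%R -> (Cmod r < 1)%R) by (intros; rewrite Cmod_R, Rabs_pos_eq; lra).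
  split.
  - intros r Hr.
    (* Real points of the disk suffice here: there the real and imaginary parts of the coefficients
       give two real power series. *)
    assert (XR := real_disk (fun n => Re (a n)) (fun r Hr => ex_series_ext _ _ (fun n => proj1 (Ar n r)) (ex_intro _ _ (proj1 (P _ (Cr r Hr))))) r Hr).
    assert (XI := real_disk (fun n => Im (a n)) (fun r Hr => ex_series_ext _ _ (fun n => proj2 (Ar n r)) (ex_intro _ _ (proj2 (P _ (Cr r Hr))))) r Hr).
    apply (ex_series_le (V := R_CompleteNormedModule) _ (fun n => Rabs (Re (a n)) * r ^ n + Rabs (Im (a n)) * r ^ n)%R).
    + intros n. unfold norm; simpl; unfold abs; simpl.
      assert (0 <= r ^ n)%R by (apply pow_le; lra).
      rewrite Rabs_pos_eq by (apply Rmult_le_pos; [apply Cmod_ge_0|lra]).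
      rewrite <- Rmult_plus_distr_r. apply Rmult_le_compat_r; [lra|].
      destruct (a n) as [p q]. apply Cmod_le_sum.
    + apply (ex_series_plus (V := R_NormedModule) _ _ XR XI).
  - intros z Hz. destruct (P z Hz) as [P1 P2].
    unfold peval, cseries. rewrite (is_series_unique _ _ P1), (is_series_unique _ _ P2). apply surjective_pairing.
Qed.

(* [b] is the series of the odd function [F] with [F (z)^2 = f (z^2)]. *)
Lemma sqrt_transform (a : nat -> C) : disk a -> inj_disk a -> a O = 0 -> a 1%nat = 1 ->
  exists b, disk b /\ inj_disk b /\ b 1%nat = 1 /\ odd_series b /\
  a 2%nat = 2 * b 3%nat /\ a 3%nat = 2 * b 5%nat + b 3%nat * b 3%nat /\
  a 4%nat = 2 * b 7%nat + 2 * b 3%nat * b 5%nat.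
Proof.
  intros Ha Hi a0 a1. set (g := tl a).
  assert (Hg : disk g) by now apply disk_tl.
  assert (Eg : forall z, (Cmod z < 1)%R -> peval a z = z * peval g z).
  { intros z Hz. rewrite peval_tl, a0 by auto. fold g. ring. }
  assert (Z0 : forall z, (Cmod z < 1)%R -> peval a z = 0 -> z = 0).
  { intros z Hz E. apply Hi; [exact Hz|rewrite Cmod_0; lra|]. now rewrite E, peval_0, a0. }
  assert (Ng : forall z, (Cmod z < 1)%R -> peval g z <> 0).
  { intros z Hz E. assert (z = 0) by (apply Z0; [exact Hz|]; rewrite Eg, E by exact Hz; ring).
    subst z. rewrite peval_0 in E. unfold g, tl in E. rewrite a1 in E. apply RtoC_inj in E. lra. }
  destruct (sqrt_series g Hg a1 Ng) as (s & Hs & s0 & Es).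
  (* F(z) = z s(z^2), with s the square root of f(z)/z. *)
  set (b := fun n => if Nat.even n then RtoC 0 else s (Nat.div2 n)).
  assert (Be : forall n, b (2 * n)%nat = 0).
  { intros n. unfold b. rewrite Nat.even_mul. reflexivity. }
  assert (Bo : forall n, b (S (2 * n)) = s n).
  { intros n. unfold b. rewrite Nat.even_succ, Nat.odd_mul. simpl andb. cbn iota. f_equal. apply Nat.div2_succ_double. }
  assert (Hb : disk b).
  { apply disk_intro. intros Q HQ. destruct (disk_geom s Q Hs HQ) as (A & HA & B). exists A.
    intros n. unfold b. destruct (Nat.even n).
    - rewrite Cmod_0. apply Rmult_le_pos; [lra|apply pow_le; lra].
    - eapply Rle_trans; [apply B|]. apply Rmult_le_compat_l; [lra|]. apply Rle_pow; [lra|].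
      apply Nat.div2_decr. lia. }
  assert (Sq : forall z, (Cmod z < 1)%R -> (Cmod (z * z) < 1)%R).
  { intros z Hz. rewrite Cmod_mult. pose proof (Cmod_ge_0 z). nra. }
  assert (Eb : forall z, (Cmod z < 1)%R -> peval b z = z * peval s (z * z)).
  { intros z Hz. pose proof (Cmod_ge_0 z). pose proof (Cmod_ge_0 (z * z)). specialize (Sq z Hz).
    assert (A1 : asum (fun n => s n * (z * z) ^ n)) by now apply disk_asum.
    assert (E : forall n, b (S (2 * n)) * z ^ (S (2 * n)) = z * (s n * (z * z) ^ n)).
    { intros n. rewrite Bo, Cpow_S, Cpow_mult_r. replace (z ^ 2) with (z * z) by (simpl; ring). ring. }
    unfold peval. rewrite <- cseries_scal by exact A1. rewrite (cseries_odd (fun n => b n * z ^ n)).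
    - apply cseries_ext, E.
    - now apply disk_asum.
    - intros n. rewrite Be. ring.
    - apply (asum_ext (fun n => z * (s n * (z * z) ^ n))); [intros; symmetry; apply E|]. now apply asum_scal. }
  assert (Sqr : forall z, (Cmod z < 1)%R -> peval b z * peval b z = peval a (z * z)).
  { intros z Hz. specialize (Sq z Hz). pose proof (Cmod_ge_0 (z * z)). rewrite Eg, Eb by auto.
    rewrite <- (peval_ext _ _ (z * z) Es), (peval_conv s s (Cmod (z * z))); [ring|apply Hs; lra|apply Hs; lra|lra]. }
  assert (B1 : b 1%nat = s O) by exact (Bo O). assert (B3 : b 3%nat = s 1%nat) by exact (Bo 1%nat).
  assert (B5 : b 5%nat = s 2%nat) by exact (Bo 2%nat). assert (B7 : b 7%nat = s 3%nat) by exact (Bo 3%nat).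
  exists b. repeat split.
  - exact Hb.
  - intros z w Hz Hw E.
    assert (E2 : z * z = w * w).
    { apply Hi; auto. rewrite <- !Sqr by auto. now rewrite E. }
    (* From z^2 = w^2 the remaining case is z = -w. Oddness gives F(w) = -F(w), so F(w) = 0, and
       univalence of f forces w = 0. *)
    destruct (Ceq_dec z w) as [->|D]; [reflexivity|].
    assert (N : z - w <> 0). { intros Z. apply D. replace z with (z - w + w) by ring. rewrite Z. ring. }
    assert (Ez : z = - w).
    { replace z with ((z * z - w * w) / (z - w) - w) by (field; exact N). rewrite E2. field. exact N. }
    assert (Eo : peval b z = - peval b w).
    { rewrite !Eb by auto. rewrite Ez. replace (- w * - w) with (w * w) by ring. ring. }
    assert (W0 : peval b w = 0).
    { rewrite E in Eo. replace (peval b w) with ((peval b w - - peval b w) / 2) by field. rewrite <- Eo. field. }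
    assert (w * w = 0). { apply Z0; auto. rewrite <- Sqr, W0 by auto. ring. }
    assert (Cmod w = 0%R).
    { assert (Q : (Cmod w * Cmod w = 0)%R) by (rewrite <- Cmod_mult, H; apply Cmod_0). nra. }
    apply Cmod_eq_0 in H0. subst w. rewrite Ez. ring.
  - rewrite B1. exact s0.
  - exact Be.
  - rewrite B3. assert (E := Es 1%nat). simpl in E. unfold g, tl in E. rewrite <- E, s0. ring.
  - rewrite B3, B5. assert (E := Es 2%nat). simpl in E. unfold g, tl in E. rewrite <- E, s0. ring.
  - rewrite B3, B5, B7. assert (E := Es 3%nat). simpl in E. unfold g, tl in E. rewrite <- E, s0. ring.
Qed.

Theorem theorem1 (f : C -> C) (a : nat -> C) :
  class_S f a ->
  (Cmod (gamma3 a) - Cmod (gamma2 a) <= 1 / sqrt 5)%R.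
Proof.
  intros (a0 & a1 & Hf & Hinj). destruct (pseries_disk a f Hf) as [Ha Ef].
  assert (Hi : inj_disk a).
  { intros z w Hz Hw E. apply Hinj; auto. now rewrite !Ef by auto. }
  destruct (sqrt_transform a Ha Hi a0 a1) as (b & Hb & Hib & b1 & Ho & E2 & E3 & E4).
  assert (AB := area_bound b Hb Hib b1 Ho).
  set (om := (b 7%nat - 2 * b 3%nat * b 5%nat + b 3%nat * b 3%nat * b 3%nat)%C) in AB.
  assert (Key : gamma3 a = b 3%nat * gamma2 a + (om - / 6 * (b 3%nat * b 3%nat * b 3%nat))).
  { unfold gamma3, gamma2, om. rewrite E2, E3, E4. field. }
  assert (B : (Cmod (gamma3 a) <= Cmod (b 3%nat) * Cmod (gamma2 a) + (Cmod om + Cmod (b 3%nat) ^ 3 / 6))%R).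
  { rewrite Key. eapply Rle_trans; [apply Cmod_triangle|]. rewrite Cmod_mult. apply Rplus_le_compat_l.
    eapply Rle_trans; [apply Cmod_triangle|]. rewrite Cmod_opp, !Cmod_mult, <- RtoC_inv, Cmod_R by lra.
    rewrite Rabs_pos_eq by lra. right. field. }
  set (A := Cmod (b 3%nat)) in *. set (D := Cmod om) in *. set (G := Cmod (gamma2 a)) in *.
  pose proof (Cmod_ge_0 (b 3%nat)) as PA. fold A in PA. pose proof (Cmod_ge_0 om) as PD. fold D in PD.
  pose proof (Cmod_ge_0 (gamma2 a)) as PG. fold G in PG.
  set (t := (1 / sqrt 5)%R).
  assert (S5 : (0 < sqrt 5)%R) by (apply sqrt_lt_R0; lra).
  assert (Pt : (0 < t)%R) by (apply Rdiv_lt_0_compat; lra).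
  assert (Et : (t * t = / 5)%R).
  { unfold t. replace (1 / sqrt 5 * (1 / sqrt 5))%R with (/ (sqrt 5 * sqrt 5))%R by (field; lra).
    rewrite sqrt_sqrt; lra. }
  assert (t1 : (t < 3 / 5)%R) by nra. assert (t2 : (2 / 5 < t)%R) by nra.
  assert (A1 : (A <= 1)%R) by nra.
  assert (A3 : (A ^ 3 <= 1)%R) by (rewrite <- (pow1 3); apply pow_incr; lra).
  assert (A30 : (0 <= A ^ 3)%R) by (apply pow_le; lra).
  (* By the area bound, D^2 <= (1 - A^2)/5. The right side is positive as t > 2/5, and its square is
     at least t^2 - t A^3/3 >= 1/5 - A^2/5, because t A <= 3/5. *)
  assert (DD : (D <= t - A ^ 3 / 6)%R).
  { apply Rnot_lt_le. intros L.
    assert ((t - A ^ 3 / 6) * (t - A ^ 3 / 6) < D * D)%R by nra.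
    assert (t * A ^ 3 <= 3 / 5 * A ^ 2)%R.
    { replace (t * A ^ 3)%R with (t * A * A ^ 2)%R by ring. apply Rmult_le_compat_r; [apply pow2_ge_0|]. nra. }
    assert (0 <= A ^ 3 * A ^ 3)%R by now apply Rmult_le_pos. nra. }
  assert (A * G <= 1 * G)%R by (apply Rmult_le_compat_r; lra). lra.
Qed.
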